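(* Let $p$ be fixed and consider the linear model $y_i=\mathbf{x}_i^T\mathbf{b}^*+\epsilon_i$, $i=1,\dots,n$, with $\mathbf{x}_i\in\mathbb{R}^p$, $\mathbf{b}^*\in\mathbb{R}^p$ and $\epsilon_1,\dots,\epsilon_n$ i.i.d. with mean $0$ and variance $\sigma^2$. Let $\mathbf{y}=(y_1,\dots,y_n)^T$, $\mathbf{X}=[\mathbf{x}_1,\dots,\mathbf{x}_n]^T$, and assume $\mathbf{X}^T\mathbf{X}/n\to\mathbf{C}$ for a positive definite matrix $\mathbf{C}$. Let $\mathcal{A}=\{j:b^*_j\neq0\}$, let $\mathbf{C}_{11}$ be the submatrix of $\mathbf{C}$ with rows and columns indexed by $\mathcal{A}$, and $\mathbf{b}^*_1=(b^*_j)_{j\in\mathcal{A}}$. Define \[ \tilde{\mathbf{b}}_n=\arg\min_{\mathbf{b}}\ \|\mathbf{y}-\mathbf{X}\mathbf{b}\|_2^2+\frac{\eta_n}{\alpha_n}\sum_{j=1}^p\Big[\sqrt{1+2\alpha_n|b_j|}-1\Big], \] and let $\tilde{\mathbf{b}}_{n1}=(\tilde b_{nj})_{j\in\mathcal{A}}$, $\tilde{\mathcal{A}}_n=\{j:\tilde b_{nj}\neq0\}$. Suppose $\eta_n/n^{3/4}\to0$, $\eta_n/\sqrt n\to\infty$ and $\alpha_n/\sqrt n\to c_3\in(0,\infty)$. Then (1) $\lim_{n\to\infty}P(\tilde{\mathcal{A}}_n=\mathcal{A})=1$; (2) $\sqrt n(\tilde{\mathbf{b}}_{n1}-\mathbf{b}^*_1)\xrightarrow{d}N(\mathbf{0},\sigma^2\mathbf{C}_{11}^{-1})$.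 *)

(* Defs.v *)
From HB Require Import structures.
From mathcomp Require Import all_boot all_order all_algebra.
From mathcomp Require Import all_classical all_reals all_analysis.
Set Implicit Arguments. Unset Strict Implicit. Unset Printing Implicit Defensive.
Import Order.TTheory GRing.Theory Num.Theory.
Import numFieldNormedType.Exports.
Local Open Scope classical_set_scope.
Local Open Scope ring_scope.

Section defs.
Context {R : realType}.

Definition mutually_independent d (T : measurableType d) (P : probability T R)
    (X : nat -> T -> R) : Prop :=
  forall (I : seq nat) (B : nat -> set R), uniq I ->
    (forall i, measurable (B i)) ->
    P (\big[setI/setT]_(i <- I) (X i @^-1` B i)) =
    (\prod_(i <- I) P (X i @^-1` B i))%E.

Definition identically_distributed d (T : measurableType d)
    (P : probability T R) (X : nat -> T -> R) : Prop :=
  forall i (B : set R), measurable B -> P (X i @^-1` B) = P (X 0%N @^-1` B).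

Definition has_normal_law d (T : measurableType d) (P : probability T R)
    (Y : T -> R) (m v : R) : Prop :=
  forall B : set R, measurable B ->
    P (Y @^-1` B) = if v == 0 then \d_m B else normal_prob m (Num.sqrt v) B.

Definition gaussian_vector d (T : measurableType d) (P : probability T R)
    (k : nat) (G : T -> 'rV[R]_k) (S : 'M[R]_k) : Prop :=
  (forall j, measurable_fun setT (fun w => G w 0 j)) /\
  forall t : 'rV[R]_k,
    has_normal_law P (fun w => (G w *m t^T) 0 0) 0 ((t *m S *m t^T) 0 0).

Definition cvg_in_law_normal d (T : measurableType d) (P : probability T R)
    (k : nat) (Z : nat -> T -> 'rV[R]_k) (S : 'M[R]_k) : Prop :=
  exists (d' : measure_display) (T' : measurableType d')
         (Q : probability T' R) (G : T' -> 'rV[R]_k),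
    gaussian_vector Q G S /\
    forall f : 'rV[R]_k -> R, continuous f -> (exists M, forall x, `|f x| <= M) ->
      ('E_P[f \o Z n])%E @[n --> \oo] --> ('E_Q[f \o G])%E.

Definition posdef (p : nat) (C : 'M[R]_p) : Prop :=
  C^T = C /\ forall v : 'rV[R]_p, v != 0 -> 0 < (v *m C *m v^T) 0 0.

(** X^T X = \sum_{i<n} x_i^T x_i *)
Definition gram (p : nat) (x : nat -> 'rV[R]_p) (n : nat) : 'M[R]_p :=
  \sum_(i < n) (x i)^T *m x i.

Definition nzsupp (p : nat) (b : 'rV[R]_p) : {set 'I_p} := [set j | b 0 j != 0].

Definition restr_row (p : nat) (A : {set 'I_p}) (b : 'rV[R]_p) : 'rV[R]_#|A| :=
  \row_(i < #|A|) b 0 (enum_val i).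
Definition restr_mx (p : nat) (A : {set 'I_p}) (C : 'M[R]_p) : 'M[R]_#|A| :=
  \matrix_(i < #|A|, j < #|A|) C (enum_val i) (enum_val j).

Definition objective (p n : nat) (x : nat -> 'rV[R]_p) (y : nat -> R)
    (eta alpha : R) (b : 'rV[R]_p) : R :=
  \sum_(i < n) (y i - (x i *m b^T) 0 0) ^+ 2 +
  eta / alpha * \sum_(j < p) (Num.sqrt (1 + 2 * alpha * `|b 0 j|) - 1).

End defs.

(* Main.v *)
(** Put [s = sqrt n], [u = s (b - bstar)], [W_n = s^-1 \sum_(i < n) eps_i x_i] and let
    [S] be the inverse of [C11].  Up to a constant the objective is
    [u C_n u^T - 2 W_n u^T + \sum_j rho (bstar_j + u_j / s)] with [C_n -> C].  On the event
    [|W_n| <= M] its minimiser is bounded, because the slope of the penalty at the nonzero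
    [bstar_j] is of order [eta_n / n^(3/4) -> 0]; its coordinates off the support vanish,
    because the slope of the penalty on a [1/s]-neighbourhood of [0] is of order
    [eta_n / s -> +oo]; hence it is uniformly close to the solution [(W_n)_A S] of the
    unpenalised normal equations on the support.  By Chebyshev's inequality [|W_n| <= M] has
    probability close to [1], so only the central limit theorem for [(W_n)_A S] is left.

    That theorem is proved with the integrals [E cos (<t, Y> + c)] in place of characteristic
    functions: for independent [X], [Y],
    [E cos (X + Y + c) = E cos (X + c) E cos Y - E cos (X + c - pi/2) E sin Y],
    a recursion that the Taylor estimates of [cos] and [sin] solve asymptotically.  Convergence
    of these integrals gives convergence in law because a bounded continuous function is
    approximated on a ball by trigonometric polynomials with the same uniform bound (Bernstein
    polynomials in [(1 + sin (lam w_j)) / 2]). *)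

Require Import Defs.
From HB Require Import structures.
From mathcomp Require Import all_boot all_order all_algebra.
From mathcomp Require Import all_classical all_reals all_analysis.
From mathcomp Require Import measurable_realfun ring lra.
Import Order.TTheory GRing.Theory Num.Theory.
Import numFieldNormedType.Exports.
Set Implicit Arguments.
Unset Strict Implicit.
Unset Printing Implicit Defensive.
Local Open Scope classical_set_scope.
Local Open Scope ring_scope.

(** * Independence *)

(** The penalty is concave in each [|b_j|], so the objective need not be convex. Every statement
    about the minimiser therefore comes from comparing its objective value with that of one
    competitor: the true parameter for boundedness, the minimiser with its coordinates off the
    support zeroed for sparsity, the padded solution of the normal equations for closeness. The
    exponent [3/4] is made of [sqrt n] from the rescaling and of [sqrt alpha_n], of order [n^(1/4)],
    from the slope of the penalty at a fixed nonzero point. These estimates are uniform in the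
    noise: for large [n] they hold for every real sequence with [|W_n| <= M], so probability enters
    only through the tightness and the limit law of [W_n]. For the limit law only second moments are
    available; hence Taylor remainders are bounded by the smaller of a quadratic and a cubic term.
    The negligibility of each single weight is forced by the convergence of the Gram averages. *)

Section independence.
Context {R : realType} {d : measure_display} {T : measurableType d}.
Variable P : probability T R.
Implicit Types X Y : T -> R.

Lemma integrable_bounded X (M : R) : measurable_fun setT X ->
  (forall w, `|X w| <= M) -> P.-integrable setT (EFin \o X).
Proof.
move=> mX XM; apply: measurable_bounded_integrable => //.
  by rewrite (le_lt_trans (probability_le1 _ _))// ltry.
exists M; split; first exact: num_real.
by move=> x Mx w _ /=; rewrite (le_trans (XM _))// ltW.
Qed.

Definition indep2 X Y := forall A B : set R, measurable A -> measurable B ->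
  P (X @^-1` A `&` Y @^-1` B) = (P (X @^-1` A) * P (Y @^-1` B))%E.

Lemma indep2_comp X Y (u v : R -> R) :
  measurable_fun setT u -> measurable_fun setT v ->
  indep2 X Y -> indep2 (u \o X) (v \o Y).
Proof.
move=> mu mv XY A B mA mB; apply: (XY (u @^-1` A) (v @^-1` B)).
- by rewrite -[X in measurable X]setTI; exact: mu.
- by rewrite -[X in measurable X]setTI; exact: mv.
Qed.

(** A measure on the plane that agrees with the product measure on rectangles is the product
    measure, and [indep2] is exactly this agreement for the law of the pair. *)
Lemma indep2_joint (X Y : {mfun T >-> R}) : indep2 X Y ->
  forall D : set (R * R), measurable D ->
  P ((fun w => (X w, Y w)) @^-1` D) = (distribution P X \x distribution P Y)%E D.
Proof.
move=> XY D mD.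
have mZ : measurable_fun setT (fun w => (X w, Y w)) by exact: measurable_fun_pair.
pose Z : {mfun T >-> (R * R)%type} := mfun_Sub (mem_set mZ : _ \in mfun).
rewrite (@product_measure_unique _ _ _ _ _ (distribution P X) (distribution P Y)
  (distribution P Z))// => A B mA mB.
Qed.

(** Fubini's theorem for the law of the pair, which is a product. It serves the second moments of
    weighted sums as well as the cosine recursions. *)
Lemma indep2_integralM X Y : indep2 X Y ->
  P.-integrable setT (EFin \o X) -> P.-integrable setT (EFin \o Y) ->
  P.-integrable setT (EFin \o (fun w => X w * Y w)) /\
  \int[P]_w (X w * Y w) = \int[P]_w X w * \int[P]_w Y w.
Proof.
move=> XY iX iY.
have mX : measurable_fun setT X.
  by case/integrableP : iX => /measurable_EFinP.
have mY : measurable_fun setT Y.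
  by case/integrableP : iY => /measurable_EFinP.
pose X' : {mfun T >-> R} := mfun_Sub (mem_set mX : _ \in mfun).
pose Y' : {mfun T >-> R} := mfun_Sub (mem_set mY : _ \in mfun).
have mZ : measurable_fun setT (fun w => (X w, Y w)) by exact: measurable_fun_pair.
pose Z : {mfun T >-> (R * R)%type} := mfun_Sub (mem_set mZ : _ \in mfun).
pose m1 := distribution P X'; pose m2 := distribution P Y'.
have joint : forall D : set (R * R), measurable D -> distribution P Z D = (m1 \x m2)%E D.
  by move=> D mD; rewrite -(@indep2_joint X' Y').
have mf : measurable_fun setT (fun z : R * R => (z.1 * z.2)%:E).
  apply/measurable_EFinP; apply: measurable_funM; [exact: measurable_fst|exact: measurable_snd].
have iX' : (\int[P]_w `|X w|%:E < +oo)%E by case/integrableP : iX.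
have iY' : (\int[P]_w `|Y w|%:E < +oo)%E by case/integrableP : iY.
have mabs : measurable_fun setT (fun y : R => `|y|%:E).
  by apply/measurable_EFinP; exact: normr_measurable.
have eX : (\int[m1]_x `|x|%:E = \int[P]_w `|X w|%:E)%E.
  by rewrite ge0_integral_distribution.
have eY : (\int[m2]_x `|x|%:E = \int[P]_w `|Y w|%:E)%E.
  by rewrite ge0_integral_distribution.
(* Tonelli for [|z.1 * z.2|] gives the integrability that Fubini requires. *)
have ip : (m1 \x m2)%E.-integrable setT (fun z : R * R => (z.1 * z.2)%:E).
  apply/integrable12ltyP => //=.
  under eq_integral do under eq_integral do rewrite normrM EFinM.
  under eq_integral do rewrite ge0_integralZl//.
  rewrite ge0_integralZr//; last exact: integral_ge0.
  by rewrite eX eY lte_mul_pinfty// ?integral_ge0// ge0_fin_numE// integral_ge0.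
have ipush : (distribution P Z).-integrable setT (fun z : R * R => (z.1 * z.2)%:E).
  apply/integrableP; split=> //.
  rewrite (eq_measure_integral (m1 \x m2)%E); last by move=> D mD _; exact: joint.
  by case/integrableP : ip.
have iXY : P.-integrable setT (EFin \o (fun w => X w * Y w)).
  apply/integrableP; split.
    by apply/measurable_EFinP; exact: measurable_funM.
  case/integrableP : ipush => _.
  rewrite ge0_integral_distribution//; last exact: measurableT_comp.
split => //.
rewrite /Rintegral.
have -> : (\int[P]_w (X w * Y w)%:E = \int[distribution P Z]_z (z.1 * z.2)%:E)%E.
  by rewrite integral_distribution.
rewrite (eq_measure_integral (m1 \x m2)%E); last by move=> D mD _; exact: joint.
rewrite -integral12_prod_meas1// /fubini_F/=.
have i2 : m2.-integrable setT (fun y : R => y%:E).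
  apply/integrableP; split; first exact/measurable_EFinP.
  by rewrite eY.
under eq_integral do under eq_integral do rewrite EFinM.
under eq_integral do rewrite integralZl//.
have i1 : m1.-integrable setT (fun y : R => y%:E).
  apply/integrableP; split; first exact/measurable_EFinP.
  by rewrite eX.
have i2f := integrable_fin_num measurableT i2.
have e1 : (\int[m1]_x x%:E = \int[P]_w (X w)%:E)%E.
  by rewrite integral_distribution//; exact/measurable_EFinP.
have e2 : (\int[m2]_x x%:E = \int[P]_w (Y w)%:E)%E.
  by rewrite integral_distribution//; exact/measurable_EFinP.
rewrite -/m1 -/m2 -(fineK i2f) integralZr// fineM//; last exact: integrable_fin_num.
by rewrite e1 e2.
Qed.

(** Independence from [E] passes from rectangles to all events of the pair, because the law of the
    pair conditioned on [E] is again determined by its values on rectangles. *)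
Lemma indep2_joint_event (X Y : {mfun T >-> R}) (E : set T) : measurable E ->
  indep2 X Y ->
  (forall A B, measurable A -> measurable B ->
    P (X @^-1` A `&` Y @^-1` B `&` E) =
    (P (X @^-1` A) * P (Y @^-1` B) * P E)%E) ->
  forall D : set (R * R), measurable D ->
  P ((fun w => (X w, Y w)) @^-1` D `&` E) =
  (P ((fun w => (X w, Y w)) @^-1` D) * P E)%E.
Proof.
move=> mE XY XYE D mD.
have mZ : measurable_fun setT (fun w => (X w, Y w)) by exact: measurable_fun_pair.
have mZD : measurable ((fun w => (X w, Y w)) @^-1` D).
  by rewrite -[X in measurable X]setTI; exact: mZ.
have [PE0|PE0] := eqVneq (P E) 0%E.
  rewrite PE0 mule0; apply/eqP; rewrite -measure_le0 -PE0.
  by apply: le_measure; [rewrite inE; exact: measurableI|rewrite inE|exact: subIsetr].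
have PEf : (P E \is a fin_num)%E by exact: fin_num_measure.
have c0 : 0 <= fine (P E) by exact: fine_ge0.
have cn0 : fine (P E) != 0 by apply: contra_neq PE0 => c; rewrite -(fineK PEf) c.
have ci0 : 0 <= (fine (P E))^-1 by rewrite invr_ge0.
(* [nu] is the law of [(X, Y)] conditioned on [E]; the null case, where one cannot normalise, has
   been settled above. *)
pose nu := mscale (NngNum ci0)
  (measure_function_pushforward__canonical__measure_function_Measure (mrestr P mE) mZ).
have nuE F : nu F = ((fine (P E))^-1%:E * P ((fun w => (X w, Y w)) @^-1` F `&` E))%E by [].
rewrite (indep2_joint XY mD).
rewrite (@product_measure_unique _ _ _ _ _ (distribution P X) (distribution P Y) nu)//.
  apply: etrans (esym (congr1 (fun z => z * P E)%E (nuE D))).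
  by rewrite muleAC -{2}(fineK PEf) -EFinM mulVf// mul1e.
move=> A B mA mB.
rewrite [LHS]nuE.
rewrite (_ : (fun w => (X w, Y w)) @^-1` (A `*` B) = X @^-1` A `&` Y @^-1` B)//.
by rewrite XYE// muleCA -{2}(fineK PEf) -EFinM mulVf// mule1.
Qed.

(** Turns mutual independence of the noise into independence of a partial sum from the next term,
    the only form used later. *)
Lemma indep2_sum (eps : nat -> T -> R) (a : nat -> R) (m : nat) :
  (forall i, measurable_fun setT (eps i)) ->
  mutually_independent P eps ->
  indep2 (fun w => \sum_(i < m) a i * eps i w) (eps m).
Proof.
move=> meps ind.
pose S k w := \sum_(i < k) a i * eps i w.
have mS k : measurable_fun setT (S k).
  by apply: measurable_sum => i; exact: measurable_funM.
have mcap (I : seq nat) (B : nat -> set R) : (forall i, measurable (B i)) ->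
    measurable (\big[setI/setT]_(i <- I) (eps i @^-1` B i)).
  move=> mB; elim/big_ind : _ => //; first exact: measurableI.
  by move=> i _; rewrite -[X in measurable X]setTI; exact: meps.
(* The induction needs the partial sum to be independent of any finite family of later variables:
   passing from [k] to [k.+1] moves [eps k] from that family into the sum. *)
suff H k (I : seq nat) (B : nat -> set R) (A : set R) :
    uniq I -> (forall i, i \in I -> (k <= i)%N) -> (forall i, measurable (B i)) ->
    measurable A ->
    P (S k @^-1` A `&` \big[setI/setT]_(i <- I) (eps i @^-1` B i)) =
    (P (S k @^-1` A) * P (\big[setI/setT]_(i <- I) (eps i @^-1` B i)))%E.
  move=> A B mA mB.
  have := H m [:: m] (fun=> B) A isT _ (fun=> mB) mA.
  by rewrite big_seq1; apply => i; rewrite inE => /eqP ->.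
elim: k I B A => [|k IH] I B A uI kI mB mA.
  have [A0|A0] := pselect (A 0).
    rewrite (_ : S 0%N @^-1` A = setT) ?setTI ?probability_setT ?mul1e//.
    by apply/seteqP; split=> // w _; rewrite /S/= big_ord0.
  rewrite (_ : S 0%N @^-1` A = set0) ?set0I ?measure0 ?mul0e//.
  by apply/seteqP; split=> // w; rewrite /S/= big_ord0.
pose X : {mfun T >-> R} := mfun_Sub (mem_set (mS k) : _ \in mfun).
pose Y : {mfun T >-> R} := mfun_Sub (mem_set (meps k) : _ \in mfun).
have XY : indep2 X Y.
  move=> A' B' mA' mB'.
  have := IH [:: k] (fun=> B') A' isT _ (fun=> mB') mA'.
  by rewrite big_seq1; apply => i; rewrite inE => /eqP ->.
have kNI : k \notin I by apply/negP => /kI; rewrite ltnn.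
pose D := [set z : R * R | A (z.1 + a k * z.2)].
have mD : measurable D.
  have mg : measurable_fun setT (fun z : R * R => z.1 + a k * z.2).
    by apply: measurable_funD => //; apply: measurable_funM.
  by rewrite -[X in measurable X]setTI; exact: mg.
have SD : S k.+1 @^-1` A = (fun w => (X w, Y w)) @^-1` D.
  by apply/seteqP; split=> w; rewrite /D/S/= big_ord_recr.
rewrite SD; apply: indep2_joint_event => // [|A' B' mA' mB']; first exact: mcap.
(* Since [k] is not in [I], changing [B] at [k] lets the induction hypothesis at [k :: I] treat
   [eps k] and the later variables at once. *)
pose B2 i := if i == k then B' else B i.
have mB2 i : measurable (B2 i) by rewrite /B2; case: ifP.
have BB2 : \big[setI/setT]_(i <- I) (eps i @^-1` B i) =
           \big[setI/setT]_(i <- I) (eps i @^-1` B2 i).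
  rewrite big_seq [RHS]big_seq; apply: eq_bigr => i iI.
  by rewrite /B2; case: eqP => // ik; move: kNI; rewrite -ik iI.
have uk : uniq (k :: I) by rewrite /= kNI.
have kI' i : i \in k :: I -> (k <= i)%N.
  by rewrite inE => /predU1P[->//|/kI/ltnW].
have := IH (k :: I) B2 A' uk kI' mB2 mA'.
have B2k : B2 k = B' by rewrite /B2 eqxx.
by rewrite (ind (k :: I))// !big_cons -(ind I)// -BB2 B2k setIA muleA.
Qed.

End independence.

(** * Central limit theorem for weighted sums *)

Section trigonometric_estimates.
Context {R : realType}.
Implicit Types x y : R.

Lemma sin_le_id x : 0 <= x -> `|sin x| <= x.
Proof.
move=> x0.
have [|c _] := @MVT_segment R sin cos 0 x x0.
  by apply: continuous_subspaceT => t; exact: continuous_sin.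
by rewrite sin0 !subr0 => ->; rewrite normrM (ger0_norm x0) ler_piMl// cos_max.
Qed.

Lemma norm_sin_le x : `|sin x| <= `|x|.
Proof.
have [x0|x0] := leP 0 x; first by rewrite (ger0_norm x0) sin_le_id.
by rewrite (ltr0_norm x0) -normrN -sinN sin_le_id// oppr_ge0 ltW.
Qed.

Lemma one_sub_cos x : 1 - cos x = 2 * sin (x / 2) ^+ 2.
Proof.
have -> : cos x = cos ((x / 2) + (x / 2)) by congr cos; field.
by have h := cos2Dsin2 (x / 2); rewrite cosD -!expr2; lra.
Qed.

Lemma one_sub_cos_le x : 1 - cos x <= x ^+ 2 / 2.
Proof.
rewrite one_sub_cos.
have : `|sin (x / 2)| ^+ 2 <= `|x / 2| ^+ 2.
  by rewrite lerXn2r ?nnegrE ?norm_sin_le.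
rewrite !real_normK ?num_real// => h.
by apply: (le_trans (ler_wpM2l _ h)) => //; rewrite le_eqVlt; apply/orP; left; apply/eqP; field.
Qed.

(** Mean value theorem: the derivative [1 - cos] of [t - sin t] is at most quadratic. *)
Lemma sub_sin_ge0_le x : 0 <= x -> `|x - sin x| <= x ^+ 3 / 2.
Proof.
move=> x0.
have [|c cx] := @MVT_segment R (fun t => t - sin t) (fun t => 1 - cos t) 0 x x0.
  by apply: continuous_subspaceT => t; apply: cvgB => //; exact: continuous_sin.
rewrite sin0 !subr0 => ->.
have c0 : 0 <= c <= x by move: cx; rewrite in_itv.
have cge : 0 <= 1 - cos c by rewrite subr_ge0 cos_le1.
rewrite normrM (ger0_norm x0) (ger0_norm cge).
have -> : x ^+ 3 / 2 = x ^+ 2 / 2 * x by field.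
rewrite ler_wpM2r// (le_trans (one_sub_cos_le c))// ler_pM2r//.
by case/andP : c0 => ? ?; rewrite lerXn2r// nnegrE.
Qed.

Lemma sub_sin_le x : `|x - sin x| <= `|x| ^+ 3 / 2.
Proof.
have [x0|x0] := leP 0 x; first by rewrite (ger0_norm x0) sub_sin_ge0_le.
have -> : `|x - sin x| = `|(- x) - sin (- x)| by rewrite sinN -opprD normrN.
by rewrite (ltr0_norm x0) sub_sin_ge0_le// oppr_ge0 ltW.
Qed.

(** Quadratic at infinity, hence integrable under a second moment; cubic near 0, hence of smaller
    order than the variance for small arguments. *)
Definition taylor_rem x := 2 * (x ^+ 2 * Num.min 1 `|x|).

Lemma sin_taylor x : `|sin x - x| <= taylor_rem x.
Proof.
rewrite distrC /taylor_rem; have [x1|x1] := leP 1 `|x|.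
  rewrite mulr1 (le_trans (ler_normB _ _))//.
  rewrite (le_trans (lerD (lexx _) (norm_sin_le x)))//.
  by rewrite -real_normK ?num_real//; nra.
rewrite (le_trans (sub_sin_le x))// -(@real_normK _ x) ?num_real//.
have := normr_ge0 x; move: `|x| => t t0.
rewrite -exprSr; have : 0 <= t ^+ 3 by exact: exprn_ge0.
lra.
Qed.

Lemma cos_taylor x : `|cos x - 1 + x ^+ 2 / 2| <= taylor_rem x.
Proof.
rewrite /taylor_rem; have [x1|x1] := leP 1 `|x|.
  rewrite mulr1 ger0_norm; last by have := one_sub_cos_le x; lra.
  by have := cos_le1 x; have := sqr_ge0 x; lra.
(* With [1 - cos x = 2 * sin (x / 2) ^+ 2], the left-hand side is a difference of two squares; one
   factor is cubic, the other linear. *)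
have -> : cos x - 1 + x ^+ 2 / 2 = 2 * (x / 2 - sin (x / 2)) * (x / 2 + sin (x / 2)).
  have := one_sub_cos x; set s := sin _; move=> h.
  by rewrite (_ : cos x = 1 - 2 * s ^+ 2); [field|rewrite -h; ring].
rewrite !normrM (@ger0_norm _ 2)// -mulrA ler_pM2l//.
have h1 := sub_sin_le (x / 2).
have h2 : `|x / 2 + sin (x / 2)| <= `|x|.
  rewrite (le_trans (ler_normD _ _))// (le_trans (lerD (lexx _) (norm_sin_le _)))//.
  by rewrite normrM normfV (@ger0_norm _ 2)//; lra.
rewrite (le_trans (ler_pM _ _ h1 h2))//.
rewrite normrM normfV (@ger0_norm _ 2)// -(@real_normK _ x) ?num_real//.
have := normr_ge0 x; move: `|x| x1 => t t1 t0.
have -> : (t / 2) ^+ 3 / 2 * t = t ^+ 3 * t / 16 by field.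
rewrite -exprSr; have : 0 <= t ^+ 3 by exact: exprn_ge0.
by move: (t ^+ 3) => u u0; nra.
Qed.

Lemma expRN_taylor x : 0 <= x -> `|1 - x - expR (- x)| <= x ^+ 2.
Proof.
move=> x0.
have h1 : 1 - x <= expR (- x) by exact: expR_ge1Dx.
(* From [1 + x <= expR x], because [(1 - x + x ^+ 2) * (1 + x) = 1 + x ^+ 3] is at least 1. *)
have h2 : expR (- x) <= 1 - x + x ^+ 2.
  rewrite expRN; have h := expR_ge1Dx x.
  have h3 : 0 < 1 + x by lra.
  apply: (@le_trans _ _ (1 + x)^-1); first by rewrite lef_pV2 ?posrE// (lt_le_trans h3).
  rewrite -div1r ler_pdivrMr//.
  have : 0 <= x ^+ 3 by exact: exprn_ge0.
  have -> : (1 - x + x ^+ 2) * (1 + x) = 1 + x ^+ 3 by ring.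
  lra.
by rewrite distrC ger0_norm; lra.
Qed.

(** Think of [F j c] as [E cos (S_j + c)] and of [k j], [s j] as the cosine and sine integrals of
    the next summand. As [F] and [e] are bounded by 1, replacing [k] by [e] and [s] by 0 costs at
    most [dlt] each per step, and earlier errors are not amplified. The shifted value
    [F j (c - pi / 2)] is multiplied by the small [s j], so its bound 1 is enough. *)
Lemma cos_recursion (F : nat -> R -> R) (k s e dlt : nat -> R) (n : nat) (c : R) :
  (forall c, F 0%N c = cos c) ->
  (forall j c, (j < n)%N -> F j.+1 c = F j c * k j - F j (c - pi / 2) * s j) ->
  (forall j c, `|F j c| <= 1) ->
  (forall j, (j < n)%N -> `|k j - e j| <= dlt j) ->
  (forall j, (j < n)%N -> `|s j| <= dlt j) ->
  (forall j, 0 <= e j <= 1) ->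
  `|F n c - (\prod_(j < n) e j) * cos c| <= 2 * \sum_(j < n) dlt j.
Proof.
move=> F0 FS F1 + + e01; elim: n FS c => [|n IH] FS c kd sd.
  by rewrite F0 !big_ord0 mul1r subrr normr0 mulr0.
rewrite !big_ord_recr/= FS//.
have {}IH : `|F n c - \prod_(j < n) e j * cos c| <= 2 * \sum_(j < n) dlt j.
  by apply: IH => [j c' jn|j jn|j jn]; [apply: FS|apply: kd|apply: sd]; exact: ltnW.
set S := \sum_(j < n) _ in IH *; set Q := \prod_(j < n) _ in IH *.
have -> : F n c * k n - F n (c - pi / 2) * s n - Q * e n * cos c =
  (F n c * (k n - e n) - F n (c - pi / 2) * s n) + e n * (F n c - Q * cos c) by ring.
rewrite (le_trans (ler_normD _ _))//.
have h1 : `|F n c * (k n - e n)| <= dlt n.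
  by rewrite normrM (le_trans (ler_piMl _ _))// kd.
have h2 : `|F n (c - pi / 2) * s n| <= dlt n.
  by rewrite normrM (le_trans (ler_piMl _ _))// sd.
have h3 : `|e n * (F n c - Q * cos c)| <= 2 * S.
  rewrite normrM (le_trans (ler_piMl _ _))//.
  by case/andP : (e01 n) => e0 e1; rewrite ger0_norm.
have h4 := ler_normB (F n c * (k n - e n)) (F n (c - pi / 2) * s n).
lra.
Qed.

End trigonometric_estimates.

(** * Cosine and sine integrals of one small summand, and the limit of the recursion *)

Section characteristic_function.
Context {R : realType} {d : measure_display} {T : measurableType d}.
Variable P : probability T R.

Lemma le_integrableR (f g : T -> R) : measurable_fun setT f ->
  (forall w, `|f w| <= g w) -> P.-integrable setT (EFin \o g) ->
  P.-integrable setT (EFin \o f).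
Proof.
move=> mf fg ig; apply: le_integrable ig => //; first exact/measurable_EFinP.
by move=> w _ /=; rewrite lee_fin (le_trans (fg w))// ler_norm.
Qed.

Lemma integrableDR (f g : T -> R) : P.-integrable setT (EFin \o f) ->
  P.-integrable setT (EFin \o g) ->
  P.-integrable setT (EFin \o (fun w => f w + g w)).
Proof. by move=> /integrableD h /h; apply. Qed.

Lemma integrableBR (f g : T -> R) : P.-integrable setT (EFin \o f) ->
  P.-integrable setT (EFin \o g) ->
  P.-integrable setT (EFin \o (fun w => f w - g w)).
Proof. by move=> /integrableB h /h; apply. Qed.

Lemma integrableZR (r : R) (f : T -> R) : P.-integrable setT (EFin \o f) ->
  P.-integrable setT (EFin \o (fun w => r * f w)).
Proof. by move=> /(integrableZl measurableT r). Qed.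

Lemma integrable_cstR (r : R) : P.-integrable setT (EFin \o (fun=> r)).
Proof. exact: finite_measure_integrable_cst. Qed.

Lemma Rintegral_cstP (r : R) : \int[P]_w r = r.
Proof.
rewrite Rintegral_cst//.
rewrite -[RHS]mulr1; congr (_ * _).
exact: (congr1 fine (probability_setT P)).
Qed.

Lemma measurable_cos_comp (f : T -> R) : measurable_fun setT f ->
  measurable_fun setT (fun w => cos (f w)).
Proof.
move=> mf; apply: measurableT_comp => //.
by apply: continuous_measurable_fun; exact: continuous_cos.
Qed.

Lemma measurable_sin_comp (f : T -> R) : measurable_fun setT f ->
  measurable_fun setT (fun w => sin (f w)).
Proof.
move=> mf; apply: measurableT_comp => //.
by apply: continuous_measurable_fun; exact: continuous_sin.
Qed.

Lemma integrable_cos_comp (f : T -> R) : measurable_fun setT f ->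
  P.-integrable setT (EFin \o (fun w => cos (f w))).
Proof.
move=> mf; apply: (@integrable_bounded _ _ _ _ _ 1) => [|w].
  exact: measurable_cos_comp.
exact: cos_max.
Qed.

Lemma integrable_sin_comp (f : T -> R) : measurable_fun setT f ->
  P.-integrable setT (EFin \o (fun w => sin (f w))).
Proof.
move=> mf; apply: (@integrable_bounded _ _ _ _ _ 1) => [|w].
  exact: measurable_sin_comp.
exact: sin_max.
Qed.

Lemma normr_Rintegral_cos_le1 (f : T -> R) : measurable_fun setT f ->
  `|\int[P]_w cos (f w)| <= 1.
Proof.
move=> mf; rewrite (le_trans (le_normr_Rintegral _ _))//; first exact: integrable_cos_comp.
rewrite -[leRHS](Rintegral_cstP 1); apply: le_Rintegral => //.
- apply: (@integrable_bounded _ _ _ _ _ 1) => [|w].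
    by apply: measurableT_comp => //; exact: measurable_cos_comp.
  by rewrite normr_id cos_max.
- exact: integrable_cstR.
- by move=> w _; exact: cos_max.
Qed.

Lemma integrable_sqr (f : T -> R) : measurable_fun setT f ->
  P.-integrable setT (EFin \o (fun w => f w ^+ 2)) ->
  P.-integrable setT (EFin \o f).
Proof.
move=> mf i2; apply: (@le_integrableR _ (fun w => 1 + f w ^+ 2)) => //.
  by move=> w; rewrite -real_normK ?num_real//; have := normr_ge0 (f w); nra.
by apply: integrableDR => //; exact: integrable_cstR.
Qed.

Variables (X : T -> R) (s2 : R).
Hypothesis mX : measurable_fun setT X.
Hypothesis iX2 : P.-integrable setT (EFin \o (fun w => X w ^+ 2)).
Hypothesis EX0 : \int[P]_w X w = 0.
Hypothesis EX2 : \int[P]_w (X w ^+ 2) = s2.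

(** This is [taylor_rem (a * X)] divided by [a ^+ 2], at [r = |a|]. Its mean [L r] plays the role of
    the truncated second moment in Lindeberg's condition. *)
Let f (r : R) w := 2 * (X w ^+ 2 * Num.min 1 (r * `|X w|)).
Let L (r : R) := \int[P]_w f r w.

Let mf r : measurable_fun setT (f r).
Proof.
apply: measurable_funM => //; apply: measurable_funM; first exact: measurable_funX.
apply: measurable_minr => //; apply: measurable_funM => //.
exact: measurableT_comp.
Qed.

Let f_ge0 r w : 0 <= r -> 0 <= f r w.
Proof.
move=> r0; rewrite /f pmulr_rge0//; apply: mulr_ge0; first exact: sqr_ge0.
by rewrite le_min ler01/= mulr_ge0.
Qed.

Let f_le r w : f r w <= 2 * X w ^+ 2.
Proof. by rewrite ler_pM2l// ler_piMr ?sqr_ge0// ge_min lexx. Qed.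

Let i2X2 : P.-integrable setT (EFin \o (fun w => 2 * X w ^+ 2)).
Proof.
exact: integrableZR.
Qed.

Let if_ r : 0 <= r -> P.-integrable setT (EFin \o f r).
Proof.
move=> r0; apply: (le_integrableR _ _ i2X2) => // w.
by rewrite ger0_norm ?f_ge0.
Qed.

Let L_mono r r' : 0 <= r -> r <= r' -> L r <= L r'.
Proof.
move=> r0 rr'; apply: le_Rintegral => //; [exact: if_|exact/if_/(le_trans r0)|].
move=> w _; rewrite /f ler_pM2l// ler_wpM2l ?sqr_ge0//.
rewrite le_min ge_min lexx/= ge_min; apply/orP; right.
by rewrite ler_wpM2r.
Qed.

(** Dominated convergence with bound [2 * X ^+ 2]. A sequence is enough, since [L_mono] carries the
    estimate to all smaller arguments. *)
Let L_cvg0 : L n.+1%:R^-1 @[n --> \oo] --> 0.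
Proof.
have := @dominated_cvg _ _ _ P setT measurableT (fun n => EFin \o f n.+1%:R^-1)
  (fun=> 0%E) (EFin \o (fun w => 2 * X w ^+ 2)).
rewrite integral0 => H.
suff h : (\int[P]_w (EFin \o f n.+1%:R^-1) w)%E @[n --> \oo] --> 0%:E by exact: (fine_cvg h).
apply: H => //.
- by move=> n; exact/measurable_EFinP.
- move=> w _; apply: cvg_EFin; first by near=> n.
  apply: (@squeeze_cvgr _ _ _ _ (cst 0) (fun n => 2 * (X w ^+ 2 * (n.+1%:R^-1 * `|X w|)))).
  + near=> n; rewrite /= f_ge0//=.
    by rewrite /f ler_pM2l// ler_wpM2l ?sqr_ge0// ge_min lexx orbT.
  + exact: cvg_cst.
  + have -> : 0 = 2 * (X w ^+ 2 * (0 * `|X w|)) by rewrite mul0r !mulr0.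
    by apply: cvgMr; apply: cvgMr; apply: cvgMl; exact: cvg_harmonic.
- by move=> n w _ /=; rewrite lee_fin ger0_norm ?f_ge0.
Unshelve. all: by end_near. Qed.

Lemma taylor_remM a w : taylor_rem (a * X w) = a ^+ 2 * f `|a| w.
Proof. by rewrite /taylor_rem /f normrM exprMn; ring. Qed.

(** As [X] has mean 0, subtracting [a * X] under the integral changes nothing and leaves a Taylor
    remainder. *)
Lemma sin_expect_le a : `|\int[P]_w sin (a * X w)| <= a ^+ 2 * L `|a|.
Proof.
have maX : measurable_fun setT (fun w => a * X w) by exact: measurable_funM.
have iX := integrable_sqr mX iX2.
have -> : \int[P]_w sin (a * X w) = \int[P]_w (sin (a * X w) - a * X w).
  rewrite RintegralB//; [|exact: integrable_sin_comp|exact: integrableZR].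
  by rewrite RintegralZl// EX0 mulr0 subr0.
have iD : P.-integrable setT (EFin \o (fun w => sin (a * X w) - a * X w)).
  by apply: integrableBR; [exact: integrable_sin_comp|exact: integrableZR].
rewrite (le_trans (le_normr_Rintegral _ _))//.
rewrite -RintegralZl//; last exact: if_.
apply: le_Rintegral => //.
- exact: (@integrable_norm _ _ _ P setT).
- by apply: integrableZR; exact: if_.
- by move=> w _; rewrite -taylor_remM sin_taylor.
Qed.

(** The integral and the exponential are both compared with [1 - s2 * a ^+ 2 / 2]; the two errors
    are the two terms of the bound. Exponentials are chosen because their product over the summands
    depends only on the total variance. *)
Lemma cos_expect_le a :
  `|\int[P]_w cos (a * X w) - expR (- (s2 * a ^+ 2 / 2))| <=
  a ^+ 2 * L `|a| + (s2 * a ^+ 2 / 2) ^+ 2.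
Proof.
have maX : measurable_fun setT (fun w => a * X w) by exact: measurable_funM.
have s20 : 0 <= s2 by rewrite -EX2; apply: Rintegral_ge0 => w _; exact: sqr_ge0.
have i1 : P.-integrable setT (EFin \o (fun w => cos (a * X w) - 1)).
  by apply: integrableBR; [exact: integrable_cos_comp|exact: integrable_cstR].
have i2 : P.-integrable setT (EFin \o (fun w => (a ^+ 2 / 2) * X w ^+ 2)).
  exact: integrableZR.
have h : \int[P]_w cos (a * X w) =
    \int[P]_w (cos (a * X w) - 1 + (a ^+ 2 / 2) * X w ^+ 2) + (1 - s2 * a ^+ 2 / 2).
  rewrite RintegralD// RintegralZl// EX2 RintegralB//;
    [|exact: integrable_cos_comp|exact: integrable_cstR].
  by rewrite Rintegral_cstP; field.
rewrite h -addrA (le_trans (ler_normD _ _))// lerD//; last first.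
  by apply: expRN_taylor; rewrite divr_ge0// mulr_ge0// sqr_ge0.
have i3 : P.-integrable setT (EFin \o (fun w => cos (a * X w) - 1 + (a ^+ 2 / 2) * X w ^+ 2)).
  exact: integrableDR.
rewrite (le_trans (le_normr_Rintegral _ _))//.
rewrite -RintegralZl//; last exact: if_.
apply: le_Rintegral => //.
- exact: (@integrable_norm _ _ _ P setT).
- by apply: integrableZR; exact: if_.
- move=> w _; rewrite -taylor_remM.
  by rewrite (_ : a ^+ 2 / 2 * X w ^+ 2 = (a * X w) ^+ 2 / 2) ?cos_taylor//; field.
Qed.

(* Stated for any [F] obeying the cosine recursion: it is applied to weighted sums of the
   noise and also to the standard normal law, whose cosine integrals it thus computes. *)
Theorem char_limit (F : nat -> nat -> R -> R) (a : nat -> nat -> R) (v c : R) :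
  (forall n c, F n 0%N c = cos c) ->
  (forall n j c, (j < n)%N -> F n j.+1 c =
    F n j c * (\int[P]_w cos (a n j * X w)) -
    F n j (c - pi / 2) * (\int[P]_w sin (a n j * X w))) ->
  (forall n j c, `|F n j c| <= 1) ->
  (forall e, 0 < e -> \forall n \near \oo, forall i, (i < n)%N -> `|a n i| <= e) ->
  \sum_(i < n) a n i ^+ 2 @[n --> \oo] --> v ->
  F n n c @[n --> \oo] --> expR (- (s2 * v / 2)) * cos c.
Proof.
move=> F0 FS F1 amax avar.
have s20 : 0 <= s2 by rewrite -EX2; apply: Rintegral_ge0 => w _; exact: sqr_ge0.
pose V n := \sum_(i < n) a n i ^+ 2.
have prodE n : \prod_(j < n) expR (- (s2 * a n j ^+ 2 / 2)) = expR (- (s2 * V n / 2)).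
  rewrite -expR_sum; congr expR.
  rewrite sumrN; congr (- _).
  by rewrite /V mulr_sumr mulr_suml.
have h1 : expR (- (s2 * V n / 2)) * cos c @[n --> \oo] --> expR (- (s2 * v / 2)) * cos c.
  apply: cvgMl; apply: continuous_cvg; first exact: continuous_expR.
  by apply: cvgN; apply: cvgMl; apply: cvgMr.
have h2 : F n n c - expR (- (s2 * V n / 2)) * cos c @[n --> \oo] --> 0.
  apply/cvgr0Pnorm_le => e e0.
  pose K := `|v| + 1.
  have K0 : 0 < K by rewrite ltr_wpDl.
  have e4 : 0 < e / (4 * K) by rewrite divr_gt0// mulr_gt0.
  have VK : \forall n \near \oo, V n <= K.
    have /cvgrPdist_le/(_ 1 ltr01) := avar; apply: filterS => n h.
    have := ler_norm v; have := ler_norm (V n - v); rewrite distrC in h.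
    by rewrite /K; move: h; rewrite -/(V n); lra.
  (* Once all weights are below [k.+1%:R^-1], each of the two errors of [cos_expect_le] is at most
     [a n j ^+ 2 * (e / (4 * K))]. Summed with total at most [K] and doubled by [cos_recursion],
     this gives [e]. *)
  have [k [Lk sk]] : exists k : nat,
      L k.+1%:R^-1 <= e / (4 * K) /\ s2 ^+ 2 * k.+1%:R^-1 ^+ 2 <= e / (4 * K).
    have l1 : \forall k \near \oo, `|L k.+1%:R^-1| <= e / (4 * K).
      by move/cvgr0Pnorm_le : L_cvg0; exact.
    have l2 : \forall k \near \oo, `|s2 ^+ 2 * k.+1%:R^-1 ^+ 2| <= e / (4 * K).
      have : s2 ^+ 2 * (k.+1%:R^-1 * k.+1%:R^-1) @[k --> \oo] --> s2 ^+ 2 * (0 * 0 : R).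
        by apply: cvgMr; apply: cvgM; exact: cvg_harmonic.
      by rewrite !mulr0 => /cvgr0Pnorm_le; apply.
    have [k [k1 k2]] := filter_ex (filterI l1 l2).
    exists k; split; exact: (le_trans (ler_norm _)).
  set r := k.+1%:R^-1 in Lk sk.
  have r0 : 0 < r by rewrite invr_gt0.
  have := amax r r0; apply: filterS2 VK => n VK ar.
  pose dlt j := a n j ^+ 2 * L `|a n j| + (s2 * a n j ^+ 2 / 2) ^+ 2.
  rewrite -prodE (le_trans (@cos_recursion _ (F n)
    (fun j => \int[P]_w cos (a n j * X w)) (fun j => \int[P]_w sin (a n j * X w))
    (fun j => expR (- (s2 * a n j ^+ 2 / 2))) dlt n c _ _ _ _ _ _))//.
  - by move=> j c' jn; exact: FS.
  - by move=> j jn; exact: cos_expect_le.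
  - move=> j jn; apply: (le_trans (sin_expect_le _)).
    by rewrite /dlt lerDl sqr_ge0.
  - move=> j; rewrite expR_ge0/= -[leRHS]expR0 ler_expR oppr_le0.
    by rewrite divr_ge0// mulr_ge0// sqr_ge0.
  - have dj (j : 'I_n) : dlt j <= a n j ^+ 2 * (e / (4 * K) + e / (4 * K)).
      have arj := ar j (ltn_ord j).
      rewrite /dlt mulrDr lerD//.
        by rewrite ler_wpM2l ?sqr_ge0// (le_trans _ Lk)// L_mono.
      have -> : (s2 * a n j ^+ 2 / 2) ^+ 2 = a n j ^+ 2 * (s2 ^+ 2 * a n j ^+ 2 / 4) by field.
      rewrite ler_wpM2l ?sqr_ge0// (le_trans _ sk)//.
      have : `|a n j| ^+ 2 <= r ^+ 2 by rewrite lerXn2r// nnegrE// ltW.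
      rewrite real_normK ?num_real// => h.
      have := ler_wpM2l (sqr_ge0 s2) h.
      have : 0 <= s2 ^+ 2 * a n j ^+ 2 by rewrite mulr_ge0// sqr_ge0.
      lra.
    have h : \sum_(j < n) dlt j <= V n * (e / (4 * K) + e / (4 * K)).
      by rewrite mulr_suml; apply: ler_sum => j _; exact: dj.
    apply: (@le_trans _ _ (2 * (K * (e / (4 * K) + e / (4 * K))))).
      rewrite ler_pM2l// (le_trans h)// ler_wpM2r// addr_ge0// ltW//.
    rewrite le_eqVlt; apply/orP; left; apply/eqP; field.
    by rewrite gt_eqF.
rewrite -[X in _ --> X]add0r.
apply: cvg_trans (cvgD h2 h1); apply: near_eq_cvg; near=> n.
by rewrite /= subrK.
Unshelve. all: by end_near. Qed.

End characteristic_function.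

Section weighted_sums.
Context {R : realType} {d : measure_display} {T : measurableType d}.
Variables (P : probability T R) (eps : nat -> T -> R) (sigma : R).
Hypothesis meps : forall i, measurable_fun setT (eps i).
Hypothesis eps_indep : mutually_independent P eps.
Hypothesis eps_ident : identically_distributed P eps.
Hypothesis eps_L2 : forall i, eps i \in Lfun P 2%:E.
Hypothesis eps_mean : forall i, ('E_P[eps i] = 0)%E.
Hypothesis eps_var : forall i, 'V_P[eps i] = (sigma ^+ 2)%:E.

Let ieps2 i : P.-integrable setT (EFin \o (fun w => eps i w ^+ 2)).
Proof. exact: Lfun2_integrable_sqr. Qed.

Let ieps i : P.-integrable setT (EFin \o eps i).
Proof. exact: integrable_sqr. Qed.

Let Eeps i : \int[P]_w eps i w = 0.
Proof. by have := eps_mean i; rewrite unlock /Rintegral => ->. Qed.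

Let Eeps2 i : \int[P]_w (eps i w ^+ 2) = sigma ^+ 2.
Proof.
have := eps_var i; rewrite varianceE// eps_mean expe2 mule0 sube0 unlock /Rintegral.
by move=> ->.
Qed.

Lemma Rintegral_ident (h : R -> R) i : measurable_fun setT h ->
  (forall i, P.-integrable setT (EFin \o (h \o eps i))) ->
  \int[P]_w h (eps i w) = \int[P]_w h (eps 0%N w).
Proof.
move=> mh ih; rewrite /Rintegral; congr fine.
pose X j : {mfun T >-> R} := mfun_Sub (mem_set (meps j) : _ \in mfun).
have H j : (\int[P]_w (h (eps j w))%:E = \int[distribution P (X j)]_x (h x)%:E)%E.
  rewrite integral_distribution//; first exact/measurable_EFinP.
  exact: ih.
rewrite !H; apply: eq_measure_integral => A mA _.
exact: eps_ident.
Qed.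

Definition wsum (a : nat -> R) (m : nat) (w : T) := \sum_(i < m) a i * eps i w.

Lemma measurable_wsum a m : measurable_fun setT (wsum a m).
Proof. by apply: measurable_sum => i; exact: measurable_funM. Qed.

Lemma wsumS a m w : wsum a m.+1 w = wsum a m w + a m * eps m w.
Proof. by rewrite /wsum big_ord_recr. Qed.

(** Induction on [m]; the cross term has mean 0 because [eps m] is centred and independent of the
    partial sum. *)
Lemma wsum_sqr a m :
  P.-integrable setT (EFin \o (fun w => wsum a m w ^+ 2)) /\
  \int[P]_w (wsum a m w ^+ 2) = sigma ^+ 2 * \sum_(i < m) a i ^+ 2.
Proof.
elim: m => [|m [IHi IH]].
  have h0 : (fun w => wsum a 0 w ^+ 2) = (fun=> 0).
    by apply/funext => w; rewrite /wsum big_ord0 expr0n.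
  by rewrite h0 Rintegral_cstP big_ord0 mulr0; split => //; exact: integrable_cstR.
have iS : P.-integrable setT (EFin \o wsum a m).
  by apply: integrable_sqr => //; exact: measurable_wsum.
have ind : indep2 P (wsum a m) (eps m) by exact: indep2_sum.
have [iSe ESe] := indep2_integralM ind iS (ieps m).
have h : (fun w => wsum a m.+1 w ^+ 2) =
    (fun w => wsum a m w ^+ 2 + (2 * a m * (wsum a m w * eps m w) + a m ^+ 2 * eps m w ^+ 2)).
  by apply/funext => w; rewrite wsumS; ring.
have i1 : P.-integrable setT (EFin \o (fun w => 2 * a m * (wsum a m w * eps m w))).
  exact: integrableZR.
have i2 : P.-integrable setT (EFin \o (fun w => a m ^+ 2 * eps m w ^+ 2)).
  exact: integrableZR.
rewrite h; split; first by apply: integrableDR => //; exact: integrableDR.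
rewrite RintegralD//; last exact: integrableDR.
rewrite IH RintegralD// !RintegralZl// Eeps2 ESe Eeps big_ord_recr/=.
by ring.
Qed.

Lemma wsum_tail a m (M : R) : 0 < M ->
  (P [set w | M <= `|wsum a m w|]%R <=
   (sigma ^+ 2 * (\sum_(i < m) a i ^+ 2) / M ^+ 2)%:E)%E.
Proof.
move=> M0; have [iS ES] := wsum_sqr a m.
pose A := [set w | M <= `|wsum a m w|]%R.
have mA : measurable A.
  rewrite (_ : A = (fun w => `|wsum a m w|) @^-1` `[M, +oo[%classic).
    rewrite -[X in measurable X]setTI; apply: measurableT_comp => //.
    exact: measurable_wsum.
  by apply/seteqP; split => w; rewrite /A/= in_itv/= andbT.
have M20 : 0 < M ^+ 2 by exact: exprn_gt0.
rewrite EFinM lee_pdivlMr// -ES /Rintegral fineK; last exact: integrable_fin_num.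
rewrite muleC -integral_cst//.
apply: (@le_trans _ _ (\int[P]_(w in A) (wsum a m w ^+ 2)%:E)%E).
  apply: ge0_le_integral => //.
  - by move=> w _; rewrite lee_fin ltW.
  - apply/measurable_EFinP/measurable_funTS; apply: measurable_funX; exact: measurable_wsum.
  - move=> w Aw; rewrite lee_fin -(@real_normK _ (wsum a m w)) ?num_real//.
    by rewrite lerXn2r// nnegrE// ltW.
apply: ge0_subset_integral => //.
- apply/measurable_EFinP; apply: measurable_funX; exact: measurable_wsum.
- by move=> w _; rewrite lee_fin sqr_ge0.
Qed.

Theorem clt_cos (a : nat -> nat -> R) (v c : R) :
  (forall e, 0 < e -> \forall n \near \oo, forall i, (i < n)%N -> `|a n i| <= e) ->
  \sum_(i < n) a n i ^+ 2 @[n --> \oo] --> v ->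
  \int[P]_w cos (wsum (a n) n w + c) @[n --> \oo] --> expR (- (sigma ^+ 2 * v / 2)) * cos c.
Proof.
move=> amax avar.
apply: (@char_limit _ _ _ P (eps 0%N) (sigma ^+ 2) (meps 0%N) (ieps2 0%N) (Eeps 0%N)
  (Eeps2 0%N) (fun n j c => \int[P]_w cos (wsum (a n) j w + c)) a v c) => //.
- move=> n c'; rewrite -[RHS](Rintegral_cstP P); apply: eq_Rintegral => w _.
  by rewrite /wsum big_ord0 add0r.
- move=> n j c' _.
  have mcosM b : measurable_fun setT (fun x : R => cos (b * x)).
    by apply: measurable_cos_comp; exact: measurable_funM.
  have msinM b : measurable_fun setT (fun x : R => sin (b * x)).
    by apply: measurable_sin_comp; exact: measurable_funM.
  have mcosD b : measurable_fun setT (fun x : R => cos (x + b)).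
    by apply: measurable_cos_comp; exact: measurable_funD.
  have iS b : P.-integrable setT (EFin \o (fun w => cos (wsum (a n) j w + b))).
    by apply: integrable_cos_comp; apply: measurable_funD => //; exact: measurable_wsum.
  have iC b i : P.-integrable setT (EFin \o (fun w => cos (b * eps i w))).
    by apply: integrable_cos_comp; exact: measurable_funM.
  have iN b i : P.-integrable setT (EFin \o (fun w => sin (b * eps i w))).
    by apply: integrable_sin_comp; exact: measurable_funM.
  have ind : indep2 P (wsum (a n) j) (eps j) by exact: indep2_sum.
  have [i1 e1] := indep2_integralM (indep2_comp (mcosD c') (mcosM (a n j)) ind)
    (iS c') (iC (a n j) j).
  have [i2 e2] := indep2_integralM (indep2_comp (mcosD (c' - pi / 2)) (msinM (a n j)) ind)
    (iS (c' - pi / 2)) (iN (a n j) j).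
  (* Identical distribution replaces [eps 0], the single variable fed to [char_limit], by the
     [eps j] that actually occurs. *)
  rewrite -(Rintegral_ident (h := fun x => cos (a n j * x)) j)//; last by move=> i; exact: iC.
  rewrite -(Rintegral_ident (h := fun x => sin (a n j * x)) j)//; last by move=> i; exact: iN.
  rewrite -e1 -e2 -RintegralB//; apply: eq_Rintegral => w _ /=.
  rewrite wsumS addrAC (cosD (wsum (a n) j w + c')).
  by rewrite (addrA (wsum (a n) j w)) cosBpihalf.
- move=> n j c'; apply: normr_Rintegral_cos_le1.
  by apply: measurable_funD => //; exact: measurable_wsum.
Qed.

End weighted_sums.

(** * Gaussian vectors *)

Section normal_density.
Context {R : realType}.
Local Notation mu := (@lebesgue_measure R).

(** [normal_prob] is given by integrating [normal_pdf] over sets, so the density equals its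
    Radon-Nikodym derivative almost everywhere, and the change of variables for that derivative
    applies. *)
Lemma ge0_integral_normal_prob (m s : R) (f : R -> \bar R) :
  (forall x, 0 <= f x)%E -> measurable_fun setT f ->
  (\int[normal_prob m s]_x f x = \int[mu]_x (f x * (normal_pdf m s x)%:E))%E.
Proof.
move=> f0 mf.
have dom := normal_prob_dominates m s.
rewrite -(Radon_Nikodym_SigmaFinite.change_of_variables dom)//.
have ig := Radon_Nikodym_SigmaFinite.f_integrable dom.
apply: ae_eq_integral => //.
- by apply: emeasurable_funM => //; exact: measurable_int ig.
- apply: emeasurable_funM => //; apply/measurable_EFinP.
  exact: measurable_normal_pdf.
- apply: ae_eqe_mul2l; apply: integral_ae_eq => //.
  + by apply/measurable_EFinP; exact: measurable_normal_pdf.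
  + by move=> E _ mE; rewrite -Radon_Nikodym_SigmaFinite.f_integral.
Qed.

(** Both sides are measures that agree on half-open intervals. For negative [b] the preimage is
    half-open at the other end, whence the two cases. *)
Lemma lebesgue_affine (b c : R) : b != 0 -> forall A : set R, measurable A ->
  (mu A = `|b|%:E * mu ((fun x => b * x + c)%R @^-1` A))%E.
Proof.
move=> b0 A mA.
have mf : measurable_fun setT ((fun x : R => b * x + c) : measurableTypeR R -> measurableTypeR R).
  by apply: measurable_funD => //; exact: measurable_funM.
pose nu : {measure set (measurableTypeR R) -> \bar R} := mscale (NngNum (normr_ge0 b))
  (measure_function_pushforward__canonical__measure_function_Measure mu mf).
have nuE F : nu F = (`|b|%:E * mu ((fun x => b * x + c)%R @^-1` F))%E by [].
rewrite (@lebesgue_measure_unique _ nu)// => _ [[u v] _ <-] /=.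
rewrite [RHS]nuE lebesgue_measure_itv/=.
have [uv|vu] := ltP u v; last first.
  rewrite lte_fin ltNge vu/= set_itv_ge; last by rewrite bnd_simp -leNgt.
  by rewrite preimage_set0 measure0 mule0.
rewrite lte_fin uv.
have [bp|bn|bz] := ltgtP 0 b; last by rewrite -bz eqxx in b0.
- rewrite (_ : _ @^-1` _ = `](u - c) / b, (v - c) / b]%classic).
    rewrite lebesgue_measure_itv/= lte_fin ltr_pM2r ?invr_gt0// ltrD2r uv.
    rewrite gtr0_norm// -!EFinB -EFinM; congr (_%:E); field.
    by rewrite gt_eqF.
  apply/seteqP; split => x /=; rewrite !in_itv/= ltr_pdivrMr// ler_pdivlMr//;
    rewrite ltrBlDr lerBrDr (mulrC x); exact: id.
- rewrite (_ : _ @^-1` _ = `[(v - c) / b, (u - c) / b[%classic).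
    rewrite lebesgue_measure_itv/= lte_fin ltr_nM2r ?invr_lt0// ltrD2r uv.
    rewrite ltr0_norm// -!EFinB -EFinM; congr (_%:E); field.
    by rewrite lt_eqF.
  apply/seteqP; split => x /=; rewrite !in_itv/= ltr_ndivlMr// ler_ndivrMr//;
    by rewrite ltrBlDr lerBrDr (mulrC x) andbC; exact: id.
Qed.

Lemma ge0_integral_affine (b c : R) (f : R -> R) : b != 0 ->
  (forall x, 0 <= f x) -> measurable_fun setT f ->
  (\int[mu]_x (f x)%:E = `|b|%:E * \int[mu]_x (f (b * x + c)%R)%:E)%E.
Proof.
move=> b0 f0 mf.
have mg : measurable_fun setT ((fun x : R => b * x + c) : measurableTypeR R -> measurableTypeR R).
  by apply: measurable_funD => //; exact: measurable_funM.
pose pf := measure_function_pushforward__canonical__measure_function_Measure mu mg.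
pose nu : {measure set (measurableTypeR R) -> \bar R} := mscale (NngNum (normr_ge0 b)) pf.
have mf' : measurable_fun setT ((EFin \o f) : measurableTypeR R -> \bar R).
  exact/measurable_EFinP.
transitivity (\int[nu]_x (f x)%:E)%E.
  by apply: eq_measure_integral => A mA _; exact: lebesgue_affine.
rewrite ge0_integral_mscale//; last by move=> x _; rewrite lee_fin.
congr (_ * _)%E.
by rewrite ge0_integral_pushforward// => x _; rewrite lee_fin.
Qed.

End normal_density.

Section normal_moments.
Context {R : realType}.
Local Notation mu := (@lebesgue_measure R).
Let g (x : R) := expR (- (x ^+ 2 / 2)).

Let cg : continuous g.
Proof.
by move=> x; apply: differentiable_continuous; apply/derivable1_diffP; apply: ex_derive.
Qed.

Let mg : measurable_fun setT g.
Proof. exact: continuous_measurable_fun. Qed.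

(** An antiderivative of [(1 - x ^+ 2) * g x] that vanishes at 0 and at infinity; this is what makes
    the integrals of [x ^+ 2 * g x] and [g x] equal. *)
Let F (x : R) := x * g x.

Let dF (x : R) : is_derive x 1 F ((1 - x ^+ 2) * g x).
Proof.
rewrite /F; apply: is_derive_eq.
by rewrite /g /GRing.scale/=; field.
Qed.

Let cF : continuous F.
Proof.
by move=> x; apply: differentiable_continuous; apply/derivable1_diffP; apply: ex_derive.
Qed.

Let F_cvg0 : F x @[x --> +oo] --> 0.
Proof.
apply/cvgrPdist_le => e e0; near=> x.
have x0 : 0 < x by near: x; exact: nbhs_pinfty_gt.
have xe : 2 / e <= x by near: x; apply: nbhs_pinfty_ge; exact: num_real.
rewrite sub0r normrN /F /g expRN ger0_norm; last first.
  by rewrite mulr_ge0// ?ltW// invr_ge0 expR_ge0.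
have h := expR_ge1Dx (x ^+ 2 / 2).
rewrite ler_pdivrMr ?expR_gt0//.
rewrite ler_pdivrMr// in xe.
apply: (le_trans _ (ler_wpM2l (ltW e0) h)).
nra.
Unshelve. all: by end_near. Qed.

(** The fundamental theorem on a half-line is applied to a nonnegative integrand, and [x ^+ 2 - 1]
    changes sign at 1; hence the cut there. *)
Let int_y : (\int[mu]_(x in `[1%R, +oo[) (x ^+ 2 * g x)%R%:E =
  \int[mu]_(x in `[1%R, +oo[) (g x)%:E + (g 1)%:E)%E.
Proof.
have m1 : measurable (`[1, +oo[%classic : set R) by exact: measurable_itv.
have h : (\int[mu]_(x in `[1%R, +oo[) ((x ^+ 2 - 1) * g x)%:E = (g 1)%:E)%E.
  rewrite (@ge0_continuous_FTC2y _ _ (fun x => - F x) 1 0).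
  - by rewrite sub0e -EFinN opprK /F mul1r.
  - move=> x x1; rewrite mulr_ge0 ?expR_ge0// subr_ge0 expr2.
    by rewrite (le_trans x1)// ler_peMr// (le_trans ler01).
  - apply: continuous_subspaceT => x; apply: cvgM; last exact: cg.
    by apply: cvgB; [exact: exprn_continuous|exact: cvg_cst].
  - by rewrite -oppr0; apply: cvgN.
  - by move=> x _; apply: derivableN; exact: ex_derive.
  - by apply: cvgN; apply: cvg_at_right_filter; exact: cF.
  - move=> x _; rewrite derive1E deriveN; last exact: ex_derive.
    by rewrite (@derive_val _ _ _ _ _ _ _ (dF x)); ring.
rewrite -h -ge0_integralD//.
- by apply: eq_integral => x _; rewrite -EFinD; congr (_%:E); ring.
- by move=> x _; rewrite lee_fin expR_ge0.
- exact/measurable_EFinP/measurable_funTS.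
- move=> x /=; rewrite in_itv/= andbT => x1; rewrite lee_fin.
  rewrite mulr_ge0 ?expR_ge0// subr_ge0 expr2.
  by rewrite (le_trans x1)// ler_peMr// (le_trans ler01).
- apply/measurable_EFinP/measurable_funTS/measurable_funM => //.
  by apply: measurable_funB => //; exact: measurable_funX.
Qed.

Let int_1 : (\int[mu]_(x in `[0%R, 1%R]) (x ^+ 2 * g x)%R%:E + (g 1)%:E =
  \int[mu]_(x in `[0%R, 1%R]) (g x)%:E)%E.
Proof.
have h : (\int[mu]_(x in `[0%R, 1%R]) ((1 - x ^+ 2) * g x)%:E = (g 1)%:E)%E.
  rewrite (@continuous_FTC2 _ _ F 0 1)//.
  - by rewrite /F mul0r mul1r sube0.
  - apply: continuous_subspaceT => x; apply: cvgM; last exact: cg.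
    by apply: cvgB; [exact: cvg_cst|exact: exprn_continuous].
  - split.
    + by move=> x _; exact: ex_derive.
    + by apply: cvg_at_right_filter; exact: cF.
    + by apply: cvg_at_left_filter; exact: cF.
  - by move=> x _; rewrite derive1E (@derive_val _ _ _ _ _ _ _ (dF x)).
rewrite -h -ge0_integralD//.
- by apply: eq_integral => x _; rewrite -EFinD; congr (_%:E); ring.
- by move=> x _; rewrite lee_fin mulr_ge0 ?sqr_ge0 ?expR_ge0.
- apply/measurable_EFinP/measurable_funTS/measurable_funM => //.
- move=> x /=; rewrite in_itv/= => /andP[x0 x1]; rewrite lee_fin.
  by rewrite mulr_ge0 ?expR_ge0// subr_ge0 exprn_ile1.
- apply/measurable_EFinP/measurable_funTS/measurable_funM => //.
  by apply: measurable_funB => //; exact: measurable_funX.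
Qed.

Let int_sqr : (\int[mu]_x (x ^+ 2 * g x)%R%:E = \int[mu]_x (g x)%:E)%E.
Proof.
have cs : continuous (fun x : R => x ^+ 2 * g x).
  by move=> x; apply: cvgM; [exact: exprn_continuous|exact: cg].
have ms : measurable_fun setT (fun x : R => x ^+ 2 * g x) by exact: continuous_measurable_fun.
have s0 x : 0 <= x ^+ 2 * g x by rewrite mulr_ge0 ?sqr_ge0 ?expR_ge0.
have g0 x : 0 <= g x by exact: expR_ge0.
rewrite [LHS]ge0_symfun_integralT//; last by move=> x /=; rewrite /g sqrrN.
rewrite [RHS]ge0_symfun_integralT//; last by move=> x /=; rewrite /g sqrrN.
congr (_ * _)%E; rewrite -set_itvcy.
have split (f : R -> R) : measurable_fun setT f -> (forall x, 0 <= f x) ->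
    (\int[mu]_(x in `[0%R, +oo[) (f x)%:E =
     \int[mu]_(x in `[0%R, 1%R]) (f x)%:E + \int[mu]_(x in `[1%R, +oo[) (f x)%:E)%E.
  move=> mf f0.
  rewrite (@itv_bndbnd_setU _ _ _ (BRight 1))//; last by rewrite bnd_simp.
  rewrite ge0_integral_setU//=.
  - congr (_ + _)%E; rewrite integral_itv_obnd_cbnd//.
    exact/measurable_EFinP/measurable_funTS.
  - exact/measurable_EFinP/measurable_funTS.
  - by move=> x _; rewrite lee_fin.
  - rewrite disj_set2E; apply/eqP; apply/seteqP; split => // x [] /=.
    by rewrite !in_itv/= andbT => /andP[_ x1]; rewrite ltNge x1.
(* The boundary terms [g 1] of the two pieces match. *)
rewrite split// [RHS]split// int_y -int_1.
by rewrite -addeA (addeC (g 1)%:E).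
Qed.

Lemma normal_pdf01E x : normal_pdf 0 1 x = normal_peak 1 * g x :> R.
Proof.
rewrite normal_pdfE ?oner_neq0// /normal_fun /g subr0 expr1n.
by congr (_ * expR _); rewrite mulNr.
Qed.

(** Lets the standard normal law itself enter [char_limit] with [s2 = 1]. *)
Lemma normal_second_moment :
  (\int[normal_prob (0:R) 1]_x (x ^+ 2)%:E = 1)%E.
Proof.
rewrite ge0_integral_normal_prob//; last first.
- by apply/measurable_EFinP; exact: measurable_funX.
- by move=> x; rewrite lee_fin sqr_ge0.
have pk : 0 <= normal_peak 1 :> R by exact: normal_peak_ge0.
under eq_integral do rewrite -EFinM normal_pdf01E mulrCA EFinM.
rewrite ge0_integralZl//.
- rewrite int_sqr -ge0_integralZl//; last first.
    by move=> x _; rewrite lee_fin expR_ge0.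
    exact/measurable_EFinP.
  under eq_integral do rewrite -EFinM -normal_pdf01E.
  exact: integral_normal_pdf.
- by apply/measurable_EFinP; apply: measurable_funM => //; exact: measurable_funX.
- by move=> x _; rewrite lee_fin mulr_ge0 ?sqr_ge0 ?expR_ge0.
Qed.

End normal_moments.

(** * Affine images and convolutions of normal laws *)

Section normal_stability.
Context {R : realType}.
Local Notation mu := (@lebesgue_measure R).
Local Notation nu := (normal_prob (0 : R) 1).

Lemma normal_peakE (s : R) : normal_peak s = (Num.sqrt (2 * pi) * `|s|)^-1.
Proof.
rewrite /normal_peak; congr (_^-1).
have -> : s ^+ 2 * pi *+ 2 = (2 * pi) * s ^+ 2 :> R by rewrite -mulr_natr; ring.
by rewrite sqrtrM ?sqrtr_sqr// mulr_ge0// pi_ge0.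
Qed.

Lemma normal_pdfE' (m s x : R) : s != 0 ->
  normal_pdf m s x = (Num.sqrt (2 * pi) * `|s|)^-1 * expR (- (x - m) ^+ 2 / (2 * s ^+ 2)).
Proof.
move=> s0; rewrite normal_pdfE// normal_peakE /normal_fun; congr (_ * expR (_ / _)).
by rewrite mulr_natl.
Qed.

Lemma normal_prob_affine (x b : R) (B : set R) : b != 0 -> measurable B ->
  nu [set y | B (x + b * y)] = normal_prob x `|b| B.
Proof.
move=> b0 mB.
have ab0 : `|b| != 0 by rewrite normr_eq0.
have mg : measurable_fun setT (fun y : R => b * y + x).
  by apply: measurable_funD => //; exact: measurable_funM.
pose h z := \1_B z * normal_pdf x `|b| z.
have mh : measurable_fun setT h.
  by apply: measurable_funM; [exact: measurable_indic|exact: measurable_normal_pdf].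
rewrite {2}/normal_prob integral_mkcond.
transitivity (\int[mu]_z (h z)%:E)%E; last first.
  by apply: eq_integral => z _; rewrite epatch_indic /h mulrC EFinM.
rewrite (ge0_integral_affine x b0)//; last first.
  by move=> z; rewrite mulr_ge0// normal_pdf_ge0.
rewrite -ge0_integralZl//; last 2 first.
- by apply/measurable_EFinP; apply: measurableT_comp.
- by move=> z _; rewrite lee_fin mulr_ge0// normal_pdf_ge0.
rewrite [LHS]/normal_prob [LHS]integral_mkcond; apply: eq_integral => y _.
rewrite epatch_indic /= /h -!EFinM; congr (_%:E).
rewrite !normal_pdfE' ?oner_neq0// normr_id normr1.
rewrite mulrC (_ : \1_B (b * y + x) = \1_[set y | B (x + b * y)] y :> R); last first.
  rewrite !indicE; congr (_%:R); congr (nat_of_bool _).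
  by apply/idP/idP; rewrite !inE/= addrC.
rewrite addrK subr0 real_normK ?num_real//.
rewrite (_ : - (b * y) ^+ 2 / (2 * b ^+ 2) = - y ^+ 2 / (2 * 1 ^+ 2)); last by field.
have : Num.sqrt (2 * pi) != 0 :> R by rewrite gt_eqF// sqrtr_gt0 mulr_gt0// pi_gt0.
move: (Num.sqrt _) => c c0; field.
by rewrite c0 ab0.
Qed.

(** Completing the square. For [z] equal to [x] plus an independent centred normal variable with
    deviation [|b|], the right-hand side is the marginal density of [z] times the conditional
    density of [x] given [z]. *)
Lemma normal_pdf_convolution (s b x z : R) : s != 0 -> b != 0 ->
  normal_pdf 0 s x * normal_pdf x b z =
  normal_pdf 0 (Num.sqrt (s ^+ 2 + b ^+ 2)) z *
  normal_pdf (z * s ^+ 2 / (s ^+ 2 + b ^+ 2)) (s * b / Num.sqrt (s ^+ 2 + b ^+ 2)) x.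
Proof.
move=> s0 b0.
have S0 : 0 < s ^+ 2 + b ^+ 2.
  by rewrite ltr_pwDl ?sqr_ge0// exprn_even_gt0.
have sS0 : 0 < Num.sqrt (s ^+ 2 + b ^+ 2) by rewrite sqrtr_gt0.
rewrite !normal_pdfE'//; last 2 first.
- by rewrite !mulf_neq0// invr_eq0 gt_eqF.
- by rewrite gt_eqF.
rewrite mulrACA [RHS]mulrACA -!expRD !normrM normfV (gtr0_norm sS0).
congr (_ * expR _).
- have : Num.sqrt (2 * pi) != 0 :> R by rewrite gt_eqF// sqrtr_gt0 mulr_gt0// pi_gt0.
  move: (Num.sqrt (2 * pi)) => c c0; field.
  by rewrite c0 !normr_eq0 s0 b0 gt_eqF.
- rewrite !exprMn exprVn sqr_sqrtr ?ltW//; field.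
  by rewrite s0 b0 gt_eqF.
Qed.

Lemma normal_prob_convolution (s b : R) (B : set R) : s != 0 -> b != 0 -> measurable B ->
  (\int[normal_prob 0%R s]_x normal_prob x b B =
   normal_prob 0%R (Num.sqrt (s ^+ 2 + b ^+ 2)) B)%E.
Proof.
move=> s0 b0 mB.
have ab0 : `|b| != 0 by rewrite normr_eq0.
have mpdf : measurable_fun setT (fun z : R * R => normal_pdf z.1 b z.2).
  have -> : (fun z : R * R => normal_pdf z.1 b z.2) = (fun z => normal_pdf 0 b (z.2 - z.1)).
    by apply/funext => z; rewrite !normal_pdfE'// subr0.
  apply: measurableT_comp; first exact: measurable_normal_pdf.
  by apply: measurable_funB; [exact: measurable_snd|exact: measurable_fst].
pose G (z : R * R) := (\1_B z.2 * normal_pdf z.1 b z.2)%:E.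
have mG : measurable_fun setT G.
  apply/measurable_EFinP; apply: measurable_funM => //.
  by apply: measurableT_comp => //; exact: measurable_indic.
have G0 z : (0 <= G z)%E by rewrite lee_fin mulr_ge0// normal_pdf_ge0.
have E1 x : normal_prob x b B = (\int[mu]_z G (x, z))%E.
  rewrite /normal_prob integral_mkcond; apply: eq_integral => z _.
  by rewrite epatch_indic /G/= mulrC EFinM.
have mH : measurable_fun setT (fun x : R => normal_prob x b B).
  under eq_fun do rewrite E1.
  exact: (@measurable_fun_fubini_tonelli_F _ _ _ _ _ mu G).
rewrite ge0_integral_normal_prob//.
pose K (z : R * R) := (\1_B z.2 * (normal_pdf 0 s z.1 * normal_pdf z.1 b z.2))%:E.
have mK : measurable_fun setT K.
  apply/measurable_EFinP; apply: measurable_funM.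
    by apply: measurableT_comp => //; exact: measurable_indic.
  apply: measurable_funM => //.
  by apply: measurableT_comp => //; exact: measurable_normal_pdf.
have K0 z : (0 <= K z)%E by rewrite lee_fin !mulr_ge0// normal_pdf_ge0.
transitivity (\int[mu]_x \int[mu]_z K (x, z))%E.
  apply: eq_integral => x _; rewrite E1 -ge0_integralZr//.
  - by apply: eq_integral => z _; rewrite /G/K/= -EFinM; congr (_%:E); ring.
  - by apply: measurableT_comp => //; exact: measurable_pair1.
  - by rewrite lee_fin normal_pdf_ge0.
rewrite (@fubini_tonelli _ _ _ _ _ mu mu K)//.
rewrite [RHS]/normal_prob [RHS]integral_mkcond; apply: eq_integral => z _.
rewrite epatch_indic.
(* After Tonelli, the conditional density of [x] integrates to 1 and only the marginal of [z] is
   left. *)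
under eq_integral do rewrite /K/= normal_pdf_convolution// mulrA EFinM.
rewrite ge0_integralZl//.
- by rewrite integral_normal_pdf mule1 mulrC EFinM.
- by apply/measurable_EFinP; exact: measurable_normal_pdf.
- by move=> x _; rewrite lee_fin normal_pdf_ge0.
- by rewrite lee_fin mulr_ge0// normal_pdf_ge0.
Qed.

End normal_stability.

Section normal_law.
Context {R : realType}.

Let mid : @measurable_fun _ _ (measurableTypeR R) R setT id.
Proof. by move=> _ A mA; rewrite setTI. Qed.

Definition to_R : {mfun measurableTypeR R >-> R} :=
  @mfun_Sub _ _ (measurableTypeR R) R id (mem_set mid).

(* [normal_prob] lives on [measurableTypeR R]; this is its copy on [R] itself. *)
Definition std_normal : probability R R :=
  @distribution _ _ (measurableTypeR R) R R (normal_prob (0 : R) 1) to_R.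
Local Notation nu := std_normal.

Lemma std_normalE (A : set R) : nu A = normal_prob 0 1 A.
Proof. by []. Qed.

(** Adjoins an independent normal coordinate. The cases [b = 0] and [v = 0] are separate because
    [has_normal_law] then means a Dirac mass, which has no density to convolve. *)
Lemma normal_law_prod {d} {T : measurableType d} (Q : probability T R)
    (X : T -> R) (v b : R) :
  measurable_fun setT X -> 0 <= v -> has_normal_law Q X 0 v ->
  has_normal_law ((Q \x nu)%E : probability (T * R)%type R)
    (fun z => X z.1 + b * z.2) 0 (v + b ^+ 2).
Proof.
move=> mX v0 XN B mB.
have [b0|b0] := eqVneq b 0.
  rewrite b0 expr0n/= addr0.
  rewrite (_ : _ @^-1` B = (X @^-1` B) `*` setT); last first.
    by apply/seteqP; split => -[w y] /=; rewrite mul0r addr0// => -[].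
  have mXB : measurable (X @^-1` B) by rewrite -[X in measurable X]setTI; exact: mX.
  rewrite [LHS](product_measure1E Q nu mXB measurableT).
  apply: etrans (congr1 (fun z => Q (X @^-1` B) * z)%E (probability_setT nu)) _.
  by rewrite mule1; exact: XN.
have b20 : 0 < b ^+ 2 by rewrite exprn_even_gt0.
have -> : (v + b ^+ 2 == 0) = false by rewrite gt_eqF// ltr_wpDl.
have mf : measurable_fun setT (fun z : R * R => z.1 + b * z.2).
  by apply: measurable_funD => //; apply: measurable_funM.
pose D := (fun z : R * R => z.1 + b * z.2) @^-1` B.
have mD : measurable D by rewrite -[X in measurable X]setTI; exact: mf.
have mh := measurable_fun_xsection nu mD.
have hE x : nu (xsection D x) = normal_prob x `|b| B.
  rewrite -(normal_prob_affine x b0 mB) std_normalE; congr (normal_prob _ _ _).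
  by apply/seteqP; split => y; rewrite /xsection/= inE.
pose X' : {mfun T >-> R} := mfun_Sub (mem_set mX : _ \in mfun).
have -> : ((Q \x nu)%E : probability (T * R)%type R)
    ((fun z => X z.1 + b * z.2) @^-1` B) =
    (\int[distribution Q X']_x nu (xsection D x))%E.
  by rewrite ge0_integral_distribution.
have [v00|vn0] := eqVneq v 0.
  rewrite (eq_measure_integral (\d_(0:R))); last first.
    move=> A mA _; rewrite /distribution/= /pushforward.
    by have := XN A mA; rewrite v00 eqxx.
  by rewrite integral_dirac// diracT mul1e hE v00 add0r sqrtr_sqr.
rewrite (eq_measure_integral
  (@distribution _ _ (measurableTypeR R) R R (normal_prob (0 : R) (Num.sqrt v)) to_R)); last first.
  move=> A mA _; rewrite /distribution/= /pushforward.
  by have := XN A mA; rewrite (negbTE vn0).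
rewrite ge0_integral_distribution//.
transitivity (\int[normal_prob (0 : R) (Num.sqrt v)]_x normal_prob x `|b| B)%E.
  by apply: eq_integral => x _; rewrite -hE.
have vgt0 : 0 < v by rewrite lt_def vn0.
have sv0 : Num.sqrt v != 0 by rewrite gt_eqF// sqrtr_gt0.
have ab0 : `|b| != 0 by rewrite normr_eq0.
have e : Num.sqrt v ^+ 2 + `|b| ^+ 2 = v + b ^+ 2.
  by rewrite sqr_sqrtr// real_normK ?num_real.
by have := normal_prob_convolution sv0 ab0 mB; rewrite e.
Qed.

(** Iterated products with [std_normal]: each step adds the coordinate [ord_max]. Controlling all
    linear combinations at once is what both the induction and [gaussian_vector] require. *)
Lemma normal_vector_exists (k : nat) :
  exists (d : measure_display) (T : measurableType d) (Q : probability T R)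
    (N : 'I_k -> T -> R),
    (forall j, measurable_fun setT (N j)) /\
    forall a : 'I_k -> R,
      has_normal_law Q (fun w => \sum_j a j * N j w) 0 (\sum_j a j ^+ 2).
Proof.
elim: k => [|k [d [T [Q [N [mN HN]]]]]].
  exists _, R, nu, (fun _ _ => 0); split => // a B mB.
  rewrite !big_ord0 eqxx.
  have [B0|B0] := pselect (B 0).
    rewrite diracE mem_set// (_ : _ @^-1` B = setT) ?probability_setT//.
    by apply/seteqP; split.
  rewrite diracE memNset// (_ : _ @^-1` B = set0) ?measure0//.
  by apply/seteqP; split.
pose N' (j : 'I_k.+1) (z : T * R) := if unlift ord_max j is Some i then N i z.1 else z.2.
exists _, (T * R)%type, ((Q \x nu)%E : probability (T * R)%type R), N'; split.
  move=> j; rewrite /N'; case: unlift => [i|]; last exact: measurable_snd.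
  exact: measurableT_comp.
move=> a.
have e z : \sum_j a j * N' j z =
    (\sum_i a (lift ord_max i) * N i z.1) + a ord_max * z.2.
  rewrite big_ord_recr/= /N' unlift_none; congr (_ + _).
  apply: eq_bigr => i _.
  have -> : widen_ord (leqnSn k) i = lift ord_max i by apply: val_inj; rewrite /= /bump leqNgt ltn_ord.
  by rewrite liftK.
under eq_fun do rewrite e.
have -> : \sum_j a j ^+ 2 = \sum_i a (lift ord_max i) ^+ 2 + a ord_max ^+ 2.
  rewrite big_ord_recr/=; congr (_ + _).
  apply: eq_bigr => i _; congr (a _ ^+ 2).
  by apply: val_inj; rewrite /= /bump leqNgt ltn_ord.
apply: (normal_law_prod (X := fun w => \sum_i a (lift ord_max i) * N i w)) => //.
- by apply: measurable_sum => i; exact: measurable_funM.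
- by apply: sumr_ge0 => i _; exact: sqr_ge0.
Qed.

Lemma normal_lawZ (a : R) : has_normal_law nu (fun x => a * x) 0 (a ^+ 2).
Proof.
move=> B mB; rewrite expf_eq0/=; have [a0|a0] := eqVneq a 0.
  have [B0|B0] := pselect (B 0).
    rewrite diracE mem_set// (_ : _ @^-1` B = setT) ?probability_setT//.
    by apply/seteqP; split => // x; rewrite /= a0 mul0r.
  rewrite diracE memNset// (_ : _ @^-1` B = set0) ?measure0//.
  by apply/seteqP; split => // x; rewrite /= a0 mul0r.
rewrite sqrtr_sqr -(normal_prob_affine 0 a0 mB); congr (normal_prob _ _ _).
by apply/seteqP; split => x; rewrite /= add0r.
Qed.

Lemma has_normal_law_Rintegral d d' (T : measurableType d) (T' : measurableType d')
    (P : probability T R) (P' : probability T' R) (Y : T -> R) (Y' : T' -> R) (v : R)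
    (h : R -> R) :
  measurable_fun setT Y -> measurable_fun setT Y' ->
  has_normal_law P Y 0 v -> has_normal_law P' Y' 0 v ->
  measurable_fun setT h -> P.-integrable setT (EFin \o (h \o Y)) ->
  P'.-integrable setT (EFin \o (h \o Y')) ->
  \int[P]_w h (Y w) = \int[P']_w h (Y' w).
Proof.
move=> mY mY' YN YN' mh ih ih'; rewrite /Rintegral; congr fine.
pose X : {mfun T >-> R} := mfun_Sub (mem_set mY : _ \in mfun).
pose X' : {mfun T' >-> R} := mfun_Sub (mem_set mY' : _ \in mfun).
transitivity (\int[distribution P X]_x (h x)%:E)%E.
  by rewrite integral_distribution//; exact/measurable_EFinP.
transitivity (\int[distribution P' X']_x (h x)%:E)%E; last first.
  by rewrite integral_distribution//; exact/measurable_EFinP.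
apply: eq_measure_integral => A mA _; rewrite /distribution/= /pushforward.
by rewrite [LHS]YN// [RHS]YN'.
Qed.

Let Exx : (\int[nu]_x (x ^+ 2)%:E = 1)%E.
Proof.
rewrite ge0_integral_distribution//=.
- exact: normal_second_moment.
- by apply/measurable_EFinP; exact: measurable_funX.
- by move=> y; rewrite lee_fin sqr_ge0.
Qed.

Let ix2 : nu.-integrable setT (EFin \o (fun x : R => x ^+ 2)).
Proof.
apply/integrableP; split; first by apply/measurable_EFinP; exact: measurable_funX.
under eq_integral do rewrite /= ger0_norm ?sqr_ge0//.
by rewrite Exx ltry.
Qed.

Let ix : nu.-integrable setT (EFin \o (id : R -> R)).
Proof. exact: integrable_sqr. Qed.

(** By symmetry: [-1 * x] has the same law as [x]. *)
Let Ex0 : \int[nu]_x x = 0.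
Proof.
have h : \int[nu]_x x = \int[nu]_x (-1 * x).
  have e1 : has_normal_law nu id 0 1.
    rewrite [X in has_normal_law _ X](_ : _ = fun x => 1 * x); last first.
      by apply/funext => x; rewrite mul1r.
    by rewrite -[X in has_normal_law _ _ _ X](expr1n _ 2); exact: normal_lawZ.
  have e2 : has_normal_law nu (fun x => -1 * x) 0 1.
    by rewrite -[X in has_normal_law _ _ _ X](sqrr_sign _ 1) expr1; exact: normal_lawZ.
  apply: (has_normal_law_Rintegral (h := id) _ _ e1 e2) => //.
  - exact: measurable_funM.
  - exact: integrableZR.
by move: h; rewrite RintegralZl//; lra.
Qed.

Let Ex2 : \int[nu]_x (x ^+ 2) = 1.
Proof.
by rewrite /Rintegral Exx.
Qed.

Let std_normal_law : has_normal_law nu id 0 1.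
Proof.
rewrite [X in has_normal_law _ X](_ : _ = fun x => 1 * x); last first.
  by apply/funext => x; rewrite mul1r.
by rewrite -[X in has_normal_law _ _ _ X](expr1n _ 2); exact: normal_lawZ.
Qed.

Let PP : probability (R * R)%type R := (nu \x nu)%E.

Let indep_PP : indep2 PP fst snd.
Proof.
move=> A B mA mB.
rewrite (_ : _ `&` _ = A `*` B)// (_ : fst @^-1` A = A `*` setT); last first.
  by apply/seteqP; split => // -[x y] [].
rewrite (_ : snd @^-1` B = setT `*` B); last by apply/seteqP; split => // -[x y] [].
rewrite /PP/= !product_measure1E//.
rewrite -[RHS]/(nu A * nu setT * (nu setT * nu B))%E.
by rewrite (probability_setT nu) mule1 mul1e.
Qed.

Let fst_law : has_normal_law PP fst 0 1.
Proof.
move=> B mB; rewrite -std_normal_law//.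
rewrite (_ : fst @^-1` B = B `*` setT); last by apply/seteqP; split => // -[x y] [].
rewrite /PP/= product_measure1E//.
rewrite -[LHS]/(nu B * nu setT)%E.
by rewrite (probability_setT nu) mule1.
Qed.

Let snd_law : has_normal_law PP snd 0 1.
Proof.
move=> B mB; rewrite -std_normal_law//.
rewrite (_ : snd @^-1` B = setT `*` B); last by apply/seteqP; split => // -[x y] [].
rewrite /PP/= product_measure1E//.
rewrite -[LHS]/(nu setT * nu B)%E.
by rewrite (probability_setT nu) mul1e.
Qed.

Let bnd d (T : measurableType d) (P : probability T R) (h : R -> R) (X : T -> R) :
  measurable_fun setT h -> (forall x, `|h x| <= 1) -> measurable_fun setT X ->
  P.-integrable setT (EFin \o (h \o X)).
Proof.
move=> mh h1 mX; apply: (@integrable_bounded _ _ _ _ _ 1) => [|w]; last exact: h1.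
exact: measurableT_comp.
Qed.

(** By stability the left-hand variable has the law of [a * z.1 + b * z.2] under [PP]; the addition
    formula and independence then give the recursion that [char_limit] asks for. *)
Let std_normal_cos_rec (a b c : R) :
  \int[nu]_x cos (Num.sqrt (a ^+ 2 + b ^+ 2) * x + c) =
  \int[nu]_x cos (a * x + c) * (\int[nu]_x cos (b * x)) -
  \int[nu]_x cos (a * x + (c - pi / 2)) * (\int[nu]_x sin (b * x)).
Proof.
have mlin (u v : R) : measurable_fun setT (fun x : R => u * x + v).
  by apply: measurable_funD => //; exact: measurable_funM.
have mcosD u v : measurable_fun setT (fun x : R => cos (u * x + v)).
  exact: measurable_cos_comp.
have mcos1 v : measurable_fun setT (fun x : R => cos (x + v)).
  by apply: measurable_cos_comp; exact: measurable_funD.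
have mcosM u : measurable_fun setT (fun x : R => cos (u * x)).
  by apply: measurable_cos_comp; exact: measurable_funM.
have msinM u : measurable_fun setT (fun x : R => sin (u * x)).
  by apply: measurable_sin_comp; exact: measurable_funM.
have mf : measurable_fun setT (@fst R R) by exact: measurable_fst.
have ms : measurable_fun setT (@snd R R) by exact: measurable_snd.
have mab : measurable_fun setT (fun z : R * R => a * z.1 + b * z.2).
  by apply: measurable_funD; exact: measurable_funM.
have E1 (h : R -> R) : measurable_fun setT h -> (forall x, `|h x| <= 1) ->
    \int[nu]_x h x = \int[PP]_z h z.1.
  move=> mh h1; apply: (has_normal_law_Rintegral _ _ std_normal_law fst_law) => //;
    exact: bnd.
have E2 (h : R -> R) : measurable_fun setT h -> (forall x, `|h x| <= 1) ->
    \int[nu]_x h x = \int[PP]_z h z.2.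
  move=> mh h1; apply: (has_normal_law_Rintegral _ _ std_normal_law snd_law) => //;
    exact: bnd.
have law1 : has_normal_law PP (fun z => a * z.1 + b * z.2) 0 (a ^+ 2 + b ^+ 2).
  apply: (normal_law_prod (X := fun x => a * x)); last exact: normal_lawZ.
    exact: measurable_funM.
  exact: sqr_ge0.
have law2 : has_normal_law nu (fun x => Num.sqrt (a ^+ 2 + b ^+ 2) * x) 0 (a ^+ 2 + b ^+ 2).
  have h : Num.sqrt (a ^+ 2 + b ^+ 2) ^+ 2 = a ^+ 2 + b ^+ 2.
    by rewrite sqr_sqrtr// addr_ge0// sqr_ge0.
  by rewrite -[X in has_normal_law _ _ _ X]h; exact: normal_lawZ.
rewrite (has_normal_law_Rintegral (h := fun y => cos (y + c)) _ _ law2 law1)//; last 3 first.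
- exact: measurable_funM.
- apply: (@bnd _ _ _ (fun y => cos (y + c))) => // [x|]; first exact: cos_max.
  exact: measurable_funM.
- by apply: (@bnd _ _ _ (fun y => cos (y + c))) => // x; exact: cos_max.
rewrite (E1 (fun x => cos (a * x + c)))//; last by move=> x; exact: cos_max.
rewrite (E1 (fun x => cos (a * x + (c - pi / 2))))//; last by move=> x; exact: cos_max.
rewrite (E2 (fun x => cos (b * x)))//; last by move=> x; exact: cos_max.
rewrite (E2 (fun x => sin (b * x)))//; last by move=> x; exact: sin_max.
have [i1 e1] := indep2_integralM (indep2_comp (mcosD a c) (mcosM b) indep_PP)
  (@bnd _ _ PP _ _ (mcosD a c) (fun x => cos_max _) mf)
  (@bnd _ _ PP _ _ (mcosM b) (fun x => cos_max _) ms).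
have [i2 e2] := indep2_integralM (indep2_comp (mcosD a (c - pi / 2)) (msinM b) indep_PP)
  (@bnd _ _ PP _ _ (mcosD a (c - pi / 2)) (fun x => cos_max _) mf)
  (@bnd _ _ PP _ _ (msinM b) (fun x => sin_max _) ms).
rewrite -e1 -e2 -RintegralB//; apply: eq_Rintegral => z _ /=.
by rewrite addrAC (cosD (a * z.1 + c)) (addrA (a * z.1)) cosBpihalf.
Qed.

(* By stability, [b N] has the law of a sum of [n] independent copies of [(b / sqrt n) N]. *)
Lemma std_normal_cos (b c : R) :
  \int[nu]_x cos (b * x + c) = expR (- (b ^+ 2 / 2)) * cos c.
Proof.
pose a (n j : nat) : R := b / Num.sqrt n%:R.
(* [F n j] describes the sum of [j] independent copies of [(b / sqrt n) N], written through its law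
   as one scaled normal variable. For [n > 0], [F n n] no longer depends on [n], so its limit is its
   value. *)
pose F (n j : nat) (c : R) := \int[nu]_x cos (Num.sqrt (j%:R * (a n 0%N) ^+ 2) * x + c).
have mlin (u v : R) : measurable_fun setT (fun x : R => u * x + v).
  by apply: measurable_funD => //; exact: measurable_funM.
have an2 n : (0 < n)%N -> n%:R * a n 0%N ^+ 2 = b ^+ 2.
  move=> n0; rewrite /a exprMn exprVn sqr_sqrtr// mulrCA divff ?mulr1//.
  by rewrite pnatr_eq0 -lt0n.
have h : F n n c @[n --> \oo] --> expR (- (1 * b ^+ 2 / 2)) * cos c.
  apply: (@char_limit _ _ _ nu id 1 (@measurable_id _ _ _) ix2 Ex0 Ex2 F a) => //.
  - move=> n c'; rewrite /F mul0r sqrtr0 -[RHS](Rintegral_cstP nu).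
    by apply: eq_Rintegral => x _; rewrite mul0r add0r.
  - move=> n j c' jn; rewrite /F -[a n j]/(a n 0%N) -std_normal_cos_rec.
    apply: eq_Rintegral => x _; congr (cos (Num.sqrt _ * x + _)).
    rewrite sqr_sqrtr; last by apply: mulr_ge0 => //; exact: sqr_ge0.
    by rewrite -{3}[a n 0%N ^+ 2]mul1r -mulrDl natr1.
  - by move=> n j c'; exact: normr_Rintegral_cos_le1.
  - move=> e e0; near=> n => i _.
    have n0 : (0 < n)%N by near: n; exact: nbhs_infty_gt.
    have sn0 : 0 < Num.sqrt n%:R :> R by rewrite sqrtr_gt0 ltr0n.
    rewrite /a normrM normfV (gtr0_norm sn0) ler_pdivrMr//.
    rewrite -ler_pdivrMl// -(@ler_pXn2r _ 2)// ?nnegrE ?mulr_ge0 ?invr_ge0 ?sqrtr_ge0 ?(ltW e0)//.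
    rewrite sqr_sqrtr//.
    near: n; exact: nbhs_infty_ger.
  - apply: cvg_near_cst; near=> n.
    have n0 : (0 < n)%N by near: n; exact: nbhs_infty_gt.
    by rewrite -(an2 _ n0) (eq_bigr (fun=> a n 0%N ^+ 2))// sumr_const card_ord mulr_natl.
rewrite mul1r in h.
(* The square root in [F] returns [|b|]; the laws of [|b| N] and [b N] coincide. *)
have nb : \int[nu]_x cos (`|b| * x + c) = \int[nu]_x cos (b * x + c).
  have l1 : has_normal_law nu (fun x => `|b| * x) 0 (b ^+ 2).
    have e : `|b| ^+ 2 = b ^+ 2 by rewrite real_normK ?num_real.
    by have := normal_lawZ `|b|; rewrite e.
  have mc : measurable_fun setT (fun y : R => cos (y + c)).
    by apply: measurable_cos_comp; exact: measurable_funD.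
  apply: (has_normal_law_Rintegral (h := fun y => cos (y + c)) _ _ l1 (normal_lawZ b)) => //.
  - exact: measurable_funM.
  - exact: measurable_funM.
  - exact: (@integrable_cos_comp _ _ _ nu).
  - exact: (@integrable_cos_comp _ _ _ nu).
rewrite -nb; apply: (cvg_unique _ _ h) => //.
apply: cvg_near_cst; near=> n.
have n0 : (0 < n)%N by near: n; exact: nbhs_infty_gt.
by rewrite /F an2// sqrtr_sqr.
Unshelve. all: by end_near. Qed.

Lemma normal_law_cos d (T : measurableType d) (P : probability T R) (Y : T -> R) (v c : R) :
  measurable_fun setT Y -> 0 <= v -> has_normal_law P Y 0 v ->
  \int[P]_w cos (Y w + c) = expR (- (v / 2)) * cos c.
Proof.
move=> mY v0 YN.
have mc : measurable_fun setT (fun y : R => cos (y + c)).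
  by apply: measurable_cos_comp; exact: measurable_funD.
have l : has_normal_law nu (fun x => Num.sqrt v * x) 0 v.
  by rewrite -[X in has_normal_law _ _ _ X](sqr_sqrtr v0); exact: normal_lawZ.
rewrite (has_normal_law_Rintegral (h := fun y => cos (y + c)) mY _ YN l)//.
- by rewrite std_normal_cos sqr_sqrtr.
- exact: measurable_funM.
- by apply: (@integrable_cos_comp _ _ _ P); exact: measurable_funD.
- apply: (@integrable_cos_comp _ _ _ nu); apply: measurable_funD => //.
Qed.

End normal_law.

(** * Gaussian vectors with a prescribed covariance *)

Section gaussian_vectors.
Context {R : realType}.

Lemma mulmx_trE (k : nat) (u v : 'rV[R]_k) : (u *m v^T) 0 0 = \sum_j u 0 j * v 0 j.
Proof. by rewrite mxE; apply: eq_bigr => j _; rewrite mxE. Qed.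

(** Cholesky factorisation by induction: split off the first row and column and factor the Schur
    complement [S'] of the corner entry [a]. *)
Lemma posdef_factorization (k : nat) (S : 'M[R]_k) :
  posdef S -> exists B : 'M[R]_k, B^T *m B = S.
Proof.
elim: k S => [|k IH] S [Ssym Spos].
  by exists 0; apply/matrixP => -[].
pose S0 : 'M[R]_(1 + k) := S.
have addE (A B : 'M[R]_1) : (A + B) 0 0 = A 0 0 + B 0 0 by rewrite mxE.
have scaleE (c : R) (A : 'M[R]_1) : (c *: A) 0 0 = c * A 0 0 by rewrite mxE.
have sE (c : R) : (c%:M : 'M[R]_1) 0 0 = c by rewrite mxE eqxx mulr1n.
pose v := ursubmx S0; pose D := drsubmx S0.
pose a := S0 0 0.
have ulE : ulsubmx S0 = a%:M.
  apply/matrixP => i j; rewrite !ord1 !mxE eqxx mulr1n /a.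
  by congr (S _ _); apply: val_inj.
have dlE : dlsubmx S0 = v^T by rewrite /v trmx_ursub [S0^T]Ssym.
have DT : D^T = D by rewrite /D trmx_drsub [S0^T]Ssym.
have SE : S0 = block_mx a%:M v v^T D by rewrite -[LHS]submxK ulE dlE.
have quad (c : R) (w : 'rV[R]_k) :
    ((row_mx c%:M w : 'rV[R]_(1 + k)) *m S0 *m (row_mx c%:M w)^T) 0 0 =
    c ^+ 2 * a + 2 * c * (v *m w^T) 0 0 + (w *m D *m w^T) 0 0.
  rewrite SE mul_row_block tr_row_mx mul_row_col !mulmxDl !tr_scalar_mx.
  rewrite -!scalar_mxM !mul_scalar_mx !mul_mx_scalar.
  have e : (w *m v^T) 0 0 = (v *m w^T) 0 0.
    by rewrite -[in LHS](trmxK w) -trmx_mul [LHS]mxE.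
  by rewrite -scalemxAl !addE !scaleE e sE; ring.
have row_neq0 (c : R) (w : 'rV[R]_k) : (c != 0) || (w != 0) ->
    (row_mx c%:M w : 'rV[R]_(1 + k)) != 0.
  apply: contraTneq => h0.
  have [h1 h2] : c%:M = 0 :> 'M[R]_1 /\ w = 0.
    by apply: eq_row_mx; rewrite h0 row_mx0.
  by rewrite h2 eqxx orbF negbK; apply/eqP; rewrite -(sE c) h1 mxE.
have a0 : 0 < a.
  have := Spos _ (row_neq0 1 0 _); rewrite oner_neq0 => /(_ isT).
  by rewrite quad !mul0mx trmx0 mulmx0 !mxE; lra.
pose S' := D - a^-1 *: (v^T *m v).
have S'pos : posdef S'.
  split; first by rewrite /S' linearB linearZ/= trmx_mul trmxK DT.
  (* This first entry minimises the form of [S] over vectors ending in [w], and the minimum is the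
     form of [S'] at [w]. *)
  move=> w w0; have := Spos _ (row_neq0 (- (v *m w^T) 0 0 / a) w _).
  rewrite w0 orbT => /(_ isT); rewrite quad.
  suff -> : (w *m S' *m w^T) 0 0 = (w *m D *m w^T) 0 0 - a^-1 * ((v *m w^T) 0 0) ^+ 2.
    move: ((v *m w^T) 0 0) ((w *m D *m w^T) 0 0) => y z.
    have -> : (- y / a) ^+ 2 * a + 2 * (- y / a) * y + z = z - a^-1 * y ^+ 2; last by [].
    by field; rewrite gt_eqF.
  rewrite mulmxBr mulmxBl -scalemxAr -scalemxAl.
  rewrite [LHS]addE -scaleN1r scaleE scaleE mulN1r; congr (_ - _ * _).
  rewrite mulmxA -(mulmxA (w *m v^T)) mxE big_ord1 expr2; congr (_ * _).
  by rewrite -[in LHS](trmxK w) -trmx_mul [LHS]mxE.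
have [B' B'E] := IH _ S'pos.
pose B : 'M[R]_(1 + k) := block_mx (Num.sqrt a)%:M ((Num.sqrt a)^-1 *: v) 0 B'.
have sa0 : Num.sqrt a != 0 by rewrite gt_eqF// sqrtr_gt0.
suff BE : B^T *m B = S0 by exists B.
rewrite SE /B tr_block_mx mulmx_block.
rewrite !trmx0 !mul0mx !addr0 !tr_scalar_mx -scalar_mxM -expr2 sqr_sqrtr ?ltW//.
have -> : ((Num.sqrt a)^-1 *: v)^T = (Num.sqrt a)^-1 *: v^T by rewrite linearZ.
rewrite mulmx0 addr0 mul_scalar_mx mul_mx_scalar !scalerA mulfV// !scale1r B'E /S'.
congr block_mx.
rewrite -scalemxAl -scalemxAr scalerA -invfM -expr2 sqr_sqrtr ?ltW//.
by rewrite addrC subrK.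
Qed.

(** A standard normal vector times [B] has covariance [B^T *m B]. The factor [sigma] is applied
    after the factorisation, because [sigma ^+ 2 *: S] is not positive definite when [sigma] is
    0. *)
Lemma gaussian_vector_exists (k : nat) (S : 'M[R]_k) (sigma : R) : posdef S ->
  exists (d : measure_display) (T : measurableType d) (Q : probability T R)
    (G : T -> 'rV[R]_k), gaussian_vector Q G (sigma ^+ 2 *: S).
Proof.
move=> /posdef_factorization[B BS].
have [d [T [Q [N [mN HN]]]]] := @normal_vector_exists R k.
pose G w := (\row_j N j w) *m (sigma *: B).
have GE w (t : 'rV[R]_k) : (G w *m t^T) 0 0 =
    \sum_j ((sigma *: B) *m t^T) j 0 * N j w.
  by rewrite /G -mulmxA mxE; apply: eq_bigr => j _; rewrite mxE mulrC.
exists d, T, Q, G; split.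
  move=> j.
  rewrite (_ : (fun _ => _) = fun w => \sum_i N i w * (sigma *: B) i j).
    by apply: measurable_sum => i; exact: measurable_funM.
  by apply/funext => w; rewrite /G mxE; apply: eq_bigr => i _; rewrite mxE.
move=> t; under eq_fun do rewrite GE.
have -> : (t *m (sigma ^+ 2 *: S) *m t^T) 0 0 = \sum_j ((sigma *: B) *m t^T) j 0 ^+ 2.
  rewrite -BS expr2 -scalerA scalemxAr scalemxAl -linearZ/=.
  rewrite mulmxA -[X in X *m _ *m t^T]trmxK trmx_mul trmxK -mulmxA mxE.
  by apply: eq_bigr => j _; rewrite [X in X * _]mxE -expr2.
exact: HN.
Qed.

End gaussian_vectors.

(** * Approximation by trigonometric polynomials *)

(** Only [x] is confined to the compact set; [y] may leave it, as happens when a bounded vector is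
    compared with a nearby one. *)
Lemma compact_unif_continuous {R : realType} (V : normedModType R) (A : set V)
    (h : V -> R) (e : R) :
  compact A -> continuous h -> 0 < e ->
  exists2 dlt : R, 0 < dlt &
    forall x y, A x -> `|x - y| < dlt -> `|h x - h y| < e.
Proof.
move=> cA ch e0.
have /compact_near_coveringP/(_ R (at_right (0:R)) (fun dlt x =>
    forall y, `|x - y| < dlt -> `|h x - h y| < e)) := cA.
move=> /(_ _) H.
have : \forall dlt \near (0:R)^'+, A `<=` (fun x => forall y, `|x - y| < dlt -> `|h x - h y| < e).
  apply: H => x Ax.
  have e20 : 0 < e / 2 by rewrite divr_gt0.
  have /cvgrPdist_lt/(_ _ e20)/nbhs_ballP[r /= r0 hr] := ch x.
  have r20 : 0 < r / 2 by rewrite divr_gt0.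
  exists (ball x (r / 2), [set dlt | dlt < r / 2]) => /=.
    split; first exact: nbhsx_ballx.
    exact: nbhs_right_lt.
  move=> [x' dlt] /= [xx' dr] y x'y.
  have b1 : ball x r x' by apply: le_ball xx'; lra.
  have b2 : ball x r y.
    rewrite -ball_normE /=; rewrite -ball_normE /= in xx'.
    by rewrite -(subrKA x') (le_lt_trans (ler_normD _ _))//; lra.
  have := hr _ b1; have := hr _ b2 => /= h1 h2.
  rewrite -(subrKA (h x)) (le_lt_trans (ler_normD _ _))//.
  by rewrite distrC in h2; lra.
move=> H'.
have [dlt [d0 Hd]] := filter_ex (filterI (nbhs_right_gt (0 : R)) H').
by exists dlt => // x y Ax; exact: Hd.
Qed.

(** * Bernstein operators in one and in several variables *)

Section bernstein.
Context {R : realType}.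
Implicit Types (g : R -> R) (a x h : R).

(* [bern h m g a x] is the expectation of [g (a + h B)] for [B] binomial with parameters
   [m] and [x]. *)
Fixpoint bern h (m : nat) g a x : R :=
  if m is m'.+1 then x * bern h m' g (a + h) x + (1 - x) * bern h m' g a x
  else g a.

Lemma bern_le h m g1 g2 a x : 0 <= x <= 1 -> (forall t, g1 t <= g2 t) ->
  bern h m g1 a x <= bern h m g2 a x.
Proof.
move=> /andP[x0 x1] g12; elim: m a => //= m IH a.
by rewrite lerD// ler_wpM2l// subr_ge0.
Qed.

Lemma bern_cst h m (c : R) a x : bern h m (fun=> c) a x = c.
Proof. by elim: m a => //= m IH a; rewrite !IH; ring. Qed.

Lemma bernD h m g1 g2 (c : R) a x :
  bern h m (fun t => g1 t + c * g2 t) a x = bern h m g1 a x + c * bern h m g2 a x.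
Proof. by elim: m a => //= m IH a; rewrite !IH; ring. Qed.

(** Squared bias plus variance of [a + h B]. *)
Lemma bern_sqr h m (c : R) a x :
  bern h m (fun t => (t - c) ^+ 2) a x =
  (a + m%:R * h * x - c) ^+ 2 + m%:R * h ^+ 2 * (x * (1 - x)).
Proof.
elim: m a => [|m IH] a /=; first by ring.
by rewrite !IH -natr1; ring.
Qed.

End bernstein.

Section multivariate_bernstein.
Context {R : realType} (k : nat).
Implicit Types (f : 'rV[R]_k -> R) (x y : 'rV[R]_k) (s : seq 'I_k).

Definition set_coord y (j : 'I_k) (t : R) : 'rV[R]_k :=
  \row_i if i == j then t else y 0 i.

(** Composition of one-variable operators: [s] lists the coordinates still to be averaged and [y]
    stores the values already fixed, while [x] carries the binomial parameters. *)
Fixpoint mbern (m : nat) s f y x : R :=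
  if s is j :: s' then
    bern (m%:R^-1) m (fun t => mbern m s' f (set_coord y j t) x) 0 (x 0 j)
  else f y.

Definition unit_box x := forall j, 0 <= x 0 j <= 1.

Lemma mbern_le m s f1 f2 y x : unit_box x -> (forall y, f1 y <= f2 y) ->
  mbern m s f1 y x <= mbern m s f2 y x.
Proof.
by move=> ux f12; elim: s y => //= j s IH y; apply: bern_le => // t; exact: IH.
Qed.

Lemma mbern_cst m s (c : R) y x : mbern m s (fun=> c) y x = c.
Proof.
elim: s y => //= j s IH y; rewrite (_ : (fun _ => _) = fun=> c) ?bern_cst//.
by apply/funext => t; rewrite IH.
Qed.

Lemma mbernD m s f1 f2 (c : R) y x :
  mbern m s (fun y => f1 y + c * f2 y) y x = mbern m s f1 y x + c * mbern m s f2 y x.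
Proof.
elim: s y => //= j s IH y; rewrite -bernD; congr bern.
by apply/funext => t; rewrite IH.
Qed.

Lemma mbern_sum m s (F : 'I_k -> 'rV[R]_k -> R) (r : seq 'I_k) y x :
  mbern m s (fun y => \sum_(i <- r) F i y) y x = \sum_(i <- r) mbern m s (F i) y x.
Proof.
elim: r => [|i r IH].
  rewrite big_nil (_ : (fun _ => _) = fun=> 0) ?mbern_cst//.
  by apply/funext => z; rewrite big_nil.
rewrite big_cons -IH -[X in _ = _ + X]mul1r -mbernD; congr mbern.
by apply/funext => z; rewrite big_cons mul1r.
Qed.

(** Averaging in other coordinates leaves the integrand alone. In coordinate [j], start 0 and step
    [m%:R^-1] make the mean equal to [x 0 j], so only the variance [x (1 - x) / m] remains. *)
Lemma mbern_sqr m s (j : 'I_k) y x : (0 < m)%N -> uniq s -> unit_box x ->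
  mbern m s (fun y => (y 0 j - x 0 j) ^+ 2) y x <=
  if j \in s then m%:R^-1 else (y 0 j - x 0 j) ^+ 2.
Proof.
move=> m0 us ux; elim: s y us => [|i s IH] y //= /andP[nis us].
have mR0 : m%:R != 0 :> R by rewrite pnatr_eq0 -lt0n.
have bx : x 0 j * (1 - x 0 j) <= 1.
  by case/andP: (ux j) => ? ?; nra.
rewrite inE; have [ji|ji] := eqVneq j i.
  subst i.
  apply: (@le_trans _ _ (bern m%:R^-1 m (fun t => (t - x 0 j) ^+ 2) 0 (x 0 j))).
    apply: bern_le => // t; rewrite (le_trans (IH _ us))// (negbTE nis).
    by rewrite mxE eqxx.
  have [x0 x1] := andP (ux j).
  rewrite bern_sqr (_ : _ + _ = m%:R^-1 * (x 0 j * (1 - x 0 j))); last by field.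
  by rewrite ler_piMr ?invr_ge0.
rewrite /= (le_trans (bern_le _ _ _ _ (fun t => IH _ us)))//.
rewrite (_ : (fun _ => _) = fun=> if j \in s then m%:R^-1 else (y 0 j - x 0 j) ^+ 2).
  by rewrite bern_cst.
by apply/funext => t; rewrite mxE (negbTE ji).
Qed.

Lemma mbern_bound m s f y x (K : R) : unit_box x -> (forall y, `|f y| <= K) ->
  `|mbern m s f y x| <= K.
Proof.
move=> ux fK; rewrite ler_norml.
have fb z : - K <= f z <= K by rewrite -ler_norml.
have lo := @mbern_le m s (fun=> - K) f y x ux (fun z => proj1 (andP (fb z))).
have up := @mbern_le m s f (fun=> K) y x ux (fun z => proj2 (andP (fb z))).
by rewrite mbern_cst in lo; rewrite mbern_cst in up; rewrite lo up.
Qed.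

Lemma mbern_approx f (K e dlt : R) (x : 'rV[R]_k) (m : nat) :
  0 < e -> 0 < dlt -> (0 < m)%N -> unit_box x ->
  (forall y, `|f y| <= K) ->
  (forall y, `|x - y| < dlt -> `|f x - f y| < e) ->
  `|mbern m (enum 'I_k) f 0 x - f x| <= e + 2 * K / dlt ^+ 2 * (k%:R / m%:R).
Proof.
move=> e0 d0 m0 ux fK fe.
have K0 : 0 <= K by rewrite (le_trans _ (fK 0)).
pose D y := \sum_(i <- enum 'I_k) (y 0 i - x 0 i) ^+ 2.
have c0 : 0 <= 2 * K / dlt ^+ 2.
  by apply: divr_ge0; [exact: mulr_ge0|exact/exprn_ge0/ltW].
(* Bernstein's argument: [e] covers the points near [x]. Away from [x] some coordinate differs by at
   least [dlt], so [D y / dlt ^+ 2 >= 1] and the term in [2 * K] dominates. The operator is positive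
   and linear, hence respects this bound. *)
have pw y : `|f y - f x| <= e + 2 * K / dlt ^+ 2 * D y.
  have D0 : 0 <= D y by apply: sumr_ge0 => i _; exact: sqr_ge0.
  have [xy|xy] := ltP `|x - y| dlt.
    by rewrite distrC (le_trans (ltW (fe _ xy)))// lerDl mulr_ge0.
  have Dd : dlt ^+ 2 <= D y.
    have : `|x - y| != 0 by rewrite gt_eqF// (lt_le_trans d0).
    move=> /mx_norm_neq0[[i0 i]]; rewrite /= ord1 !mxE => nE.
    have : dlt ^+ 2 <= (y 0 i - x 0 i) ^+ 2.
      rewrite -(@real_normK _ (y 0 i - x 0 i)) ?num_real//.
      rewrite lerXn2r// ?nnegrE// ?(ltW d0)// distrC -nE.
      exact: xy.
    move=> h; apply: (le_trans h).
    rewrite /D (big_rem i)/= ?mem_enum// lerDl.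
    by apply: sumr_ge0 => ? _; exact: sqr_ge0.
  have h : 2 * K <= 2 * K / dlt ^+ 2 * D y.
    have d20 : 0 < dlt ^+ 2 by exact: exprn_gt0.
    rewrite mulrAC ler_pdivlMr// ler_wpM2l// mulr_ge0//.
  have := ler_normB (f y) (f x); have := fK y; have := fK x.
  move: (`|f y|) (`|f x|) (`|f y - f x|) => u v z; lra.
have up : mbern m (enum 'I_k) (fun y => e + 2 * K / dlt ^+ 2 * D y) 0 x <=
    e + 2 * K / dlt ^+ 2 * (k%:R / m%:R).
  rewrite mbernD mbern_cst lerD2l ler_wpM2l//.
  rewrite mbern_sum (@le_trans _ _ (\sum_(i <- enum 'I_k) m%:R^-1))//.
    apply: ler_sum => i _; rewrite (le_trans (mbern_sqr _ _ _ _ _))// ?enum_uniq//.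
    by rewrite mem_enum.
  by rewrite big_enum/= sumr_const card_ord mulr_natl.
have fE : mbern m (enum 'I_k) f 0 x - f x = mbern m (enum 'I_k) (fun y => f y + (- f x) * 1) 0 x.
  by rewrite [RHS]mbernD mbern_cst mulr1.
have lo : - mbern m (enum 'I_k) (fun y => e + 2 * K / dlt ^+ 2 * D y) 0 x =
    mbern m (enum 'I_k) (fun y => 0 + (-1) * (e + 2 * K / dlt ^+ 2 * D y)) 0 x.
  by rewrite [RHS]mbernD mbern_cst add0r mulN1r.
rewrite (le_trans _ up)// fE ler_norml lo; apply/andP; split; apply: mbern_le => // y;
  have := pw y; rewrite ler_norml => /andP[]; rewrite mulr1 ?add0r ?mulN1r; lra.
Qed.

End multivariate_bernstein.

Section trigonometric_polynomials.
Context {R : realType} (k : nat).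

(** The phase [c] makes sines and constants instances of cosines, so that only cosine integrals need
    to converge. *)
Inductive trig_poly : ('rV[R]_k -> R) -> Prop :=
| trig_cos (t : 'rV[R]_k) (c : R) : trig_poly (fun w => cos ((w *m t^T) 0 0 + c))
| trigD f g : trig_poly f -> trig_poly g -> trig_poly (fun w => f w + g w)
| trigZ a f : trig_poly f -> trig_poly (fun w => a * f w).

Lemma trig_ext f g : trig_poly f -> f =1 g -> trig_poly g.
Proof. by move=> tf /funext <-. Qed.

Lemma trig_cst (c : R) : trig_poly (fun=> c).
Proof.
apply: trig_ext (trigZ c (trig_cos 0 0)) _ => w.
by rewrite trmx0 mulmx0 mxE addr0 cos0 mulr1.
Qed.

(** The product of two cosines is half the sum of the cosines of the sum and of the difference; the
    rest is bilinearity. *)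
Lemma trigM f g : trig_poly f -> trig_poly g -> trig_poly (fun w => f w * g w).
Proof.
move=> tf; elim: tf g => [t c|f1 f2 _ IH1 _ IH2|a f1 _ IH1] g tg.
- elim: tg => [t' c'|g1 g2 _ IH1 _ IH2|a g1 _ IH1].
  + apply: trig_ext (trigD (trigZ 2^-1 (trig_cos (t + t') (c + c')))
      (trigZ 2^-1 (trig_cos (t - t') (c - c')))) _ => w.
    have -> : (w *m (t + t')^T) 0 0 = (w *m t^T) 0 0 + (w *m t'^T) 0 0.
      by rewrite (linearD trmx) mulmxDr [LHS]mxE.
    have -> : (w *m (t - t')^T) 0 0 = (w *m t^T) 0 0 - (w *m t'^T) 0 0.
      by rewrite (linearB trmx) mulmxBr [LHS]mxE [X in _ + X]mxE.
    set u := (w *m t^T) 0 0; set u' := (w *m t'^T) 0 0.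
    rewrite (_ : u + u' + (c + c') = (u + c) + (u' + c')); last by ring.
    rewrite (_ : u - u' + (c - c') = (u + c) - (u' + c')); last by ring.
    by rewrite cosD cosB; field.
  + by apply: trig_ext (trigD IH1 IH2) _ => w; ring.
  + by apply: trig_ext (trigZ a IH1) _ => w; ring.
- by apply: trig_ext (trigD (IH1 g tg) (IH2 g tg)) _ => w; ring.
- by apply: trig_ext (trigZ a (IH1 g tg)) _ => w; ring.
Qed.

Lemma trig_bern h m (g : 'rV[R]_k -> R -> R) a (x : 'rV[R]_k -> R) :
  (forall t, trig_poly (fun w => g w t)) -> trig_poly x ->
  trig_poly (fun w => bern h m (g w) a (x w)).
Proof.
move=> tg tx; elim: m a => [|m IH] a /=; first exact: tg.
apply: trigD; apply: trigM => //.
by apply: trigD; [exact: trig_cst|apply: trig_ext (trigZ (-1) tx) _ => w; rewrite mulN1r].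
Qed.

Lemma trig_mbern m s (f : 'rV[R]_k -> R) y (x : 'rV[R]_k -> 'rV[R]_k) :
  (forall j, trig_poly (fun w => x w 0 j)) ->
  trig_poly (fun w => mbern m s f y (x w)).
Proof.
move=> tx; elim: s y => [|j s IH] y /=; first exact: trig_cst.
by apply: trig_bern => // t; exact: IH.
Qed.

Lemma norm_entry_le (m n : nat) (D : 'M[R]_(m, n)) i j : `|D i j| <= `|D|.
Proof.
rewrite [leRHS]/Num.Def.normr/= mx_normrE.
by apply/bigmax_geP; right; exists (i, j).
Qed.

Lemma norm_le_coord (w : 'rV[R]_k) (L : R) : 0 <= L ->
  (`|w| <= L <-> forall j, `|w 0 j| <= L).
Proof.
move=> L0; split => [wL j|wL].
  exact: le_trans (norm_entry_le w 0 j) wL.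
rewrite [leLHS]/Num.Def.normr/= mx_normrE; apply/bigmax_leP; split => // -[i j] _ /=.
by rewrite ord1.
Qed.

Lemma norm_lt_coord (w : 'rV[R]_k) (L : R) : 0 < L ->
  (forall j, `|w 0 j| < L) -> `|w| < L.
Proof.
move=> L0 wL.
rewrite [ltLHS]/Num.Def.normr/= mx_normrE; apply/bigmax_ltP; split => // -[i j] _ /=.
by rewrite ord1.
Qed.

Lemma compact_norm_ball (L : R) : compact [set w : 'rV[R]_k | `|w| <= L].
Proof.
apply: bounded_closed_compact.
  exists L; split; first exact: num_real.
  by move=> M LM w /= wL; rewrite (le_trans wL)// ltW.
rewrite (_ : [set _ | _] = Num.Def.normr @^-1` [set t | t <= L])//.
apply: closed_comp; last exact: closed_le.
by move=> w _; exact: norm_continuous.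
Qed.

(* [phi] inverts [t |-> (1 + sin (lam t)) / 2] on [-L, L]; hence [f] agrees there with a
   function of the quantities [(1 + sin (lam w_j)) / 2], whose Bernstein polynomials are
   trigonometric polynomials in [w] with the same uniform bound as [f]. *)
Lemma trig_approx (f : 'rV[R]_k -> R) (K L e : R) :
  continuous f -> (forall w, `|f w| <= K) -> 0 < L -> 0 < e ->
  exists g, [/\ trig_poly g, (forall w, `|g w| <= K) &
    forall w, `|w| <= L -> `|f w - g w| <= e].
Proof.
move=> cf fK L0 e0.
(* For [|t| <= L] this gives [|lam * t| <= 2^-1], hence [|sin (lam * t)| <= 2^-1], where [asin]
   inverts [sin] and [clamp] is the identity. Clamping at [2^-1] keeps [asin] inside the open
   interval on which it is continuous and makes [phi] continuous and bounded on the whole line. *)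
pose lam : R := (2 * L)^-1.
have lam0 : 0 < lam by rewrite invr_gt0 mulr_gt0.
pose clamp (t : R) : R := Num.max (- 2^-1) (Num.min 2^-1 t).
have clampP t : (t <= - 2^-1 /\ clamp t = - 2^-1) \/
    (- 2^-1 <= t <= 2^-1 /\ clamp t = t) \/ (2^-1 <= t /\ clamp t = 2^-1).
  rewrite /clamp; have [h|h] := leP 2^-1 t.
    by right; right; split=> //; rewrite max_r//; lra.
  have [h2|h2] := leP (- 2^-1) t; first by right; left; split=> //=; exact: ltW.
  by left; split => //; exact: ltW.
have clamp_bd t : - 2^-1 <= clamp t <= 2^-1.
  by case: (clampP t) => [[? ->]|[[? ->]|[? ->]]]; lra.
have clampE t : - 2^-1 <= t <= 2^-1 -> clamp t = t.
  by case: (clampP t) => [[? ->]|[[? ->]|[? ->]]]; lra.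
pose phi (t : R) : R := asin (clamp (2 * t - 1)) / lam.
have cphi : continuous phi.
  move=> t; apply: cvgMl.
  have cc : continuous clamp.
    move=> u; apply/cvgrPdist_le => e' e'0.
    have /cvgrPdist_le/(_ _ e'0) := @cvg_id _ (nbhs u); apply: filterS => v /=.
    apply: le_trans; rewrite ler_norml.
    have := ler_norm (u - v); have := ler_norm (v - u); rewrite (distrC v u).
    by case: (clampP u) => [[? ->]|[[? ->]|[? ->]]];
      case: (clampP v) => [[? ->]|[[? ->]|[? ->]]] ? ?; lra.
  apply: (@continuous_comp _ _ _ (fun t : R => clamp (2 * t - 1)) asin).
    apply: (@continuous_comp _ _ _ (fun t : R => 2 * t - 1) clamp); last exact: cc.
    by apply: cvgB; [apply: cvgMr; exact: cvg_id|exact: cvg_cst].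
  apply: continuous_asin; have := clamp_bd (2 * t - 1); lra.
have phiB t : `|phi t| <= pi / 2 / lam.
  have il0 : 0 < lam^-1 by rewrite invr_gt0.
  rewrite /phi normrM normfV (gtr0_norm lam0) ler_pM2r//.
  have h : -1 <= clamp (2 * t - 1) <= 1 by have := clamp_bd (2 * t - 1); lra.
  by rewrite ler_norml asin_geNpi2// asin_lepi2.
pose Phi (y : 'rV[R]_k) : 'rV[R]_k := \row_j phi (y 0 j).
pose F y := f (Phi y).
have FK y : `|F y| <= K by exact: fK.
have e20 : 0 < e / 2 by rewrite divr_gt0.
have B0 : 0 < pi / 2 / lam :> R by rewrite divr_gt0// divr_gt0// pi_gt0.
(* The ball contains the range of [Phi]; [d1] is then fed to the uniform continuity of [phi] on
   [[0, 1]], and [d2] serves for [F] on the unit box. *)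
have [d1 d10 Hd1] := compact_unif_continuous (@compact_norm_ball (pi / 2 / lam)) cf e20.
have [d2 d20 Hd2] := compact_unif_continuous (@segment_compact R 0 1) cphi d10.
have uF x y : unit_box x -> `|x - y| < d2 -> `|F x - F y| < e / 2.
  move=> ux xy; apply: Hd1 => /=.
    by apply: (proj2 (norm_le_coord _ (ltW B0))) => j; rewrite mxE.
  apply: norm_lt_coord => // j; rewrite !mxE; apply: Hd2.
    by rewrite /= in_itv/=; exact: ux.
  apply: le_lt_trans xy.
  have /(norm_le_coord _ (normr_ge0 (x - y)))/(_ j) := lexx `|x - y|.
  by rewrite !mxE.
pose X (w : 'rV[R]_k) : 'rV[R]_k := \row_j ((1 + sin (lam * w 0 j)) / 2).
have uX w : unit_box (X w).
  by move=> j; rewrite mxE; have := sin_geN1 (lam * w 0 j); have := sin_le1 (lam * w 0 j); lra.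
have tX j : trig_poly (fun w => X w 0 j).
  apply: trig_ext (trigD (trig_cst 2^-1)
    (trigZ 2^-1 (trig_cos (lam *: delta_mx 0 j) (- (pi / 2))))) _ => w.
  have -> : (w *m (lam *: delta_mx 0 j : 'rV[R]_k)^T) 0 0 = lam * w 0 j.
    have -> : (lam *: delta_mx 0 j : 'rV[R]_k)^T = lam *: delta_mx j 0.
      by apply/matrixP => a b; rewrite !mxE andbC.
    by rewrite -scalemxAr [LHS]mxE -colE mxE.
  by rewrite mxE cosBpihalf; field.
have FX w : `|w| <= L -> F (X w) = f w.
  move=> /(norm_le_coord _ (ltW L0)) wL; congr f; apply/rowP => j; rewrite !mxE /phi.
  have -> : 2 * ((1 + sin (lam * w 0 j)) / 2) - 1 = sin (lam * w 0 j) by field.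
  have tb : `|lam * w 0 j| <= 2^-1.
    rewrite normrM (gtr0_norm lam0) mulrC ler_pdivrMr ?mulr_gt0//.
    by rewrite mulrA mulVf// mul1r.
  have sb : `|sin (lam * w 0 j)| <= 2^-1 by rewrite (le_trans (norm_sin_le _)).
  rewrite clampE; last by rewrite -ler_norml.
  rewrite sinK; first by rewrite mulrC mulKf// gt_eqF.
  rewrite in_itv/= -ler_norml (le_trans tb)//.
  by have := pi_ge2 R; lra.
pose M := 2 * K / d2 ^+ 2 * k%:R.
have K0 : 0 <= K by rewrite (le_trans _ (fK 0)).
have M0 : 0 <= M by apply: mulr_ge0 => //; apply: divr_ge0; [exact: mulr_ge0|exact/exprn_ge0/ltW].
pose m := (Num.truncn (M / (e / 2))).+1.
have mM : M / m%:R <= e / 2.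
  rewrite ler_pdivrMr ?ltr0n// mulrC -ler_pdivrMr//.
  by rewrite ltW// /m; exact: truncnS_gt.
exists (fun w => mbern m (enum 'I_k) F 0 (X w)); split.
- exact: trig_mbern.
- by move=> w; exact: mbern_bound.
- move=> w wL; rewrite -(FX w wL) distrC.
  rewrite (le_trans (@mbern_approx _ _ F K (e / 2) d2 (X w) m _ _ _ _ _ _))//.
    by move=> y; exact: uF.
  by rewrite [_ * (_ / _)]mulrA -/M; lra.
Qed.

End trigonometric_polynomials.

(** * Convergence in law *)

Section convergence_in_law.
Context {R : realType} {k : nat}.

Definition measurable_coords {d} {T : measurableType d} (Y : T -> 'rV[R]_k) :=
  forall j, measurable_fun setT (fun w => Y w 0 j).

Lemma measurable_dot d (T : measurableType d) (Y : T -> 'rV[R]_k) (t : 'rV[R]_k) :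
  measurable_coords Y -> measurable_fun setT (fun w => (Y w *m t^T) 0 0).
Proof.
move=> mY; rewrite (_ : (fun _ => _) = fun w => \sum_j Y w 0 j * t 0 j).
  by apply: measurable_sum => j; exact: measurable_funM.
by apply/funext => w; rewrite mxE; apply: eq_bigr => j _; rewrite mxE.
Qed.

Lemma measurable_trig d (T : measurableType d) (Y : T -> 'rV[R]_k) (g : 'rV[R]_k -> R) :
  measurable_coords Y -> trig_poly g -> measurable_fun setT (g \o Y).
Proof.
move=> mY; elim=> [t c|f1 f2 _ IH1 _ IH2|a f _ IH].
- by apply: measurable_cos_comp; apply: measurable_funD => //; exact: measurable_dot.
- exact: measurable_funD.
- exact: measurable_funM.
Qed.

Lemma trig_approx_seq (f : 'rV[R]_k -> R) (K : R) :
  continuous f -> (forall w, `|f w| <= K) ->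
  exists g : nat -> 'rV[R]_k -> R, forall m, [/\ trig_poly (g m), (forall w, `|g m w| <= K) &
    forall w, `|w| <= m.+1%:R -> `|f w - g m w| <= m.+1%:R^-1].
Proof.
move=> cf fK.
have H m : exists g, [/\ trig_poly g, (forall w, `|g w| <= K) &
    forall w, `|w| <= m.+1%:R -> `|f w - g w| <= m.+1%:R^-1].
  by apply: trig_approx => //; rewrite ?invr_gt0 ltr0n.
by have [g Hg] := choice H; exists g.
Qed.

Lemma trig_approx_cvg (f : 'rV[R]_k -> R) (g : nat -> 'rV[R]_k -> R) (w : 'rV[R]_k) :
  (forall m w, `|w| <= m.+1%:R -> `|f w - g m w| <= m.+1%:R^-1) ->
  g m w @[m --> \oo] --> f w.
Proof.
move=> fg; apply/cvgrPdist_le => e e0; near=> m.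
have me : m.+1%:R^-1 <= e.
  by near: m; move/cvgr0Pnorm_le : (@cvg_harmonic R) => /(_ _ e0); apply: filterS => n /=;
    exact: le_trans (ler_norm _).
apply: le_trans me; apply: fg.
have mw : `|w| <= m%:R by near: m; exact: nbhs_infty_ger.
by rewrite (le_trans mw)// ler_nat.
Unshelve. all: by end_near. Qed.

(** [f] is a pointwise limit of trigonometric polynomials, and those are measurable functions of the
    coordinates. *)
Lemma measurable_continuous_comp d (T : measurableType d) (Y : T -> 'rV[R]_k)
    (f : 'rV[R]_k -> R) (K : R) :
  measurable_coords Y -> continuous f -> (forall w, `|f w| <= K) ->
  measurable_fun setT (f \o Y).
Proof.
move=> mY cf fK; have [g Hg] := trig_approx_seq cf fK.
apply: (measurable_fun_cvg (h := fun m => g m \o Y)) => [m|w _].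
  by have [tg _ _] := Hg m; exact: measurable_trig.
by apply: trig_approx_cvg => m v vm; have [_ _] := Hg m; apply.
Qed.

Lemma cvg_trig_of_cos d d' (T : measurableType d) (T' : measurableType d')
    (P : probability T R) (Q : probability T' R) (Y : nat -> T -> 'rV[R]_k)
    (G : T' -> 'rV[R]_k) (g : 'rV[R]_k -> R) :
  (forall n, measurable_coords (Y n)) -> measurable_coords G ->
  (forall (t : 'rV[R]_k) (c : R), \int[P]_w cos ((Y n w *m t^T) 0 0 + c) @[n --> \oo] -->
    \int[Q]_w cos ((G w *m t^T) 0 0 + c)) ->
  trig_poly g ->
  \int[P]_w g (Y n w) @[n --> \oo] --> \int[Q]_w g (G w).
Proof.
move=> mY mG hcos tg.
have [K gK] : exists K, forall w, `|g w| <= K.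
  elim: tg => [t c|f1 f2 _ [K1 H1] _ [K2 H2]|a f _ [K1 H1]].
  - by exists 1 => w; exact: cos_max.
  - by exists (K1 + K2) => w; rewrite (le_trans (ler_normD _ _))// lerD.
  - by exists (`|a| * K1) => w; rewrite normrM ler_wpM2l.
suff H : \int[P]_w g (Y n w) @[n --> \oo] --> \int[Q]_w g (G w) /\
    ((forall n, P.-integrable setT (EFin \o (g \o Y n))) /\ Q.-integrable setT (EFin \o (g \o G))).
  by case: H.
elim: tg => [t c|f1 f2 _ [IH1 [i1 j1]] _ [IH2 [i2 j2]]|a f _ [IH [i j]]] //; split.
- exact: hcos.
- split => [n|]; apply: integrable_cos_comp; apply: measurable_funD => //; exact: measurable_dot.
- rewrite [X in _ --> X]RintegralD//.
  rewrite (_ : (fun n => _) = (fun n => \int[P]_w f1 (Y n w) + \int[P]_w f2 (Y n w))).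
    exact: cvgD.
  by apply/funext => n; rewrite RintegralD//; [exact: i1|exact: i2].
- by split => [n|]; apply: integrableDR => //; [exact: i1|exact: i2].
- rewrite [X in _ --> X]RintegralZl//.
  rewrite (_ : (fun n => _) = (fun n => a * \int[P]_w f (Y n w))); first exact: cvgMr.
  by apply/funext => n; rewrite RintegralZl//; exact: i.
- by split => [n|]; apply: integrableZR; [exact: i|exact: j].
Qed.

Lemma cvg_in_law_of_cos d d' (T : measurableType d) (T' : measurableType d')
    (P : probability T R) (Q : probability T' R) (Y Z : nat -> T -> 'rV[R]_k)
    (G : T' -> 'rV[R]_k) :
  (forall n, measurable_coords (Y n)) -> (forall n, measurable_coords (Z n)) ->
  measurable_coords G ->
  (forall (t : 'rV[R]_k) (c : R), \int[P]_w cos ((Y n w *m t^T) 0 0 + c) @[n --> \oo] -->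
    \int[Q]_w cos ((G w *m t^T) 0 0 + c)) ->
  (forall e : R, 0 < e -> exists M : R, forall dlt : R, 0 < dlt ->
    \forall n \near \oo, exists B : set T, [/\ measurable B, (P (~` B) <= e%:E)%E &
      forall w, B w -> `|Y n w| <= M /\ `|Y n w - Z n w| < dlt]) ->
  forall f : 'rV[R]_k -> R, continuous f -> (exists M, forall x, `|f x| <= M) ->
    ('E_P[f \o Z n])%E @[n --> \oo] --> ('E_Q[f \o G])%E.
Proof.
move=> mY mZ mG hcos hB f cf [K fK].
have K0 : 0 <= K by rewrite (le_trans _ (fK 0)).
have mfZ n : measurable_fun setT (f \o Z n) by exact: measurable_continuous_comp cf fK.
have mfG : measurable_fun setT (f \o G) by exact: measurable_continuous_comp cf fK.
have ifZ n : P.-integrable setT (EFin \o (f \o Z n)) by apply: (integrable_bounded P (mfZ n)) => w; exact: fK.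
have ifG : Q.-integrable setT (EFin \o (f \o G)) by apply: (integrable_bounded Q mfG) => w; exact: fK.
have EZ n : ('E_P[f \o Z n] = (\int[P]_w f (Z n w))%:E)%E.
  by rewrite unlock /Rintegral fineK//; exact: (integrable_fin_num measurableT (ifZ n)).
have EG : ('E_Q[f \o G] = (\int[Q]_w f (G w))%:E)%E.
  by rewrite unlock /Rintegral fineK//; exact: (integrable_fin_num measurableT ifG).
rewrite EG (_ : (fun n => _) = (fun n => (\int[P]_w f (Z n w))%:E)); last first.
  by apply/funext => n; rewrite EZ.
apply: cvg_EFin; first by near=> n.
apply/cvgrPdist_le => e e0.
have [g Hg] := trig_approx_seq cf fK.
pose e1 := e / (4 + 2 * K).
have e10 : 0 < e1 by rewrite divr_gt0//; lra.
have igG m : Q.-integrable setT (EFin \o (g m \o G)).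
  have [tg gK _] := Hg m.
  by apply: (integrable_bounded Q (measurable_trig mG tg)) => w; exact: gK.
have igY m n : P.-integrable setT (EFin \o (g m \o Y n)).
  have [tg gK _] := Hg m.
  by apply: (integrable_bounded P (measurable_trig (mY n) tg)) => w; exact: gK.
have gG : \int[Q]_w g m (G w) @[m --> \oo] --> \int[Q]_w f (G w).
  have := @dominated_cvg _ _ _ Q setT measurableT (fun m => EFin \o (g m \o G))
    (EFin \o (f \o G)) (fun=> K%:E).
  move=> H; have {}H : (\int[Q]_w (EFin \o (g m \o G)) w)%E @[m --> \oo] -->
      (\int[Q]_w (EFin \o (f \o G)) w)%E.
    apply: H => //.
    - move=> m; have [tg gK _] := Hg m; apply/measurable_EFinP; exact: measurable_trig.
    - move=> w _; apply: cvg_EFin; first by near=> m.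
      by apply: trig_approx_cvg => m v vm; have [_ _] := Hg m; apply.
    - exact: integrable_cstR.
    - by move=> m w _ /=; rewrite lee_fin; have [_ gK _] := Hg m; exact: gK.
  by apply: fine_cvg; rewrite fineK//; exact: (integrable_fin_num measurableT ifG).
have [M HM] := hB _ e10.
have [m [mG1 mM me]] : exists m, [/\ `|\int[Q]_w f (G w) - \int[Q]_w g m (G w)| <= e1,
    M <= m.+1%:R & m.+1%:R^-1 <= e1].
  have n1 : \forall m \near \oo, `|\int[Q]_w f (G w) - \int[Q]_w g m (G w)| <= e1.
    by move/cvgrPdist_le : gG; exact.
  have n2 : \forall m \near \oo, M <= m%:R by exact: nbhs_infty_ger.
  have n3 : \forall m \near \oo, `|m.+1%:R^-1| <= e1 :> R.
    by move/cvgr0Pnorm_le : (@cvg_harmonic R); exact.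
  have [m [[h1 h2] h3]] := filter_ex (filterI (filterI n1 n2) n3).
  exists m; split => //; first by rewrite (le_trans h2)// ler_nat.
  exact: le_trans (ler_norm _) h3.
have [tg gK gf] := Hg m.
have [dlt dlt0 Hd] := compact_unif_continuous (@compact_norm_ball R k M) cf e10.
have gY : \int[P]_w g m (Y n w) @[n --> \oo] --> \int[Q]_w g m (G w).
  exact: cvg_trig_of_cos.
have near1 : \forall n \near \oo, `|\int[Q]_w g m (G w) - \int[P]_w g m (Y n w)| <= e1.
  by move/cvgrPdist_le : gY; exact.
have := HM _ dlt0; apply: filterS2 near1 => n near1 [B [mB PB HBw]].
have mCB : measurable (~` B) by exact: measurableC.
have iInd : P.-integrable setT (EFin \o (\1_(~` B) : T -> R)).
  apply: (@integrable_bounded _ _ _ _ _ 1) => [|w]; first exact: measurable_indic.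
  by rewrite indicE; case: (_ \in _); rewrite ?normr1 ?normr0.
have iD : P.-integrable setT (EFin \o (fun w => g m (Y n w) - f (Z n w))).
  by apply: integrableBR; [exact: igY|exact: ifZ].
have near2 : `|\int[P]_w g m (Y n w) - \int[P]_w f (Z n w)| <= 2 * e1 + 2 * K * e1.
  rewrite -RintegralB//; [|exact: igY|exact: ifZ].
  apply: (le_trans (le_normr_Rintegral _ iD)) => //.
  apply: (@le_trans _ _ (\int[P]_w (2 * e1 + 2 * K * \1_(~` B) w))).
    apply: le_Rintegral => //.
    - exact: (@integrable_norm _ _ _ P setT).
    - by apply: integrableDR; [exact: integrable_cstR|exact: integrableZR].
    - move=> w _; have [Bw|nBw] := pselect (B w).
        rewrite indicE memNset; last by move=> /(_ Bw).
        rewrite mulr0 addr0.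
        have [YM YZ] := HBw w Bw.
        have h1 := gf (Y n w) (le_trans YM mM).
        have h2 := Hd (Y n w) (Z n w) YM YZ.
        rewrite distrC in h1; have {}h1 := le_trans h1 me.
        rewrite -(subrKA (f (Y n w))) (le_trans (ler_normD _ _))//; lra.
      rewrite indicE mem_set// mulr1.
      have := ler_normB (g m (Y n w)) (f (Z n w)); have := gK (Y n w); have := fK (Z n w).
      by move: (`|_ - _|) (`|g m _|) (`|f _|) => a b c; lra.
  rewrite RintegralD//; [|exact: integrable_cstR|exact: integrableZR].
  rewrite Rintegral_cstP RintegralZl// lerD2l ler_wpM2l//; first lra.
  rewrite /Rintegral integral_indic// setIT.
  by rewrite -lee_fin fineK//; exact: fin_num_measure.
have -> : e = e1 + e1 + (2 * e1 + 2 * K * e1).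
  by rewrite /e1; field; rewrite gt_eqF//; lra.
rewrite -(subrKA (\int[P]_w g m (Y n w))) (le_trans (ler_normD _ _))// lerD//.
by rewrite -(subrKA (\int[Q]_w g m (G w))) (le_trans (ler_normD _ _))// lerD.
Unshelve. all: by end_near. Qed.

End convergence_in_law.

(** * Minimisers of the penalised least squares objective *)

Section quadratic_forms.
Context {R : realType}.

Lemma norm_dot_le (p : nat) (u v : 'rV[R]_p) :
  `|(u *m v^T) 0 0| <= p%:R * `|u| * `|v|.
Proof.
rewrite mulmx_trE (le_trans (ler_norm_sum _ _ _))//.
apply: (@le_trans _ _ (\sum_(j < p) `|u| * `|v|)).
  apply: ler_sum => j _; rewrite normrM ler_pM//.
    exact: (proj1 (norm_le_coord u (normr_ge0 u)) (lexx _)).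
  exact: (proj1 (norm_le_coord v (normr_ge0 v)) (lexx _)).
by rewrite sumr_const card_ord -mulrA mulr_natl.
Qed.

Lemma norm_mulmx_le (m p : nat) (u : 'rV[R]_m) (D : 'M[R]_(m, p)) (c : R) :
  0 <= c -> (forall i j, `|D i j| <= c) -> `|u *m D| <= m%:R * c * `|u|.
Proof.
move=> c0 Dc; apply: (proj2 (norm_le_coord _ _)); first by rewrite !mulr_ge0.
move=> j; rewrite mxE (le_trans (ler_norm_sum _ _ _))//.
apply: (@le_trans _ _ (\sum_(i < m) c * `|u|)).
  apply: ler_sum => i _; rewrite normrM mulrC ler_pM//.
  exact: (proj1 (norm_le_coord u (normr_ge0 u)) (lexx _)).
by rewrite sumr_const card_ord -mulrA mulr_natl.
Qed.

Lemma norm_bilinear_le (p : nat) (u v : 'rV[R]_p) (D : 'M[R]_p) (c : R) :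
  0 <= c -> (forall i j, `|D i j| <= c) ->
  `|(u *m D *m v^T) 0 0| <= p%:R ^+ 2 * c * `|u| * `|v|.
Proof.
move=> c0 Dc; rewrite (le_trans (norm_dot_le _ _))//.
rewrite ler_wpM2r// expr2 -!mulrA ler_wpM2l// mulrA.
exact: norm_mulmx_le.
Qed.

Lemma posdef_unitmx (p : nat) (C : 'M[R]_p) : posdef C -> C \in unitmx.
Proof.
move=> [_ Cpos]; rewrite -row_free_unit -kermx_eq0; apply/negPn/negP => /rowV0Pn[v].
move=> /sub_kermxP vC v0; have := Cpos v v0.
by rewrite vC mul0mx mxE ltxx.
Qed.

Lemma posdef_invmx (p : nat) (C : 'M[R]_p) : posdef C -> posdef (invmx C).
Proof.
move=> Cpd; have Cu := posdef_unitmx Cpd; have [Csym Cpos] := Cpd.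
have isym : (invmx C)^T = invmx C by rewrite trmx_inv Csym.
split => // v v0.
have -> : v *m invmx C *m v^T = (v *m invmx C) *m C *m (v *m invmx C)^T.
  by rewrite trmx_mul isym mulmxKV// mulmxA.
apply: Cpos; apply: contra_neq v0 => h.
by rewrite -[v](mulmxKV Cu) h mul0mx.
Qed.

Lemma posdef_lower_bound (p : nat) (C : 'M[R]_p) : posdef C ->
  exists2 lam : R, 0 < lam & forall u : 'rV[R]_p, lam * `|u| ^+ 2 <= (u *m C *m u^T) 0 0.
Proof.
move=> Cpd; have [B BC] := posdef_factorization Cpd.
have Bu : B \in unitmx.
  have := posdef_unitmx Cpd; rewrite -BC unitmx_mul => /andP[].
  by rewrite unitmx_tr.
pose c := `|invmx B^T|.
have ci i j : `|invmx B^T i j| <= c by exact: norm_entry_le.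
pose K := p%:R * c + 1.
have c0 : 0 <= c by exact: normr_ge0.
have K0 : 0 < K by rewrite ltr_wpDl// mulr_ge0.
exists (K ^-2); first by rewrite invr_gt0 exprn_gt0.
move=> u; pose v := u *m B^T.
have uv : `|u| <= K * `|v|.
  have Btu : B^T \in unitmx by rewrite unitmx_tr.
  rewrite -[u in `|u|](mulmxK Btu) -/v.
  rewrite (le_trans (norm_mulmx_le _ _ ci))// ler_wpM2r// /K; lra.
have -> : u *m C *m u^T = v *m v^T.
  by rewrite -BC /v trmx_mul trmxK !mulmxA.
rewrite mulrC ler_pdivrMr ?exprn_gt0//.
apply: (@le_trans _ _ ((K * `|v|) ^+ 2)).
  by rewrite lerXn2r// nnegrE// mulr_ge0// ltW.
rewrite exprMn mulrC ler_wpM2r ?exprn_ge0 ?(ltW K0)//.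
rewrite mulmx_trE.
have [v0|vn0] := eqVneq `|v| 0.
  by rewrite v0 expr0n/=; apply: sumr_ge0 => j _; rewrite -expr2 sqr_ge0.
have := vn0 => /mx_norm_neq0[[i0 j]]; rewrite ord1/= => nE.
rewrite (_ : `|v| = `|v 0 j|); last exact: nE.
rewrite (bigD1 j)//= real_normK ?num_real// -expr2 lerDl.
by apply: sumr_ge0 => i _; rewrite -expr2 sqr_ge0.
Qed.

Lemma quad_diff (p : nat) (u v : 'rV[R]_p) (D : 'M[R]_p) :
  (u *m D *m u^T) 0 0 - (v *m D *m v^T) 0 0 =
  (u *m D *m (u - v)^T) 0 0 + ((u - v) *m D *m v^T) 0 0.
Proof.
rewrite (linearB trmx) mulmxBr !mulmxBl.
have addE (A B : 'M[R]_1) : (A - B) 0 0 = A 0 0 - B 0 0 by rewrite !mxE.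
by rewrite !addE; ring.
Qed.

Lemma trmx_quad (p : nat) (u v : 'rV[R]_p) (D : 'M[R]_p) : D^T = D ->
  (u *m D *m v^T) 0 0 = (v *m D *m u^T) 0 0.
Proof.
move=> Dsym; have -> : (u *m D *m v^T) 0 0 = ((u *m D *m v^T)^T) 0 0 by rewrite [RHS]mxE.
by rewrite !trmx_mul trmxK Dsym mulmxA.
Qed.

End quadratic_forms.

Section selection.
Context {R : realType} {p : nat} (A : {set 'I_p}).

Definition sel_mx : 'M[R]_(#|A|, p) := \matrix_(i, j) (enum_val i == j)%:R.

Lemma restr_rowE (b : 'rV[R]_p) : restr_row A b = b *m sel_mx^T.
Proof.
apply/rowP => i; rewrite !mxE (bigD1 (enum_val i))//= !mxE eqxx mulr1 big1 ?addr0//.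
by move=> j /negPf ji; rewrite !mxE eq_sym ji mulr0.
Qed.

Lemma restr_mxE (C : 'M[R]_p) : restr_mx A C = sel_mx *m C *m sel_mx^T.
Proof.
apply/matrixP => i j; rewrite !mxE (bigD1 (enum_val j))//= !mxE eqxx mulr1.
rewrite [X in _ = _ + X]big1 ?addr0 => [|k /negPf kj]; last by rewrite !mxE eq_sym kj mulr0.
rewrite (bigD1 (enum_val i))//= !mxE eqxx mul1r big1 ?addr0// => k /negPf ki.
by rewrite !mxE eq_sym ki mul0r.
Qed.

Lemma sel_mxK : sel_mx *m sel_mx^T = 1%:M.
Proof.
apply/matrixP => i j; rewrite !mxE (bigD1 (enum_val i))//= !mxE eqxx mul1r big1 ?addr0.
  by rewrite eq_sym (inj_eq enum_val_inj).
by move=> k /negPf ki; rewrite !mxE eq_sym ki mul0r.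
Qed.

Lemma sel_mxE (v : 'rV[R]_#|A|) j :
  (v *m sel_mx) 0 j = if j \in A then (v *m sel_mx) 0 j else 0.
Proof.
case: ifPn => // jA; rewrite mxE big1// => i _; rewrite mxE.
by case: eqP => [ij|]; rewrite ?mulr0//; move: jA; rewrite -ij enum_valP.
Qed.

Lemma sel_mx_supp (u : 'rV[R]_p) : (forall j, j \notin A -> u 0 j = 0) ->
  u *m sel_mx^T *m sel_mx = u.
Proof.
move=> uA; apply/rowP => j; rewrite sel_mxE; case: ifPn => jA; last by rewrite uA.
rewrite -restr_rowE mxE (bigD1 (enum_rank_in jA j))//= !mxE enum_rankK_in// eqxx mulr1.
rewrite big1 ?addr0// => i ij; rewrite !mxE; case: eqP => [e|]; last by rewrite mulr0.
by case/eqP: ij; apply: enum_val_inj; rewrite e enum_rankK_in.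
Qed.

Lemma posdef_restr (C : 'M[R]_p) : posdef C -> posdef (restr_mx A C).
Proof.
move=> [Csym Cpos]; rewrite restr_mxE; split.
  by rewrite !trmx_mul trmxK Csym mulmxA.
move=> v v0.
have -> : v *m (sel_mx *m C *m sel_mx^T) *m v^T = (v *m sel_mx) *m C *m (v *m sel_mx)^T.
  by rewrite trmx_mul !mulmxA.
apply: Cpos; apply: contra_neq v0 => h.
by rewrite -[v]mulmx1 -sel_mxK mulmxA h mul0mx.
Qed.

End selection.

Section penalty.
Context {R : realType}.
Variables (eta alpha : R).
Hypotheses (eta0 : 0 < eta) (alpha0 : 0 < alpha).

Definition rho (t : R) := eta / alpha * (Num.sqrt (1 + 2 * alpha * `|t|) - 1).

Let arg_ge1 (t : R) : 1 <= 1 + 2 * alpha * `|t|.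
Proof. by rewrite lerDl !mulr_ge0// ltW. Qed.

Let sqrt_ge1 (t : R) : 1 <= Num.sqrt (1 + 2 * alpha * `|t|).
Proof. by rewrite -[leLHS]sqrtr1; apply: ler_wsqrtr; exact: arg_ge1. Qed.

Let sqr_sqrtE (t : R) : Num.sqrt (1 + 2 * alpha * `|t|) ^+ 2 = 1 + 2 * alpha * `|t|.
Proof. by rewrite sqr_sqrtr// (le_trans ler01). Qed.

Lemma rho0 : rho 0 = 0.
Proof. by rewrite /rho normr0 mulr0 addr0 sqrtr1 subrr mulr0. Qed.

Lemma rho_ge0 (t : R) : 0 <= rho t.
Proof. by rewrite /rho mulr_ge0 ?divr_ge0 ?subr_ge0// ltW. Qed.

Lemma rho_diff (t v : R) :
  `|rho (t + v) - rho t| <= 2 * eta / Num.sqrt (1 + 2 * alpha * `|t|) * `|v|.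
Proof.
have h1 := sqr_sqrtE (t + v); have h2 := sqr_sqrtE t.
have g1 := sqrt_ge1 (t + v); have g2 := sqrt_ge1 t.
rewrite /rho -mulrBr; set X := Num.sqrt (1 + 2 * alpha * `|t + v|) in h1 g1 *.
set Y := Num.sqrt (1 + 2 * alpha * `|t|) in h2 g2 *.
have Y0 : 0 < Y by rewrite (lt_le_trans ltr01).
have -> : X - 1 - (Y - 1) = X - Y by ring.
have ea0 : 0 < eta / alpha by rewrite divr_gt0.
rewrite normrM (gtr0_norm ea0).
have tv : `| `|t + v| - `|t| | <= `|v|.
  by rewrite (le_trans (ler_dist_dist _ _))// addrC addKr.
have d : `|X - Y| * (X + Y) = 2 * alpha * `| `|t + v| - `|t| |.
  have XY0 : 0 <= X + Y by rewrite addr_ge0// (le_trans ler01).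
  rewrite -[X + Y in LHS]ger0_norm// -normrM -subr_sqr h1 h2.
  rewrite (_ : _ - _ = 2 * alpha * (`|t + v| - `|t|)); last by ring.
  by rewrite normrM (@ger0_norm _ (2 * alpha))// mulr_ge0// ltW.
have d2 : `|X - Y| * Y <= 2 * alpha * `|v|.
  apply: (@le_trans _ _ (`|X - Y| * (X + Y))).
    by rewrite ler_wpM2l// lerDr (le_trans ler01).
  by rewrite d ler_wpM2l// mulr_ge0// ltW.
have -> : 2 * eta / Y * `|v| = eta / alpha * (2 * alpha * `|v| / Y).
  by field; rewrite !gt_eqF.
by rewrite ler_pM2l// ler_pdivlMr.
Qed.

Lemma rho_lower (t tau : R) : `|t| <= tau ->
  2 * eta / (Num.sqrt (1 + 2 * alpha * tau) + 1) * `|t| <= rho t.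
Proof.
move=> tt.
have h1 := sqr_sqrtE t; have g1 := sqrt_ge1 t.
have tau0 : 0 <= tau by rewrite (le_trans _ tt).
have XY : Num.sqrt (1 + 2 * alpha * `|t|) <= Num.sqrt (1 + 2 * alpha * tau).
  by apply: ler_wsqrtr; rewrite lerD2l ler_wpM2l// mulr_ge0// ltW.
rewrite /rho; set X := Num.sqrt (1 + 2 * alpha * `|t|) in h1 g1 XY *.
set Y := Num.sqrt (1 + 2 * alpha * tau) in XY *.
have Y1 : 0 < Y + 1 by lra.
have e : 2 * alpha * `|t| = (X - 1) * (X + 1) by rewrite -subr_sqr h1 expr1n; ring.
have -> : 2 * eta / (Y + 1) * `|t| = eta / alpha * (2 * alpha * `|t| / (Y + 1)).
  by field; rewrite !gt_eqF.
rewrite e ler_pM2l ?divr_gt0// ler_pdivrMr// ler_wpM2l ?subr_ge0//.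
by rewrite lerD2r.
Qed.

End penalty.

Section argmin.
Context {R : realType} {p : nat}.
Variables (eta alpha s : R) (bstar W : 'rV[R]_p) (Cn : 'M[R]_p).
Hypotheses (eta0 : 0 < eta) (alpha0 : 0 < alpha) (s0 : 0 < s).
Local Notation A := (nzsupp bstar).

(* [u] is the rescaled error [s (b - bstar)], [W] the score, [Cn] the normalised Gram matrix. *)
Definition Vobj (u : 'rV[R]_p) : R :=
  (u *m Cn *m u^T) 0 0 - 2 * (W *m u^T) 0 0 +
  \sum_j rho eta alpha (bstar 0 j + u 0 j / s).

Variables (u : 'rV[R]_p).
Hypothesis umin : forall u', Vobj u <= Vobj u'.
Variables (lam M r c : R).
Hypotheses (lam0 : 0 < lam) (M0 : 0 <= M) (r0 : 0 <= r) (c0 : 0 <= c).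
Hypothesis lamC : forall v : 'rV[R]_p, lam * `|v| ^+ 2 <= (v *m Cn *m v^T) 0 0.
Hypothesis WM : `|W| <= M.
Hypothesis Cc : forall i j, `|Cn i j| <= c.
Hypothesis rA : forall j, j \in A ->
  2 * (eta / s) / Num.sqrt (1 + 2 * alpha * `|bstar 0 j|) <= r.

Let offA j : j \notin A -> bstar 0 j = 0.
Proof. by rewrite inE negbK => /eqP. Qed.

Let nz (x : 'rV[R]_p) : 0 <= `|x| := normr_ge0 x.

Let coord_le (x : 'rV[R]_p) j : `|x 0 j| <= `|x|.
Proof. exact: (proj1 (norm_le_coord x (normr_ge0 x)) (lexx _)). Qed.

Let rho_diffA (v : 'rV[R]_p) j : j \in A ->
  `|rho eta alpha (bstar 0 j + v 0 j / s) - rho eta alpha (bstar 0 j)| <= r * `|v|.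
Proof.
move=> jA; rewrite (le_trans (rho_diff eta0 alpha0 _ _))//.
rewrite normrM normfV (gtr0_norm s0).
have -> : 2 * eta / Num.sqrt (1 + 2 * alpha * `|bstar 0 j|) * (`|v 0 j| / s) =
  2 * (eta / s) / Num.sqrt (1 + 2 * alpha * `|bstar 0 j|) * `|v 0 j| by ring.
rewrite ler_pM// ?rA//.
by rewrite divr_ge0// ?sqrtr_ge0// mulr_ge0// divr_ge0// ltW.
Qed.

Let dotW (v : 'rV[R]_p) : `|(W *m v^T) 0 0| <= p%:R * M * `|v|.
Proof.
rewrite (le_trans (norm_dot_le _ _))// ler_wpM2r// ler_wpM2l//.
Qed.

Definition argmin_radius := (2 * p%:R * M + p%:R * r) / lam.

Lemma argmin_bounded : `|u| <= argmin_radius.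
Proof.
have z00 : (0 : 'M[R]_1) 0 0 = 0 by rewrite mxE.
have := umin 0; rewrite /Vobj trmx0 !mulmx0 z00 mulr0 subr0 add0r => h.
have pen : \sum_j rho eta alpha (bstar 0 j + (0 : 'rV[R]_p) 0 j / s) -
    \sum_j rho eta alpha (bstar 0 j + u 0 j / s) <= p%:R * r * `|u|.
  rewrite -sumrB; apply: (@le_trans _ _ (\sum_(j < p) r * `|u|)); last first.
    by rewrite sumr_const card_ord -mulrA mulr_natl.
  apply: ler_sum => j _; rewrite mxE mul0r addr0.
  have [jA|jA] := boolP (j \in A).
    by rewrite (le_trans (ler_norm _))// distrC rho_diffA.
  rewrite offA// rho0 !add0r.
  have := rho_ge0 eta0 alpha0 (u 0 j / s); have : 0 <= r * `|u| by exact: mulr_ge0.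
  lra.
have l := lamC u; have dw := dotW u; have dw' := ler_norm ((W *m u^T) 0 0).
have key : lam * `|u| ^+ 2 <= (2 * p%:R * M + p%:R * r) * `|u|.
  rewrite mulrDl; move: h pen l dw dw'.
  rewrite (_ : 2 * p%:R * M * `|u| = 2 * (p%:R * M * `|u|)); last by ring.
  lra.
have [u00|un0] := eqVneq `|u| 0.
  rewrite u00 /argmin_radius; apply: divr_ge0; last exact: ltW.
  by rewrite addr_ge0// !mulr_ge0.
have ugt0 : 0 < `|u| by rewrite lt_def un0 nz.
rewrite /argmin_radius ler_pdivlMr// -(ler_pM2r ugt0).
by rewrite (_ : `|u| * lam * `|u| = lam * `|u| ^+ 2)//; ring.
Qed.

(* Zeroing the coordinates of [u] off [A] changes the quadratic part by at most the left-hand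
   side times the norm of the zeroed part, and the penalty by at least the right-hand side. *)
Lemma argmin_sparse :
  2 * p%:R ^+ 2 * c * argmin_radius + 2 * p%:R * M <
    2 * (eta / s) / (Num.sqrt (1 + 2 * alpha * (argmin_radius / s)) + 1) ->
  forall j, j \notin A -> u 0 j = 0.
Proof.
set K := 2 * (eta / s) / _ => KK.
have rad0 : 0 <= argmin_radius by rewrite (le_trans _ argmin_bounded).
pose u' : 'rV[R]_p := \row_j if j \in A then u 0 j else 0.
pose w := u - u'.
have wE j : w 0 j = if j \in A then 0 else u 0 j.
  by rewrite !mxE; case: ifP => _; rewrite ?subrr ?subr0.
have u'u : `|u'| <= argmin_radius.
  apply: (proj2 (norm_le_coord _ rad0)) => j; rewrite mxE.
  case: ifP => _; last by rewrite normr0.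
  exact: le_trans (coord_le _ _) argmin_bounded.
have pen : K * `|w| <= \sum_j rho eta alpha (bstar 0 j + u 0 j / s) -
    \sum_j rho eta alpha (bstar 0 j + u' 0 j / s).
  have K0 : 0 <= K.
    rewrite /K; apply: divr_ge0; last by rewrite addr_ge0// sqrtr_ge0.
    by rewrite mulr_ge0// divr_ge0// ltW.
  have each j : K * `|w 0 j| <= rho eta alpha (bstar 0 j + u 0 j / s) -
      rho eta alpha (bstar 0 j + u' 0 j / s).
    rewrite wE mxE; case: ifPn => jA; first by rewrite normr0 mulr0 subrr.
    rewrite offA// mul0r !add0r rho0 subr0.
    have ts : `|u 0 j / s| <= argmin_radius / s.
      rewrite normrM normfV (gtr0_norm s0) ler_pM2r ?invr_gt0//.
      exact: le_trans (coord_le _ _) argmin_bounded.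
    apply: le_trans (rho_lower eta0 alpha0 ts).
    rewrite normrM normfV (gtr0_norm s0) /K le_eqVlt; apply/orP; left; apply/eqP.
    by ring.
  rewrite -sumrB.
  have [w00|wn0] := eqVneq `|w| 0.
    rewrite w00 mulr0; apply: sumr_ge0 => j _; apply: le_trans (each j).
    by rewrite mulr_ge0.
  have := wn0 => /mx_norm_neq0[[i0 j]]; rewrite ord1/= => nE.
  rewrite (_ : `|w| = `|w 0 j|); last exact: nE.
  rewrite (bigD1 j)//= (le_trans (each j))// lerDl; apply: sumr_ge0 => i _.
  by apply: le_trans (each i); rewrite mulr_ge0.
have h := umin u'; rewrite /Vobj in h.
have qd := quad_diff u u' Cn; rewrite -/w in qd.
have q1 : `|(u *m Cn *m w^T) 0 0| <= p%:R ^+ 2 * c * argmin_radius * `|w|.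
  rewrite (le_trans (norm_bilinear_le _ _ c0 Cc))// ler_wpM2r// ler_wpM2l ?argmin_bounded//.
  by rewrite mulr_ge0// exprn_ge0.
have q2 : `|(w *m Cn *m u'^T) 0 0| <= p%:R ^+ 2 * c * argmin_radius * `|w|.
  rewrite (le_trans (norm_bilinear_le _ _ c0 Cc))// mulrAC ler_wpM2r//.
  by rewrite ler_wpM2l// mulr_ge0// exprn_ge0.
have dW : (W *m u^T) 0 0 - (W *m u'^T) 0 0 = (W *m w^T) 0 0.
  by rewrite /w (linearB trmx) mulmxBr !mxE.
have dw := dotW w; have dw' := ler_norm ((W *m w^T) 0 0).
have n1 := ler_norm (- (u *m Cn *m w^T) 0 0); have n2 := ler_norm (- (w *m Cn *m u'^T) 0 0).
rewrite !normrN in n1 n2.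
have key : K * `|w| <= (2 * p%:R ^+ 2 * c * argmin_radius + 2 * p%:R * M) * `|w|.
  rewrite mulrDl.
  rewrite (_ : 2 * p%:R ^+ 2 * c * argmin_radius * `|w| = 2 * (p%:R ^+ 2 * c * argmin_radius * `|w|)); last by ring.
  rewrite (_ : 2 * p%:R * M * `|w| = 2 * (p%:R * M * `|w|)); last by ring.
  lra.
have w00 : `|w| = 0.
  apply/eqP; apply: contraTT KK => wn0.
  by rewrite -leNgt -(@ler_pM2r _ `|w|)// lt_def wn0 nz.
move=> j jA; have := coord_le w j; rewrite w00 wE (negbTE jA) normr_le0.
by move=> /eqP.
Qed.

(* [u0] minimises the unpenalised quadratic part over the vectors supported in [A]. *)
Lemma argmin_close (C : 'M[R]_p) (u0 : 'rV[R]_p) (lam' e L' : R) : C^T = C ->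
  0 <= e -> 0 < lam' ->
  (forall v : 'rV[R]_p, lam' * `|v| ^+ 2 <= (v *m C *m v^T) 0 0) ->
  (forall i j, `|Cn i j - C i j| <= e) ->
  (forall j, j \notin A -> u 0 j = 0) -> (forall j, j \notin A -> u0 0 j = 0) ->
  (forall v : 'rV[R]_p, (forall j, j \notin A -> v 0 j = 0) ->
     (u0 *m C *m v^T) 0 0 = (W *m v^T) 0 0) ->
  `|u| <= L' -> `|u0| <= L' ->
  lam' * `|u0 - u| ^+ 2 <= 2 * (p%:R ^+ 2 * e * L' * L') + 2 * p%:R * r * L'.
Proof.
move=> Csym e0 l0 lC Ce uA u0A norm_eq uL u0L.
have L0 : 0 <= L' by rewrite (le_trans _ uL).
pose h := u - u0.
have hA j : j \notin A -> h 0 j = 0.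
  by move=> jA; rewrite !mxE uA// u0A// subr0.
have qE (v : 'rV[R]_p) : (v *m Cn *m v^T) 0 0 = (v *m C *m v^T) 0 0 + (v *m (Cn - C) *m v^T) 0 0.
  by rewrite mulmxBr mulmxBl !mxE; ring.
have qB (v : 'rV[R]_p) : `|v| <= L' -> `|(v *m (Cn - C) *m v^T) 0 0| <= p%:R ^+ 2 * e * L' * L'.
  move=> vL; have De i j : `|(Cn - C) i j| <= e by rewrite !mxE; exact: Ce.
  rewrite (le_trans (norm_bilinear_le _ _ e0 De))//.
  by rewrite !ler_pM// ?mulr_ge0// ?exprn_ge0.
have penB (v : 'rV[R]_p) : `|v| <= L' -> (forall j, j \notin A -> v 0 j = 0) ->
    `|\sum_j rho eta alpha (bstar 0 j + v 0 j / s) - \sum_j rho eta alpha (bstar 0 j)| <=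
    p%:R * r * L'.
  move=> vL vA; rewrite -sumrB (le_trans (ler_norm_sum _ _ _))//.
  apply: (@le_trans _ _ (\sum_(j < p) r * L')); last first.
    by rewrite sumr_const card_ord -mulrA mulr_natl.
  apply: ler_sum => j _; have [jA|jA] := boolP (j \in A).
    by rewrite (le_trans (rho_diffA _ jA))// ler_wpM2l.
  by rewrite vA// mul0r addr0 subrr normr0 mulr_ge0.
have V := umin u0; rewrite /Vobj (qE u) (qE u0) in V.
have Wh : (W *m u^T) 0 0 - (W *m u0^T) 0 0 = (W *m h^T) 0 0.
  by rewrite /h (linearB trmx) mulmxBr !mxE.
have qd := quad_diff u u0 C; rewrite -/h in qd.
have uh : (u *m C *m h^T) 0 0 = (h *m C *m h^T) 0 0 + (u0 *m C *m h^T) 0 0.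
  have -> : u = h + u0 by rewrite /h subrK.
  by rewrite !mulmxDl [LHS]mxE.
have sy := trmx_quad h u0 Csym.
have ne := norm_eq h hA.
have := lC h.
have -> : `|u0 - u| = `|h| by rewrite distrC.
have b1 := qB u uL; have b2 := qB u0 u0L.
have p1 := penB u uL uA; have p2 := penB u0 u0L u0A.
move: b1 b2 p1 p2; rewrite !ler_norml => /andP[? ?] /andP[? ?] /andP[? ?] /andP[? ?].
rewrite (_ : 2 * p%:R * r * L' = 2 * (p%:R * r * L')); last by ring.
lra.
Qed.

End argmin.

Lemma near_forall_fin (I : finType) (Q : I -> nat -> Prop) :
  (forall i, \forall n \near \oo, Q i n) -> \forall n \near \oo, forall i, Q i n.
Proof.
move=> H; have {}H i : exists N, forall n, (N <= n)%N -> Q i n.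
  by have [N _ HN] := H i; exists N => n Nn; exact: HN.
have [N HN] := choice H.
exists (\max_i N i)%N => // n /= Nn i; apply: HN; apply: leq_trans Nn.
exact: leq_bigmax.
Qed.

Section objective_expansion.
Context {R : realType} {p : nat}.
Variables (x : nat -> 'rV[R]_p) (bstar : 'rV[R]_p).

Definition score (n : nat) (e : nat -> R) : 'rV[R]_p :=
  \sum_(i < n) (e i / Num.sqrt n%:R) *: x i.

Lemma quad_gram (n : nat) (u : 'rV[R]_p) :
  (u *m gram x n *m u^T) 0 0 = \sum_(i < n) ((x i *m u^T) 0 0) ^+ 2.
Proof.
rewrite /gram mulmx_sumr mulmx_suml summxE; apply: eq_bigr => i _.
rewrite mulmxA -(mulmxA (u *m (x i)^T)) mxE big_ord1 expr2; congr (_ * _).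
by rewrite -[in LHS](trmxK u) -trmx_mul [LHS]mxE.
Qed.

Lemma score_dot (n : nat) (e : nat -> R) (u : 'rV[R]_p) :
  (score n e *m u^T) 0 0 = \sum_(i < n) e i / Num.sqrt n%:R * (x i *m u^T) 0 0.
Proof.
rewrite /score mulmx_suml summxE; apply: eq_bigr => i _.
by rewrite -scalemxAl mxE.
Qed.

Lemma objective_Vobj (n : nat) (e : nat -> R) (eta alpha : R) (u : 'rV[R]_p) :
  (0 < n)%N ->
  objective n x (fun i => (x i *m bstar^T) 0 0 + e i) eta alpha
    (bstar + (Num.sqrt n%:R)^-1 *: u) =
  \sum_(i < n) e i ^+ 2 +
  Vobj eta alpha (Num.sqrt n%:R) bstar (score n e) (n%:R^-1 *: gram x n) u.
Proof.
move=> n0; rewrite /objective /Vobj.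
set s := Num.sqrt n%:R.
have s0 : s != 0 by rewrite gt_eqF// sqrtr_gt0 ltr0n.
have s2 : s ^+ 2 = n%:R by rewrite sqr_sqrtr.
rewrite mulr_sumr addrA; congr (_ + _); last first.
  by apply: eq_bigr => j _; rewrite /rho !mxE (mulrC s^-1).
rewrite -scalemxAr -scalemxAl [X in _ = _ + (X - _)]mxE quad_gram score_dot.
rewrite mulr_sumr [in RHS]mulr_sumr -sumrB -big_split/=; apply: eq_bigr => i _.
have -> : (x i *m (bstar + s^-1 *: u)^T) 0 0 = (x i *m bstar^T) 0 0 + (x i *m u^T) 0 0 / s.
  have -> : (bstar + s^-1 *: u)^T = bstar^T + s^-1 *: u^T.
    by apply/matrixP => a b; rewrite !mxE.
  by rewrite mulmxDr -scalemxAr [LHS]mxE [X in _ + X]mxE (mulrC s^-1).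
by rewrite -/s -s2; field.
Qed.

End objective_expansion.

Section penalty_asymptotics.
Context {R : realType}.
Variables (eta alpha : nat -> R) (c3 : R).
Hypotheses (eta34 : (eta n / (n%:R `^ (3 / 4 : R))) @[n --> \oo] --> 0)
  (eta12 : (eta n / Num.sqrt n%:R) @[n --> \oo] --> +oo)
  (alpha12 : (alpha n / Num.sqrt n%:R) @[n --> \oo] --> c3) (c30 : 0 < c3).

Lemma eta_gt0 : \forall n \near \oo, 0 < eta n.
Proof.
near=> n.
have n0 : (0 < n)%N by near: n; exact: nbhs_infty_gt.
have s0 : 0 < Num.sqrt n%:R :> R by rewrite sqrtr_gt0 ltr0n.
have h : 1 <= eta n / Num.sqrt n%:R by near: n; move/cvgryPge : eta12; apply.
by rewrite -(divfK (lt0r_neq0 s0) (eta n)) mulr_gt0// (lt_le_trans ltr01).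
Unshelve. all: by end_near. Qed.

Lemma alpha_bounds : \forall n \near \oo,
  c3 / 2 * Num.sqrt n%:R <= alpha n <= 2 * c3 * Num.sqrt n%:R.
Proof.
near=> n.
have n0 : (0 < n)%N by near: n; exact: nbhs_infty_gt.
have s0 : 0 < Num.sqrt n%:R :> R by rewrite sqrtr_gt0 ltr0n.
have h : `|c3 - alpha n / Num.sqrt n%:R| <= c3 / 2.
  by near: n; move/cvgrPdist_le : alpha12; apply; rewrite divr_gt0.
rewrite -(ler_pdivlMr _ _ s0) -(ler_pdivrMr _ _ s0).
by move: h; rewrite ler_norml => /andP[h1 h2]; apply/andP; split; lra.
Unshelve. all: by end_near. Qed.

Lemma sqrt_quarter (n : nat) : n%:R `^ (3 / 4 : R) = Num.sqrt n%:R * Num.sqrt (Num.sqrt n%:R) :> R.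
Proof.
rewrite -!powR12_sqrt ?powR_ge0// -powRrM.
have [->|n0] := eqVneq n 0%N.
  by rewrite !powR0 ?mulr0//; apply: lt0r_neq0; lra.
rewrite -powRD; last by rewrite pnatr_eq0 n0 implybT.
by congr (_ `^ _); field.
Qed.

Lemma penalty_slope_small (b e : R) : b != 0 -> 0 < e ->
  \forall n \near \oo,
    2 * (eta n / Num.sqrt n%:R) / Num.sqrt (1 + 2 * alpha n * `|b|) <= e.
Proof.
move=> b0 e0.
have nb0 : 0 < `|b| by rewrite normr_gt0.
have cb0 : 0 < c3 * `|b| by rewrite mulr_gt0.
pose k := Num.sqrt (c3 * `|b|).
have k0 : 0 < k by rewrite sqrtr_gt0.
near=> n.
have n0 : (0 < n)%N by near: n; exact: nbhs_infty_gt.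
have s0 : 0 < Num.sqrt n%:R :> R by rewrite sqrtr_gt0 ltr0n.
have ss0 : 0 < Num.sqrt (Num.sqrt n%:R) :> R by rewrite sqrtr_gt0.
have eta0 : 0 < eta n by near: n; exact: eta_gt0.
have /andP[al au] : c3 / 2 * Num.sqrt n%:R <= alpha n <= 2 * c3 * Num.sqrt n%:R.
  by near: n; exact: alpha_bounds.
have h : eta n / (n%:R `^ (3 / 4)) <= e * k / 2.
  rewrite (le_trans (ler_norm _))//; near: n; move/cvgr0Pnorm_le : eta34; apply.
  by rewrite divr_gt0// mulr_gt0.
have lower : k * Num.sqrt (Num.sqrt n%:R) <= Num.sqrt (1 + 2 * alpha n * `|b|).
  rewrite /k -(sqrtrM _ (ltW cb0)); apply: ler_wsqrtr.
  have := ler_wpM2r (ltW nb0) al.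
  set y := alpha n * `|b|; rewrite (_ : 2 * alpha n * `|b| = 2 * y); last by rewrite /y; ring.
  rewrite (_ : c3 * `|b| * _ = 2 * (c3 / 2 * Num.sqrt n%:R * `|b|)); last by field.
  lra.
have low0 : 0 < k * Num.sqrt (Num.sqrt n%:R) by rewrite mulr_gt0.
apply: (@le_trans _ _ (2 * (eta n / Num.sqrt n%:R) / (k * Num.sqrt (Num.sqrt n%:R)))).
  rewrite ler_wpM2l ?lef_pV2 ?posrE ?(lt_le_trans low0)//.
  by rewrite mulr_ge0// divr_ge0// ltW.
move: h; rewrite sqrt_quarter => h.
have -> : 2 * (eta n / Num.sqrt n%:R) / (k * Num.sqrt (Num.sqrt n%:R)) =
    2 / k * (eta n / (Num.sqrt n%:R * Num.sqrt (Num.sqrt n%:R))).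
  by field; rewrite !gt_eqF.
have k20 : 0 <= 2 / k by rewrite divr_ge0// ltW.
apply: (le_trans (ler_wpM2l k20 h)).
by rewrite le_eqVlt; apply/orP; left; apply/eqP; field; rewrite gt_eqF.
Unshelve. all: by end_near. Qed.

Lemma penalty_slope_large (L K : R) : 0 <= L ->
  \forall n \near \oo,
    K < 2 * (eta n / Num.sqrt n%:R) /
      (Num.sqrt (1 + 2 * alpha n * (L / Num.sqrt n%:R)) + 1).
Proof.
move=> L0; pose D := Num.sqrt (1 + 4 * c3 * L) + 1.
have D0 : 0 < D by rewrite ltr_wpDl// sqrtr_ge0.
near=> n.
have n0 : (0 < n)%N by near: n; exact: nbhs_infty_gt.
have s0 : 0 < Num.sqrt n%:R :> R by rewrite sqrtr_gt0 ltr0n.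
have /andP[al au] : c3 / 2 * Num.sqrt n%:R <= alpha n <= 2 * c3 * Num.sqrt n%:R.
  by near: n; exact: alpha_bounds.
have h : (`|K| + 1) * D <= eta n / Num.sqrt n%:R by near: n; move/cvgryPge : eta12; apply.
rewrite (@lt_le_trans _ _ (`|K| + 1))//.
  by rewrite (le_lt_trans (ler_norm K))// ltrDl.
have up : Num.sqrt (1 + 2 * alpha n * (L / Num.sqrt n%:R)) + 1 <= D.
  rewrite lerD2r; apply: ler_wsqrtr; rewrite lerD2l.
  have Ls : 0 <= L / Num.sqrt n%:R by rewrite divr_ge0// ltW.
  have := ler_wpM2r Ls au.
  rewrite (_ : 2 * c3 * _ * _ = 2 * c3 * L); last by field; rewrite gt_eqF.
  lra.
rewrite ler_pdivlMr; last by rewrite ltr_wpDl// sqrtr_ge0.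
have K10 : 0 <= `|K| + 1 by rewrite addr_ge0.
apply: (le_trans (ler_wpM2l K10 up)); apply: (le_trans h).
have : 0 <= eta n / Num.sqrt n%:R by rewrite (le_trans _ h)// mulr_ge0// ltW.
lra.
Unshelve. all: by end_near. Qed.

End penalty_asymptotics.

Section deterministic_oracle.
Context {R : realType} {p : nat}.
Variables (x : nat -> 'rV[R]_p) (bstar : 'rV[R]_p) (C : 'M[R]_p)
  (eta alpha : nat -> R) (c3 : R).
Hypotheses (gramC : forall i j, (gram x n i j / n%:R) @[n --> \oo] --> C i j)
  (Cpd : posdef C)
  (eta34 : (eta n / (n%:R `^ (3 / 4 : R))) @[n --> \oo] --> 0)
  (eta12 : (eta n / Num.sqrt n%:R) @[n --> \oo] --> +oo)
  (alpha12 : (alpha n / Num.sqrt n%:R) @[n --> \oo] --> c3) (c30 : 0 < c3).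

Local Notation A := (nzsupp bstar).
Local Notation E := (sel_mx A).
Local Notation C11 := (restr_mx A C).
Local Notation Cn n := (n%:R^-1 *: gram x n).

Lemma gram_near (e : R) : 0 < e ->
  \forall n \near \oo, forall i j, `|(Cn n) i j - C i j| <= e.
Proof.
move=> e0; apply: near_forall_fin => i; apply: near_forall_fin => j.
have /cvgrPdist_le/(_ _ e0) := gramC (i := i) (j := j).
by apply: filterS => n; rewrite distrC mxE mulrC.
Qed.

Lemma norm_restr_le (v : 'rV[R]_p) : `|restr_row A v| <= `|v|.
Proof.
apply: (proj2 (norm_le_coord _ (normr_ge0 v))) => i; rewrite mxE.
exact: (proj1 (norm_le_coord v (normr_ge0 v)) (lexx _)).
Qed.

Theorem lasso_oracle (M dlt : R) : 0 < M -> 0 < dlt ->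
  \forall n \near \oo, forall (e : nat -> R) (b : 'rV[R]_p),
    (forall b', objective n x (fun i => (x i *m bstar^T) 0 0 + e i) (eta n) (alpha n) b <=
       objective n x (fun i => (x i *m bstar^T) 0 0 + e i) (eta n) (alpha n) b') ->
    `|score x n e| <= M ->
    nzsupp b = A /\
    `|restr_row A (score x n e) *m invmx C11 -
      Num.sqrt n%:R *: (restr_row A b - restr_row A bstar)| < dlt.
Proof.
move=> M0 dlt0.
have [lam lam0 lamC] := posdef_lower_bound Cpd.
have [Csym _] := Cpd.
have C11u : C11 \in unitmx by apply: posdef_unitmx; exact: posdef_restr.
have C11sym : C11^T = C11 by case: (posdef_restr A Cpd).
pose N : 'M[R]_p := E^T *m invmx C11 *m E.
have Ni i j : `|N i j| <= `|N| by exact: norm_entry_le.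
pose rad := @argmin_radius R p (lam / 2) M 1.
pose L := rad + p%:R * `|N| * M.
have lam20 : 0 < lam / 2 by rewrite divr_gt0.
have rad0 : 0 <= rad.
  by rewrite /rad /argmin_radius; apply: divr_ge0; [rewrite addr_ge0// !mulr_ge0// ltW|exact: ltW].
have NM0 : 0 <= p%:R * `|N| * M by rewrite !mulr_ge0// ltW.
have L0 : 0 <= L by rewrite addr_ge0.
pose c := `|C| + 1.
pose Q := 2 * (p%:R ^+ 2 * L * L) + 2 * p%:R * L + 1.
have Q0 : 0 < Q by rewrite ltr_wpDl// addr_ge0// !mulr_ge0// exprn_ge0.
pose kap := lam * dlt ^+ 2 / Q.
have kap0 : 0 < kap by rewrite divr_gt0// mulr_gt0// exprn_gt0.
pose e1 := lam / 2 / (p%:R ^+ 2 + 1).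
have p20 : 0 < p%:R ^+ 2 + 1 :> R by rewrite ltr_wpDl// exprn_ge0.
have e10 : 0 < e1 by rewrite divr_gt0.
have slope (r : R) : 0 < r -> \forall n \near \oo, forall j, j \in A ->
    2 * (eta n / Num.sqrt n%:R) / Num.sqrt (1 + 2 * alpha n * `|bstar 0 j|) <= r.
  move=> r0; apply: near_forall_fin => j.
  have [jA|jA] := boolP (j \in A); last by near=> n.
  have b0 : bstar 0 j != 0 by move: jA; rewrite inE.
  have := penalty_slope_small eta34 eta12 alpha12 c30 b0 r0.
  by apply: filterS.
have separated : \forall n \near \oo, forall j, j \in A -> rad < `|bstar 0 j| * Num.sqrt n%:R.
  apply: near_forall_fin => j.
  have [jA|jA] := boolP (j \in A); last by near=> n.
  have b0 : 0 < `|bstar 0 j| by move: jA; rewrite inE normr_gt0.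
  near=> n => _.
  have n1 : (rad / `|bstar 0 j|) ^+ 2 + 1 <= n%:R.
    by near: n; exact: nbhs_infty_ger.
  have rb : 0 <= rad / `|bstar 0 j| by rewrite divr_ge0.
  have nn : (rad / `|bstar 0 j|) ^+ 2 < n%:R by rewrite (lt_le_trans _ n1)// ltrDl.
  rewrite mulrC -ltr_pdivrMr// -[ltLHS](ger0_norm rb) -sqrtr_sqr ltr_sqrt//.
  exact: le_lt_trans (sqr_ge0 _) nn.
have rK := @penalty_slope_large R eta alpha c3 eta12 alpha12 c30 rad
  (2 * p%:R ^+ 2 * c * rad + 2 * p%:R * M) rad0.
have kap2 : 0 < kap / 2 by rewrite divr_gt0.
near=> n.
have n0 : (0 < n)%N by near: n; exact: nbhs_infty_gt.
have eta0 : 0 < eta n by near: n; exact: (eta_gt0 eta12).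
have alphab : c3 / 2 * Num.sqrt n%:R <= alpha n <= 2 * c3 * Num.sqrt n%:R.
  by near: n; exact: (alpha_bounds alpha12 c30).
have Ce1 : forall i j, `|(Cn n) i j - C i j| <= e1 by near: n; exact: gram_near.
have Ce2 : forall i j, `|(Cn n) i j - C i j| <= kap / 2 by near: n; exact: gram_near.
have Ce3 : forall i j, `|(Cn n) i j - C i j| <= 1 by near: n; exact: gram_near.
have slope1 : forall j, j \in A ->
    2 * (eta n / Num.sqrt n%:R) / Num.sqrt (1 + 2 * alpha n * `|bstar 0 j|) <= 1.
  by near: n; exact: slope.
have slope2 : forall j, j \in A ->
    2 * (eta n / Num.sqrt n%:R) / Num.sqrt (1 + 2 * alpha n * `|bstar 0 j|) <= kap / 2.
  by near: n; exact: slope.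
have sep : forall j, j \in A -> rad < `|bstar 0 j| * Num.sqrt n%:R.
  by near: n; exact: separated.
have large : 2 * p%:R ^+ 2 * c * rad + 2 * p%:R * M <
    2 * (eta n / Num.sqrt n%:R) / (Num.sqrt (1 + 2 * alpha n * (rad / Num.sqrt n%:R)) + 1).
  by near: n; exact: rK.
move=> e b bmin WM; move: alphab slope1 slope2 sep large.
set s := Num.sqrt n%:R => alphab slope1 slope2 sep large.
have s0 : 0 < s by rewrite sqrtr_gt0 ltr0n.
have alpha0 : 0 < alpha n.
  by move: alphab => /andP[+ _]; apply: lt_le_trans; rewrite mulr_gt0// divr_gt0.
pose W := score x n e.
pose u := s *: (b - bstar).
have bE : b = bstar + s^-1 *: u.
  by rewrite /u scalerA mulVf ?scale1r ?gt_eqF// addrC subrK.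
have umin u' : Vobj (eta n) (alpha n) s bstar W (Cn n) u <=
    Vobj (eta n) (alpha n) s bstar W (Cn n) u'.
  have := bmin (bstar + s^-1 *: u').
  by rewrite bE !objective_Vobj// lerD2l.
have Cc i j : `|(Cn n) i j| <= c.
  have := Ce3 i j.
  have := norm_entry_le C i j; have := ler_normD ((Cn n) i j - C i j) (C i j).
  rewrite subrK /c; lra.
have c0 : 0 <= c by rewrite addr_ge0.
have lamCn (v : 'rV[R]_p) : lam / 2 * `|v| ^+ 2 <= (v *m Cn n *m v^T) 0 0.
  have De i j : `|(Cn n - C) i j| <= e1 by rewrite !mxE; have := Ce1 i j; rewrite !mxE.
  have := norm_bilinear_le v v (ltW e10) De.
  have -> : (v *m (Cn n - C) *m v^T) 0 0 = (v *m Cn n *m v^T) 0 0 - (v *m C *m v^T) 0 0.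
    by rewrite mulmxBr mulmxBl !mxE.
  have h1 : p%:R ^+ 2 * e1 * `|v| * `|v| <= lam / 2 * `|v| ^+ 2.
    rewrite -mulrA -expr2 ler_wpM2r ?exprn_ge0// /e1 mulrA ler_pdivrMr// mulrC.
    by rewrite ler_pM2l// lerDl.
  have h2 := lamC v.
  rewrite ler_norml => /andP[h3 _].
  have h4 : lam * `|v| ^+ 2 = lam / 2 * `|v| ^+ 2 + lam / 2 * `|v| ^+ 2 by field.
  lra.
have urad : `|u| <= rad.
  exact: (argmin_bounded eta0 alpha0 s0 umin lam20 (ltW M0) ler01 lamCn WM slope1).
have uoff j : j \notin A -> u 0 j = 0.
  exact: (argmin_sparse eta0 alpha0 s0 umin lam20 (ltW M0) ler01 c0 lamCn WM Cc slope1 large).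
have bj j : b 0 j = bstar 0 j + u 0 j / s by rewrite bE !mxE (mulrC s^-1).
split.
  apply/setP => j; have [jA|jA] := boolP (j \in A); last first.
    have h := jA; rewrite inE negbK in h.
    by rewrite inE bj (eqP h) uoff// mul0r addr0 eqxx.
  rewrite inE bj; apply/eqP => h.
  have := sep j jA; apply/negP; rewrite -leNgt.
  have -> : bstar 0 j = - (u 0 j / s) by apply/eqP; rewrite -addr_eq0 h.
  rewrite normrN normrM normfV (gtr0_norm s0) divfK ?gt_eqF//.
  exact: le_trans (proj1 (norm_le_coord u (normr_ge0 u)) (lexx _) j) urad.
pose u0 := W *m N.
have u0off j : j \notin A -> u0 0 j = 0.
  by move=> /negPf jA; rewrite /u0 /N !mulmxA sel_mxE jA.
have u0L : `|u0| <= L.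
  rewrite (le_trans (norm_mulmx_le _ _ Ni))//.
  rewrite (le_trans (ler_wpM2l _ WM)) ?mulr_ge0// /L lerDr.
  exact: rad0.
have uL : `|u| <= L by rewrite (le_trans urad)// lerDl.
have norm_eq (v : 'rV[R]_p) : (forall j, j \notin A -> v 0 j = 0) ->
    (u0 *m C *m v^T) 0 0 = (W *m v^T) 0 0.
  move=> /sel_mx_supp vA; congr (_ 0 0).
  rewrite -{1}vA !trmx_mul trmxK /u0 /N.
  have -> : W *m (E^T *m invmx C11 *m E) *m C *m (E^T *m (E *m v^T)) =
      W *m E^T *m (invmx C11 *m (E *m C *m E^T)) *m E *m v^T by rewrite !mulmxA.
  rewrite -restr_mxE mulVmx// mulmx1.
  by rewrite -[in RHS]vA !trmx_mul trmxK !mulmxA.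
have close := argmin_close eta0 alpha0 s0 umin (ltW kap2) slope2 Csym (ltW kap2) lam0 lamC
  Ce2 uoff u0off norm_eq uL u0L.
have u0u : `|u0 - u| < dlt.
  rewrite ltNge; apply/negP => h.
  have : lam * dlt ^+ 2 <= lam * `|u0 - u| ^+ 2.
    by rewrite ler_pM2l// lerXn2r// nnegrE// ltW.
  move=> /le_trans/(_ close); apply/negP; rewrite -ltNge.
  have -> : 2 * (p%:R ^+ 2 * (kap / 2) * L * L) + 2 * p%:R * (kap / 2) * L =
      kap / 2 * (Q - 1) by rewrite /Q; ring.
  have -> : lam * dlt ^+ 2 = kap * Q by rewrite /kap divfK// gt_eqF.
  nra.
apply: le_lt_trans u0u; apply: le_trans (norm_restr_le (u0 - u)).
rewrite le_eqVlt; apply/orP; left; apply/eqP; congr (`|_|).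
have -> : restr_row A (u0 - u) = restr_row A u0 - restr_row A u.
  by rewrite !restr_rowE mulmxBl.
congr (_ - _).
  rewrite !restr_rowE /u0 /N -/W.
  by rewrite -!mulmxA sel_mxK mulmx1.
by rewrite !restr_rowE /u -mulmxBl scalemxAl.
Unshelve. all: by end_near. Qed.

End deterministic_oracle.

(** * The score and the oracle property *)

Lemma coord_dotE (R : realType) (k : nat) (u : 'rV[R]_k) j :
  u 0 j = (u *m (delta_mx 0 j : 'rV[R]_k)^T) 0 0.
Proof. by rewrite trmx_delta -colE mxE. Qed.

Section score_asymptotics.
Context {R : realType} {p : nat}.
Variables (x : nat -> 'rV[R]_p) (C : 'M[R]_p).
Hypothesis gramC : forall i j, (gram x n i j / n%:R) @[n --> \oo] --> C i j.

Lemma quad_gram_cvg (u : 'rV[R]_p) :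
  (\sum_(i < n) ((x i *m u^T) 0 0) ^+ 2) / n%:R @[n --> \oo] --> (u *m C *m u^T) 0 0.
Proof.
have quadE (D : 'M[R]_p) : (u *m D *m u^T) 0 0 = \sum_j \sum_i u 0 i * u 0 j * D i j.
  rewrite mxE; apply: eq_bigr => j _; rewrite !mxE mulr_suml.
  by apply: eq_bigr => i _; rewrite mulrAC.
rewrite (_ : (fun n => _) =
    fun n => \sum_j \sum_i u 0 i * u 0 j * (gram x n i j / n%:R)); last first.
  apply/funext => n; rewrite -quad_gram quadE mulr_suml; apply: eq_bigr => j _.
  by rewrite mulr_suml; apply: eq_bigr => i _; rewrite mulrA.
rewrite quadE; apply: cvg_big => [|j _]; first exact: add_continuous.
apply: cvg_big => [|i _]; first exact: add_continuous.
by apply: cvgMl_tmp; exact: gramC.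
Qed.

Lemma term_small (z : nat -> R) (v e : R) : (forall i, 0 <= z i) ->
  (\sum_(i < n) z i) / n%:R @[n --> \oo] --> v -> 0 < e ->
  \forall n \near \oo, forall i, (i < n)%N -> z i <= e * n%:R.
Proof.
move=> z0 /cvgrPdist_le zv e0.
have e40 : 0 < e / 4 by rewrite divr_gt0.
have [N _ HN] := zv _ e40.
near=> n => i iN.
have [iltN|Nlei] := ltnP i N.
  apply: (@le_trans _ _ (\sum_(j < N) z j)).
    by rewrite (bigD1 (Ordinal iltN))//= lerDl sumr_ge0.
  rewrite -ler_pdivrMl//; near: n; exact: nbhs_infty_ger.
have bnd k : (N <= k)%N -> `|v * k%:R - \sum_(j < k) z j| <= e / 4 * k%:R.
  case: k => [_|k Nk]; first by rewrite big_ord0 !mulr0 subr0 normr0.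
  have k0 : 0 < k.+1%:R :> R by rewrite ltr0n.
  rewrite -(ler_pdivrMr _ _ k0) -{2}(gtr0_norm k0) -normfV -normrM mulrBl.
  by rewrite mulfK ?gt_eqF//; exact: HN.
have := bnd i Nlei; have := bnd i.+1 (leq_trans Nlei (leqnSn _)).
rewrite big_ord_recr/= -natr1 !ler_norml; set S := \sum_(j < i) z j.
move=> /andP[h1 _] /andP[_ h2].
have hn : `|v| / (e / 4) <= n%:R by near: n; exact: nbhs_infty_ger.
move: hn; rewrite ler_pdivrMr// => hv; have vv := ler_norm v; have v0 := normr_ge0 v.
have i1n : i%:R + 1 <= n%:R :> R by rewrite natr1 ler_nat.
have h3 : e / 4 * (i%:R + 1) <= e / 4 * n%:R by rewrite ler_pM2l.
have h4 : e / 4 * i%:R <= e / 4 * (i%:R + 1) by rewrite ler_pM2l// lerDl.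
lra.
Unshelve. all: by end_near. Qed.

Let a (u : 'rV[R]_p) n i := (x i *m u^T) 0 0 / Num.sqrt n%:R.

Lemma coef_sqr_cvg (u : 'rV[R]_p) :
  \sum_(i < n) a u n i ^+ 2 @[n --> \oo] --> (u *m C *m u^T) 0 0.
Proof.
rewrite (_ : (fun n => _) = fun n => (\sum_(i < n) ((x i *m u^T) 0 0) ^+ 2) / n%:R).
  exact: quad_gram_cvg.
apply/funext => n; rewrite mulr_suml; apply: eq_bigr => i _.
by rewrite expr_div_n sqr_sqrtr.
Qed.

Lemma coef_small (u : 'rV[R]_p) (e : R) : 0 < e ->
  \forall n \near \oo, forall i, (i < n)%N -> `|a u n i| <= e.
Proof.
move=> e0; have e20 : 0 < e ^+ 2 by rewrite exprn_gt0.
near=> n => i iN.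
have n0 : 0 < n%:R :> R by rewrite ltr0n (leq_ltn_trans _ iN).
have : ((x i *m u^T) 0 0) ^+ 2 <= e ^+ 2 * n%:R.
  move: i iN; near: n.
  exact: (term_small (fun i => sqr_ge0 _) (@quad_gram_cvg u) e20).
move=> h; rewrite -ler_sqr ?nnegrE ?(ltW e0)// real_normK ?num_real// /a.
by rewrite expr_div_n sqr_sqrtr ?(ltW n0)// ler_pdivrMr.
Unshelve. all: by end_near. Qed.

Section score_law.
Context {d : measure_display} {T : measurableType d}.
Variables (P : probability T R) (eps : nat -> T -> R) (sigma : R).
Hypothesis meps : forall i, measurable_fun setT (eps i).
Hypothesis eps_indep : mutually_independent P eps.
Hypothesis eps_ident : identically_distributed P eps.
Hypothesis eps_L2 : forall i, eps i \in Lfun P 2%:E.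
Hypothesis eps_mean : forall i, ('E_P[eps i] = 0)%E.
Hypothesis eps_var : forall i, 'V_P[eps i] = (sigma ^+ 2)%:E.

Local Notation W n w := (score x n (fun i => eps i w)).

Lemma score_wsum n w (u : 'rV[R]_p) : (W n w *m u^T) 0 0 = wsum eps (a u n) n w.
Proof. by rewrite score_dot; apply: eq_bigr => i _; rewrite /a mulrC mulrA mulrAC. Qed.

Lemma score_coord n w j : W n w 0 j = wsum eps (a (delta_mx 0 j) n) n w.
Proof. by rewrite -score_wsum -coord_dotE. Qed.

Lemma measurable_score n : measurable_coords (fun w => W n w).
Proof.
move=> j; rewrite (_ : (fun _ => _) = wsum eps (a (delta_mx 0 j) n) n).
  exact: measurable_wsum.
by apply/funext => w; rewrite score_coord.
Qed.

Lemma score_cos (u : 'rV[R]_p) (c : R) :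
  \int[P]_w cos ((W n w *m u^T) 0 0 + c) @[n --> \oo] -->
  expR (- (sigma ^+ 2 * (u *m C *m u^T) 0 0 / 2)) * cos c.
Proof.
rewrite (_ : (fun n => _) = fun n => \int[P]_w cos (wsum eps (a u n) n w + c)).
  apply: (clt_cos meps eps_indep eps_ident eps_L2 eps_mean eps_var).
    by move=> e; exact: coef_small.
  exact: coef_sqr_cvg.
by apply/funext => n; apply: eq_Rintegral => w _; rewrite score_wsum.
Qed.

Lemma score_ball_measurable n (M : R) : 0 <= M -> measurable [set w | `|W n w| <= M].
Proof.
move=> M0.
rewrite (_ : [set w | _] = \bigcap_(j in [set: 'I_p]) [set w | `|W n w 0 j| <= M]).
  apply: fin_bigcap_measurable => // j _.
  rewrite (_ : [set w | _] = (fun w => `|W n w 0 j|) @^-1` `]-oo, M]%classic).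
    rewrite -[X in measurable X]setTI; apply: measurableT_comp => //.
    exact: measurable_score.
  by apply/seteqP; split => w /=; rewrite in_itv.
apply/seteqP; split => w /= wM.
  by move=> j _; apply: (proj1 (norm_le_coord (W n w) M0)).
by apply: (proj2 (norm_le_coord (W n w) M0)) => j; exact: wM.
Qed.

Lemma score_tight (e : R) : 0 < e ->
  exists2 M : R, 0 < M & \forall n \near \oo, (P (~` [set w | (`|W n w| <= M)%R]) <= e%:E)%E.
Proof.
move=> e0; pose K := sigma ^+ 2 * (\sum_j (C j j + 1)).
pose M := Num.sqrt (`|K| / e) + 1.
have M0 : 0 < M by rewrite ltr_wpDl// sqrtr_ge0.
have KM : K / M ^+ 2 <= e.
  rewrite ler_pdivrMr ?exprn_gt0// (le_trans (ler_norm K))//.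
  rewrite mulrC -ler_pdivrMr// -[leLHS]sqr_sqrtr ?divr_ge0//; last exact: ltW.
  by rewrite ler_sqr ?nnegrE ?sqrtr_ge0 ?(ltW M0)// /M lerDl.
have dC (j : 'I_p) (dj := delta_mx 0 j : 'rV[R]_p) : (dj *m C *m dj^T) 0 0 = C j j.
  by rewrite /dj -(rowE j C) trmx_delta -colE !mxE.
exists M => //; near=> n.
apply: (@le_trans _ _ (\sum_(j \in [set: 'I_p])
    P [set w | (M <= `|wsum eps (a (delta_mx 0 j) n) n w|)%R]))%E.
  apply: content_sub_fsum.
  - exact: finite_finset.
  - move=> j _.
    rewrite (_ : [set w | _] = (fun w => `|wsum eps (a (delta_mx 0 j) n) n w|) @^-1` `[M, +oo[%classic).
      rewrite -[X in measurable X]setTI; apply: measurableT_comp => //.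
      exact: measurable_wsum.
    by apply/seteqP; split => w /=; rewrite in_itv/= andbT.
  - by apply: measurableC; apply: score_ball_measurable; exact: ltW.
  - move=> w /= wM; apply: contrapT => h; apply: wM.
    apply: (proj2 (norm_le_coord (W n w) (ltW M0))) => j.
    rewrite leNgt; apply/negP => hj; apply: h; exists j => //=.
    by rewrite -score_coord ltW.
rewrite (_ : [set: 'I_p] = [set` enum 'I_p]); last first.
  by apply/seteqP; split => j //= _; rewrite mem_enum.
rewrite -fsbig_seq ?enum_uniq//= big_enum/=.
apply: (@le_trans _ _ (\sum_j (sigma ^+ 2 * (C j j + 1) / M ^+ 2)%R%:E)%E).
  apply: lee_sum => j _.
  apply: le_trans (wsum_tail meps eps_indep eps_L2 eps_mean eps_var _ _ M0) _.
  rewrite lee_fin ler_wpM2r ?invr_ge0 ?exprn_ge0 ?(ltW M0)// ler_wpM2l ?sqr_ge0//.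
  have : `|C j j - \sum_(i < n) a (delta_mx 0 j) n i ^+ 2| <= 1.
    move: j; near: n; apply: near_forall_fin => j; rewrite -dC.
    by have /cvgrPdist_le := @coef_sqr_cvg (delta_mx 0 j); apply.
  rewrite ler_norml => /andP[h _]; lra.
by rewrite sumEFin lee_fin -mulr_suml -mulr_sumr.
Unshelve. all: by end_near. Qed.

End score_law.
End score_asymptotics.

Lemma measurable_support_event (R : realType) (p : nat) d (T : measurableType d)
    (b : T -> 'rV[R]_p) (A : {set 'I_p}) :
  measurable_coords b -> measurable [set w | nzsupp (b w) = A].
Proof.
move=> mb.
rewrite (_ : [set w | _] = \bigcap_(j in [set: 'I_p]) [set w | (b w 0 j != 0) = (j \in A)]).
  apply: fin_bigcap_measurable; first exact: finite_finset.
  move=> j _; have m0 : measurable [set w | b w 0 j = 0].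
    rewrite (_ : [set w | _] = (fun w => b w 0 j) @^-1` [set 0]) //.
    rewrite -[X in measurable X]setTI; exact: mb.
  have [jA|jA] := boolP (j \in A).
    rewrite (_ : [set w | _] = ~` [set w | b w 0 j = 0]); first exact: measurableC.
    by apply/seteqP; split => w /= /eqP.
  rewrite (_ : [set w | _] = [set w | b w 0 j = 0])//.
  apply/seteqP; split => w /=; first by move=> /negbFE/eqP.
  by move=> ->; rewrite eqxx.
apply/seteqP; split => w /=; first by move=> <- j _; rewrite inE.
by move=> h; apply/setP => j; rewrite -h// inE.
Qed.

Lemma cvg_probability1 (R : realType) d (T : measurableType d) (P : probability T R)
    (E : nat -> set T) :
  (forall n, measurable (E n)) ->
  (forall e : R, 0 < e -> \forall n \near \oo, exists B : set T,
    [/\ measurable B, (P (~` B) <= e%:E)%E & B `<=` E n]) ->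
  P (E n) @[n --> \oo] --> 1%E.
Proof.
move=> mE H; apply/fine_cvgP; split; first by near=> n; exact: fin_num_measure.
apply/cvgrPdist_le => e e0; move: (H e e0); apply: filterS => n [B [mB PB BE]].
have : (P (~` E n) <= e%:E)%E.
  apply: le_trans PB; apply: le_measure; rewrite ?inE; try exact: measurableC.
  by apply: subsetC.
have PE : P (E n) = (fine (P (E n)))%:E by rewrite fineK// fin_num_measure.
rewrite probability_setC// PE -EFinB lee_fin => h.
rewrite ger0_norm ?subr_ge0//.
by rewrite -lee_fin -PE probability_le1.
Unshelve. all: by end_near. Qed.

Theorem theorem4 (R : realType) (d : measure_display) (T : measurableType d)
  (P : probability T R) (p : nat)
  (x : nat -> 'rV[R]_p) (bstar : 'rV[R]_p) (eps : nat -> T -> R) (sigma : R)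
  (C : 'M[R]_p) (eta alpha : nat -> R) (c3 : R)
  (btilde : nat -> T -> 'rV[R]_p) :
  (forall i, measurable_fun setT (eps i)) ->
  mutually_independent P eps ->
  identically_distributed P eps ->
  (forall i, eps i \in Lfun P 2%:E) ->
  (forall i, ('E_P[eps i] = 0)%E) ->
  (forall i, 'V_P[eps i] = (sigma ^+ 2)%:E) ->
  (forall i j, (gram x n i j / n%:R) @[n --> \oo] --> C i j) ->
  posdef C ->
  (eta n / (n%:R `^ (3 / 4 : R))) @[n --> \oo] --> 0 ->
  (eta n / Num.sqrt n%:R) @[n --> \oo] --> +oo ->
  (alpha n / Num.sqrt n%:R) @[n --> \oo] --> c3 ->
  0 < c3 ->
  (forall n j, measurable_fun setT (fun w => btilde n w 0 j)) ->
  (\forall n \near \oo, forall w (b : 'rV[R]_p),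
     objective n x (fun i => (x i *m bstar^T) 0 0 + eps i w) (eta n) (alpha n)
       (btilde n w) <=
     objective n x (fun i => (x i *m bstar^T) 0 0 + eps i w) (eta n) (alpha n) b) ->
  (P [set w | nzsupp (btilde n w) = nzsupp bstar]) @[n --> \oo] --> 1%E /\
  cvg_in_law_normal P
    (fun n w => Num.sqrt n%:R *:
       (restr_row (nzsupp bstar) (btilde n w) - restr_row (nzsupp bstar) bstar))
    (sigma ^+ 2 *: invmx (restr_mx (nzsupp bstar) C)).
Proof.
move=> meps eps_indep eps_ident eps_L2 eps_mean eps_var gramC Cpd eta34 eta12 alpha12 c30.
move=> mbt bmin; set A := nzsupp bstar.
set C11 := restr_mx A C.
have C11pd : posdef C11 by exact: posdef_restr.
have C11u : C11 \in unitmx by exact: posdef_unitmx.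
have Spd := posdef_invmx C11pd; have [Ssym Spos] := Spd.
pose W n w := score x n (fun i => eps i w).
have oracle M dlt : 0 < M -> 0 < dlt -> \forall n \near \oo, forall w, `|W n w| <= M ->
    nzsupp (btilde n w) = A /\ `|restr_row A (W n w) *m invmx C11 -
      Num.sqrt n%:R *: (restr_row A (btilde n w) - restr_row A bstar)| < dlt.
  move=> M0 dlt0; move: bmin (lasso_oracle bstar gramC Cpd eta34 eta12 alpha12 c30 M0 dlt0).
  by apply: filterS2 => n bn H w; apply: H; exact: bn.
have mWM n M : 0 <= M -> measurable [set w | `|W n w| <= M].
  exact: score_ball_measurable.
split.
  apply: cvg_probability1 => [n|e e0].
    by apply: measurable_support_event; exact: mbt.
  have [M M0 PM] := score_tight gramC meps eps_indep eps_L2 eps_mean eps_var e0.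
  have := oracle M 1 M0 ltr01; move: PM; apply: filterS2 => n PM H.
  exists [set w | `|W n w| <= M]; split => //; first exact/mWM/ltW.
  by move=> w /H[].
have [d' [T' [Q [G GS]]]] := gaussian_vector_exists sigma Spd.
exists d', T', Q, G; split => //; have [mG HG] := GS.
have [k0 k00 WN] : exists2 k0 : R, 0 <= k0 & forall n w,
    `|restr_row A (W n w) *m invmx C11| <= k0 * `|W n w|.
  exists (#|A|%:R * `|invmx C11|); first by rewrite mulr_ge0.
  move=> n w; apply: (le_trans (norm_mulmx_le (c := `|invmx C11|) _ _ _)) => //.
    by move=> i j; exact: norm_entry_le.
  by rewrite ler_wpM2l ?mulr_ge0// norm_restr_le.
have dotE n w (t : 'rV[R]_#|A|) : (restr_row A (W n w) *m invmx C11 *m t^T) 0 0 =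
    (W n w *m (t *m invmx C11 *m sel_mx A)^T) 0 0.
  by rewrite restr_rowE !trmx_mul Ssym !mulmxA.
apply: (@cvg_in_law_of_cos _ _ _ _ _ _ P Q (fun n w => restr_row A (W n w) *m invmx C11)) => //.
- move=> n j; pose dj : 'rV[R]_#|A| := delta_mx 0 j.
  have -> : (fun w => (restr_row A (W n w) *m invmx C11) 0 j) =
      (fun w => (W n w *m (dj *m invmx C11 *m sel_mx A)^T) 0 0).
    by apply/funext => w; rewrite -dotE coord_dotE.
  exact: (measurable_dot _ (measurable_score x meps n)).
- move=> n j.
  have -> : (fun w => (Num.sqrt n%:R *: (restr_row A (btilde n w) - restr_row A bstar)) 0 j) =
      (fun w => Num.sqrt n%:R * (btilde n w 0 (enum_val j) - bstar 0 (enum_val j))).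
    by apply/funext => w; rewrite !mxE.
  by apply: measurable_funM => //; apply: measurable_funB => //; exact: mbt.
- move=> t c.
  have tSt : (t *m invmx C11 *m sel_mx A *m C *m (t *m invmx C11 *m sel_mx A)^T) 0 0 =
      (t *m invmx C11 *m t^T) 0 0.
    congr (_ 0 0); rewrite !trmx_mul Ssym.
    have -> : t *m invmx C11 *m sel_mx A *m C *m ((sel_mx A)^T *m (invmx C11 *m t^T)) =
        t *m (invmx C11 *m (sel_mx A *m C *m (sel_mx A)^T)) *m invmx C11 *m t^T.
      by rewrite !mulmxA.
    by rewrite -restr_mxE mulVmx// mulmx1.
  have tSt0 : 0 <= (t *m invmx C11 *m t^T) 0 0.
    have [->|t0] := eqVneq t 0; first by rewrite !mul0mx mxE.
    exact/ltW/Spos.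
  have vE : (t *m (sigma ^+ 2 *: invmx C11) *m t^T) 0 0 =
      sigma ^+ 2 * (t *m invmx C11 *m t^T) 0 0.
    by rewrite -scalemxAr -scalemxAl mxE.
  have v0 : 0 <= (t *m (sigma ^+ 2 *: invmx C11) *m t^T) 0 0.
    by rewrite vE mulr_ge0// sqr_ge0.
  rewrite (normal_law_cos c (measurable_dot t mG) v0 (HG t)) vE -tSt.
  rewrite (_ : (fun n => _) = fun n => \int[P]_w
      cos ((W n w *m (t *m invmx C11 *m sel_mx A)^T) 0 0 + c)).
    exact: (score_cos gramC meps eps_indep eps_ident eps_L2 eps_mean eps_var).
  by apply/funext => n; apply: eq_Rintegral => w _; rewrite dotE.
- move=> e e0.
  have [M M0 PM] := score_tight gramC meps eps_indep eps_L2 eps_mean eps_var e0.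
  exists (k0 * M) => dlt dlt0.
  have := oracle M dlt M0 dlt0; move: PM; apply: filterS2 => n PM H.
  exists [set w | `|W n w| <= M]; split => //; first exact/mWM/ltW.
  move=> w /= WM; split; last by have [] := H w WM.
  by rewrite (le_trans (WN n w))// ler_wpM2l.
Unshelve. all: by end_near. Qed.
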